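(* Let $M^n$ be a complete, connected, orientable Riemannian manifold of dimension $n\geq 3$ with constant (normalized) scalar curvature $R$, and let $f:M^n\to\mathbb R^{n+1}$ be an isometric immersion with non-zero constant mean curvature $H$. If $HH_3\geq 0$ (at every point of $M^n$), where $H_3$ is the third mean curvature, and $0\leq R\leq\frac{nH^2}{2(n-1)}$, then $R=0$ or $R=\frac{nH^2}{2(n-1)}$. In case that $R=0$, $f(M^n)=\mathbb R^{n-1}\times\mathbb S^1\big(\frac{1}{n|H|}\big)$, and in case that $R=\frac{nH^2}{2(n-1)}$, $f(M^n)=\mathbb R^{n-2}\times\mathbb S^2\big(\frac{2}{n|H|}\big)$ (equalities of subsets of $\mathbb R^{n+1}$ up to a rigid motion of $\mathbb R^{n+1}$).
   Context: Manifolds and immersions are smooth. For an isometric immersion $f:M^n\to\mathbb R^{n+1}$ of an orientable Riemannian manifold, let $A$ be the shape operator with respect to a global unit normal vector field $\xi$ and let $\lambda_1,\ldots,\lambda_n$ be its eigenvalues (the principal curvatures). For $1\leq r\leq n$, the $r$-th mean curvature $H_r$ is defined by $\binom{n}{r}H_r=\sum_{i_1<\cdots<i_r}\lambda_{i_1}\cdots\lambda_{i_r}$, and the mean curvature is $H=H_1=\frac1n\sum_i\lambda_i$. The scalar curvature $R$ is normalized: for an orthonormal basis $\{e_1,\ldots,e_n\}$ of $T_pM$, $R=\binom{n}{2}^{-1}\sum_{i<j}K(e_i,e_j)$, where $K(e_i,e_j)$ is the sectional curvature of the plane spanned by $e_i,e_j$; by the Gauss equation $R=H_2$. $\mathbb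 S^k(r)$ denotes the round $k$-sphere of radius $r$ in $\mathbb R^{k+1}$, and $\mathbb R^{n-k}\times\mathbb S^k(r)\subset\mathbb R^{n-k}\times\mathbb R^{k+1}=\mathbb R^{n+1}$ is the standard generalized cylinder. *)

(* Defs.v *)
From mathcomp Require Import all_boot all_order all_algebra.
From mathcomp Require Import all_classical all_reals all_analysis.
Set Implicit Arguments.
Unset Strict Implicit.
Unset Printing Implicit Defensive.
Import Order.TTheory GRing.Theory Num.Theory.
Import numFieldNormedType.Exports.
Local Open Scope classical_set_scope.
Local Open Scope ring_scope.

(* R^n is 'rV[R]_n. Tangent vectors are row vectors of coordinates in a chart,
   and linear maps act on the right: 'D_v f x = v *m 'J f x when f is
   differentiable at x, so row i of 'J f x is the i-th partial derivative. *)

Section Calculus.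
Variables (R : realType) (n : nat).
Implicit Types (i : 'I_n) (x : 'rV[R]_n).

Definition partial (W : normedModType R) i (f : 'rV[R]_n -> W) : 'rV[R]_n -> W :=
  fun x => 'D_(delta_mx 0 i) f x.

Definition iter_partial (W : normedModType R) (s : seq 'I_n)
    (f : 'rV[R]_n -> W) : 'rV[R]_n -> W :=
  foldr (fun i h => partial i h) f s.

(* C^oo on an open set U: all iterated partial derivatives exist and are
   continuous. *)
Definition smooth_on (W : normedModType R) (U : set 'rV[R]_n)
    (f : 'rV[R]_n -> W) :=
  forall (s : seq 'I_n) x, U x ->
    {for x, continuous (iter_partial s f)} /\
    forall i, derivable (iter_partial s f) x (delta_mx 0 i).

End Calculus.

(* chart_fun and chart_inv are total functions; only their values on chart_dom
   and chart_img are meaningful. *)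
Record chart (R : realType) (n : nat) (T : topologicalType) := Chart {
  chart_dom : set T;
  chart_img : set 'rV[R]_n;
  chart_fun : T -> 'rV[R]_n;
  chart_inv : 'rV[R]_n -> T;
  chart_dom_open : open chart_dom;
  chart_img_open : open chart_img;
  chart_fun_img : forall p, chart_dom p -> chart_img (chart_fun p);
  chart_inv_dom : forall x, chart_img x -> chart_dom (chart_inv x);
  chart_funK : forall p, chart_dom p -> chart_inv (chart_fun p) = p;
  chart_invK : forall x, chart_img x -> chart_fun (chart_inv x) = x;
  chart_fun_continuous : forall p, chart_dom p -> {for p, continuous chart_fun};
  chart_inv_continuous : forall x, chart_img x -> {for x, continuous chart_inv}
}.

Section Atlas.
Variables (R : realType) (n : nat) (T : topologicalType).
Implicit Types (c d : chart R n T) (A : set (chart R n T)).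

Definition transition_dom c d : set 'rV[R]_n :=
  [set x | chart_img c x /\ chart_dom d (chart_inv c x)].

Definition transition c d : 'rV[R]_n -> 'rV[R]_n :=
  fun x => chart_fun d (chart_inv c x).

Definition smooth_atlas A :=
  (forall p, exists2 c, A c & chart_dom c p) /\
  (forall c d, A c -> A d -> smooth_on (transition_dom c d) (transition c d)).

End Atlas.

Record manifold (R : realType) (n : nat) := Manifold {
  points :> topologicalType;
  atlas : set (chart R n points);
  manifold_hausdorff : hausdorff_space points;
  manifold_second_countable : @second_countable points;
  atlas_smooth : smooth_atlas atlas
}.
Arguments atlas {R n} _.

Definition orientable (R : realType) (n : nat) (M : manifold R n) :=
  exists A : set (chart R n M),
    [/\ smooth_atlas A, smooth_atlas (atlas M `|` A) &
        forall c d, A c -> A d -> forall x, transition_dom c d x ->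
          0 < \det ('J (transition c d) x)].

Definition inner (R : realType) (n : nat) (G : 'M[R]_n) (u v : 'rV[R]_n) : R :=
  (u *m G *m v^T) 0 0.

(* metric c x is the Gram matrix, in the chart c, of the metric at the point of
   coordinates x. *)
Record riemannian_manifold (R : realType) (n : nat) := RiemannianManifold {
  base_manifold :> manifold R n;
  metric : chart R n base_manifold -> 'rV[R]_n -> 'M[R]_n;
  metric_smooth : forall c, atlas base_manifold c ->
    smooth_on (chart_img c) (metric c);
  metric_sym : forall c x, atlas base_manifold c -> chart_img c x ->
    (metric c x)^T = metric c x;
  metric_pos : forall c x v, atlas base_manifold c -> chart_img c x ->
    v != 0 -> 0 < inner (metric c x) v v;
  metric_transition : forall c d x,
    atlas base_manifold c -> atlas base_manifold d -> transition_dom c d x ->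
    metric c x = 'J (transition c d) x *m metric d (transition c d x)
                   *m ('J (transition c d) x)^T
}.

(* Local formulas for a metric g on an open subset of R^n. *)
Section LocalGeometry.
Variables (R : realType) (n : nat) (g : 'rV[R]_n -> 'M[R]_n).
Implicit Types (i j k l : 'I_n) (x u v w : 'rV[R]_n).

Definition dmetric i j k x : R := partial i (fun y => g y j k : R^o) x.

(* christoffel i j k is Gamma_{ij}^k *)
Definition christoffel i j k x : R :=
  2^-1 * \sum_l invmx (g x) k l *
           (dmetric i j l x + dmetric j i l x - dmetric l i j x).

(* The component along d_l of Rm(d_i, d_j) d_k, where
   Rm(X, Y) Z = nabla_X nabla_Y Z - nabla_Y nabla_X Z - nabla_[X, Y] Z. *)
Definition riemann i j k l x : R :=
  partial i (christoffel j k l : _ -> R^o) x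
  - partial j (christoffel i k l : _ -> R^o) x
  + \sum_m (christoffel j k m x * christoffel i m l x
            - christoffel i k m x * christoffel j m l x).

Definition curvature_op x u v w : 'rV[R]_n :=
  \row_l \sum_i \sum_j \sum_k u 0 i * v 0 j * w 0 k * riemann i j k l x.

Definition sectional_curvature x u v : R :=
  inner (g x) (curvature_op x u v v) u /
  (inner (g x) u u * inner (g x) v v - inner (g x) u v ^+ 2).

End LocalGeometry.

Section Riemannian.
Variables (R : realType) (n : nat) (M : riemannian_manifold R n).

(* S is the normalized scalar curvature of M at p; the rows of E form an
   orthonormal basis of the tangent space. *)
Definition is_scalar_curvature (p : M) (S : R) :=
  forall c, atlas M c -> chart_dom c p ->
  let x := chart_fun c p in
  forall E : 'M[R]_n, E *m metric c x *m E^T = 1%:M ->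
    S = ('C(n, 2)%:R)^-1 *
        \sum_(i < n) \sum_(j < n | (i < j)%N)
           sectional_curvature (metric c) x (row i E) (row j E).

Definition is_geodesic (gam : R -> M) :=
  continuous gam /\
  forall t c, atlas M c -> chart_dom c (gam t) ->
    let x := (fun s => chart_fun c (gam s)) : R -> 'rV[R]_n in
    [/\ derivable x t 1, derivable (derive1 x) t 1 &
        forall k, (derive1n 2 x t) 0 k +
          \sum_i \sum_j christoffel (metric c) i j k (x t) *
                        (derive1 x t) 0 i * (derive1 x t) 0 j = 0].

(* Geodesic completeness (for connected M, by Hopf-Rinow, the same as metric
   completeness of the Riemannian distance). *)
Definition complete_manifold :=
  forall (p : M) c (v : 'rV[R]_n), atlas M c -> chart_dom c p ->
  exists gam : R -> M,
    [/\ is_geodesic gam, gam 0 = p &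
        derive1 (fun s => chart_fun c (gam s)) 0 = v].

Definition local_expr (m : nat) (f : M -> 'rV[R]_m) (c : chart R n M) :
    'rV[R]_n -> 'rV[R]_m :=
  fun x => f (chart_inv c x).

Definition smooth_map (m : nat) (f : M -> 'rV[R]_m) :=
  forall c, atlas M c -> smooth_on (chart_img c) (local_expr f c).

Definition isometric_immersion (m : nat) (f : M -> 'rV[R]_m) :=
  smooth_map f /\
  forall c x, atlas M c -> chart_img c x ->
    let J := 'J (local_expr f c) x in
    row_free J /\ J *m J^T = metric c x.

Definition unit_normal_field (f xi : M -> 'rV[R]_n.+1) :=
  [/\ smooth_map xi,
      forall p, xi p *m (xi p)^T = 1%:M &
      forall c x, atlas M c -> chart_img c x ->
        'J (local_expr f c) x *m (local_expr xi c x)^T = 0].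

(* The Weingarten formula d xi (v) = - df (A v), with A acting on row vectors
   of coordinates in the chart c at the point of coordinates x. *)
Definition is_shape_operator (f xi : M -> 'rV[R]_n.+1) (c : chart R n M)
    (x : 'rV[R]_n) (A : 'M[R]_n) :=
  'J (local_expr xi c) x = - (A *m 'J (local_expr f c) x).

(* lam lists the eigenvalues of the shape operator at p, with multiplicity. *)
Definition principal_curvatures (f xi : M -> 'rV[R]_n.+1) (p : M)
    (lam : 'rV[R]_n) :=
  forall c, atlas M c -> chart_dom c p ->
  exists2 A : 'M[R]_n, is_shape_operator f xi c (chart_fun c p) A &
    char_poly A = \prod_(i < n) ('X - (lam 0 i)%:P).

End Riemannian.

Definition mean_curvature (R : realType) (n : nat) (r : nat) (lam : 'rV[R]_n) : R :=
  ('C(n, r)%:R)^-1 * \sum_(I : {set 'I_n} | #|I| == r) \prod_(i in I) lam 0 i.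

(* R^(n-k) x S^k(r) inside R^(n-k) x R^(k+1) = R^(n+1), for k <= n *)
Definition cylinder (R : realType) (n k : nat) (r : R) : set 'rV[R]_n.+1 :=
  [set x : 'rV[R]_n.+1 | \sum_(j < n.+1 | (n - k <= j)%N) x 0 j ^+ 2 = r ^+ 2].
Arguments cylinder {R} n k r _.

Definition rigid_motion (R : realType) (m : nat) (T : 'rV[R]_m -> 'rV[R]_m) :=
  exists (Q : 'M[R]_m) (b : 'rV[R]_m),
    Q *m Q^T = 1%:M /\ forall x, T x = x *m Q + b.

(* Main.v *)
From HB Require Import structures.
Require Import Defs.
From mathcomp Require Import all_boot all_order all_algebra.
From mathcomp Require Import all_classical all_reals all_analysis.
From mathcomp Require Import ring lra.
Import Order.TTheory GRing.Theory Num.Theory.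
Import numFieldNormedType.Exports.
Local Open Scope classical_set_scope.
Local Open Scope ring_scope.
Set Implicit Arguments.
Unset Strict Implicit.
Unset Printing Implicit Defensive.

(* Idea: let h be the second fundamental form, p_i the i-th power sum of the
   principal curvatures and e_i their elementary symmetric functions. As H and S
   are constant, so are p_1 and p_2, and Simons' formula reduces to
     |nabla h|^2 = p_2^2 - p_1 p_3 = e_2 (4 e_2 - e_1^2) - 3 e_1 e_3 <= 0
   pointwise, by the hypotheses on S and H_3. Hence nabla h = 0 and
   e_2 (4 e_2 - e_1^2) = 0; the Ricci identity then gives p_1 h^2 = p_2 h.
   So the span W of the normal and of the curved directions is the same at every
   point and f - (p_1 / p_2) xi has a constant component in W, which puts f(M)
   inside a cylinder. Conversely, geodesics of M are mapped to helices of this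
   cylinder, and completeness makes f onto.
   Tensors are handled extrinsically: grad_a u ([tgrad a u] below), the a-th
   ambient component of the tangential gradient of u, satisfies grad_a nu_b = h_ab (symmetric, with
   h nu = 0), nu_a grad_a = 0 and
     [grad_d, grad_c] u = sum_a (nu_d h_ca - nu_c h_da) grad_a u,
   so no Christoffel symbols are needed, except to relate S to h. *)

(** * Partial derivatives *)

(** The Simons identity is half the Laplacian of |h|^2, namely |nabla h|^2 + <h, Delta h>, set equal
    to zero: constancy of p_2 kills the Laplacian of |h|^2, and constancy of p_1 removes the Hessian
    of the mean curvature from Delta h. Once nabla h = 0, also Delta h = 0, which is how the
    quadratic relation between h^2 and h arises: h has only one nonzero eigenvalue, p_2 / p_1. Its
    multiplicity is the trace of h divided by it, p_1^2 / p_2, hence 1 if e_2 = 0 and 2 if 4 e_2 =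
    e_1^2; this is where the circle and the 2-sphere come from. Its inverse p_1 / p_2 is the signed
    radius, so f - (p_1 / p_2) xi is the centre of curvature. Here h is the derivative of the unit
    normal, that is, minus the shape operator, so that p_1 = - n H. Congruence with the cylinder is
    explicit: the projection onto W and the centre are written in terms of h, xi and f, and their
    derivatives are shown to vanish, which reduces the global statement to connectedness. *)

Section DirectionalDerivatives.
Variables (R : realType) (V W : normedModType R).

Lemma is_derive_line (f : V -> W) (x v : V) (t : R) :
  derivable f (x + t *: v) v ->
  is_derive t 1 (fun s : R => f (x + s *: v)) ('D_v f (x + t *: v)).
Proof.
have E : (fun h : R => h^-1 *: (((fun s : R => f (x + s *: v)) \o shift t) (h *: 1)
            - f (x + t *: v))) =
         (fun h : R => h^-1 *: ((f \o shift (x + t *: v)) (h *: v) - f (x + t *: v))).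
  apply/funext => h /=; congr (_ *: (f _ - _)).
  by rewrite [h *: 1]mulr1 scalerDl addrCA.
by move=> df; split; rewrite /derivable /derive E.
Qed.

Lemma is_derive_translate (f : V -> W) (x v w : V) (l : W) :
  is_derive (x + w) v f l -> is_derive x v (fun y => f (y + w)) l.
Proof.
have E : (fun h : R => h^-1 *: (((fun y => f (y + w)) \o shift x) (h *: v) - f (x + w))) =
         (fun h : R => h^-1 *: ((f \o shift (x + w)) (h *: v) - f (x + w))).
  by apply/funext => h /=; rewrite addrA.
by move=> [df dfE]; split; move: df dfE; rewrite /derivable /derive E.
Qed.

End DirectionalDerivatives.

Section ScalarMVT.
Variables (R : realType) (V : normedModType R).

(** Stated with absolute values because [a] will be a coordinate of a vector, of either sign. *)
Lemma directional_MVT (u : V -> R^o) (x v : V) (a : R) :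
  (forall t : R, `|t| <= `|a| -> derivable u (x + t *: v) v) ->
  exists2 c, `|c| <= `|a| & u (x + a *: v) - u x = a * 'D_v u (x + c *: v).
Proof.
move=> du; pose g := fun s : R => u (x + s *: v) : R.
have dg (t : R) : `|t| <= `|a| -> is_derive t 1 g ('D_v u (x + t *: v)).
  by move=> ta; apply: is_derive_line; exact: du.
have cg (t : R) : `|t| <= `|a| -> {for t, continuous g}.
  by move=> /dg[+ _] => /derivable1_diffP; exact: differentiable_continuous.
have g0 : g 0 = u x by rewrite /g scale0r addr0.
have [a0|a0|a0] := ltgtP a 0.
- have B t : t \in `[a, 0] -> `|t| <= `|a|.
    by rewrite in_itv /= => /andP[at0 t0]; rewrite !ler0_norm ?lerN2// ltW.
  have [||c ca E] := @MVT _ g (fun t => 'D_v u (x + t *: v)) a 0 a0.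
  + by move=> t ta; apply: dg; apply: B; apply: subset_itv_oo_cc.
  + apply: continuous_in_subspaceT => t; rewrite inE => ta; apply: cg; exact: B.
  exists c; first by apply: B; apply: subset_itv_oo_cc.
  by rewrite -g0 -opprB E sub0r mulrN opprK mulrC.
- have B t : t \in `[0, a] -> `|t| <= `|a|.
    by rewrite in_itv /= => /andP[t0 ta]; rewrite !ger0_norm// ltW.
  have [||c ca E] := @MVT _ g (fun t => 'D_v u (x + t *: v)) 0 a a0.
  + by move=> t ta; apply: dg; apply: B; apply: subset_itv_oo_cc.
  + apply: continuous_in_subspaceT => t; rewrite inE => ta; apply: cg; exact: B.
  exists c; first by apply: B; apply: subset_itv_oo_cc.
  by rewrite -g0 E subr0 mulrC.
- by exists 0; rewrite ?normr0// a0 scale0r addr0 subrr mul0r.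
Qed.

End ScalarMVT.

Section Partials.
Variables (R : realType) (n : nat).
Implicit Types (x h : 'rV[R]_n) (u : 'rV[R]_n -> R^o).

Lemma row_coord_le x i : `|x 0 i| <= `|x|.
Proof.
by rewrite [leRHS]/Num.Def.normr /= mx_normrE; apply/bigmax_geP; right => /=; exists (0, i).
Qed.

Lemma row_norm_le x (e : R) : 0 <= e -> (forall i, `|x 0 i| <= e) -> `|x| <= e.
Proof.
move=> e0 H; rewrite [leLHS]/Num.Def.normr /= mx_normrE; apply/bigmax_leP; split => //.
by move=> [a b] _ /=; rewrite (ord1 a).
Qed.

(** The points [x + truncate_row k h] form a staircase from [x] to [x + h] whose steps are parallel
    to the axes, so that each step involves one partial derivative only. *)
Definition truncate_row (k : nat) h : 'rV[R]_n :=
  \row_j (if (j < k)%N then h 0 j else 0).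

Lemma truncate_rowS h (k : 'I_n) :
  truncate_row k.+1 h = truncate_row k h + h 0 k *: delta_mx 0 k.
Proof.
apply/rowP => j; rewrite !mxE eqxx /= ltnS leq_eqVlt.
have [->|jk] /= := eqVneq j k; first by rewrite eqxx ltnn add0r mulr1.
by rewrite mulr0 addr0 orb_idl // => /eqP /val_inj /eqP; rewrite (negbTE jk).
Qed.

Lemma truncate_row_near h (k : 'I_n) (t : R) :
  `|t| <= `|h 0 k| -> `|truncate_row k h + t *: delta_mx 0 k| <= `|h|.
Proof.
move=> th; apply: row_norm_le => // j; rewrite !mxE eqxx /=.
have [->|jk] /= := eqVneq j k.
  by rewrite ltnn add0r mulr1; apply: le_trans th _; exact: row_coord_le.
by rewrite mulr0 addr0; case: ifP => _; rewrite ?normr0//; exact: row_coord_le.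
Qed.

(** The mean value theorem on each step of the staircase, then a telescoping sum. As the norm is the
    maximum norm, the staircase stays in the closed ball of radius [|h|]. *)
Lemma increment_partials u x (h : 'rV[R]_n) :
  (forall y i, `|y - x| <= `|h| -> derivable u y (delta_mx 0 i)) ->
  exists c : 'I_n -> 'rV[R]_n, (forall i, `|c i - x| <= `|h|) /\
    u (x + h) - u x = \sum_i h 0 i * partial i u (c i).
Proof.
move=> du.
have S (k : 'I_n) : exists c : 'rV[R]_n, `|c - x| <= `|h| /\
    u (x + truncate_row k.+1 h) - u (x + truncate_row k h) = h 0 k * partial k u c.
  have [|c ca E] := @directional_MVT R _ u (x + truncate_row k h) (delta_mx 0 k) (h 0 k).
    move=> t th; apply: du; rewrite addrC !addrA addNr add0r.
    exact: truncate_row_near.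
  exists (x + truncate_row k h + c *: delta_mx 0 k); split.
    by rewrite addrC !addrA addNr add0r; exact: truncate_row_near.
  by rewrite -E truncate_rowS addrA.
have [c Hc] := choice S.
exists c; split; first by move=> i; case: (Hc i).
under eq_bigr do rewrite -(Hc _).2.
rewrite -(big_mkord predT (fun k => u (x + truncate_row k.+1 h) - u (x + truncate_row k h))).
rewrite telescope_sumr //.
congr (u _ - u _); first by congr (_ + _); apply/rowP => j; rewrite mxE ltn_ord.
by rewrite (_ : truncate_row 0 h = 0) ?addr0//; apply/rowP => j; rewrite !mxE.
Qed.

Lemma near_ball_origin x (P : set 'rV[R]_n) : (\forall y \near x, P y) ->
  \forall h \near (0 : 'rV[R]_n), forall y, `|y - x| <= `|h| -> P y.
Proof.
move=> /nbhs_normP[r /= r0 Hr]; apply/nbhs_normP; exists r => //= h.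
rewrite /ball_ /= sub0r normrN => hr y yh; apply: Hr.
by rewrite /ball_ /= distrC; exact: le_lt_trans hr.
Qed.

Lemma continuous_partials_differentiable u x :
  (\forall y \near x, forall i, derivable u y (delta_mx 0 i)) ->
  (forall i, {for x, continuous (partial i u)}) ->
  differentiable u x.
Proof.
move=> du cu.
pose L h : R^o := \sum_i h 0 i * partial i u x.
have Llin : linear L.
  move=> a y z; rewrite /L scaler_sumr -big_split /=; apply: eq_bigr => i _.
  by rewrite !mxE mulrDl -mulrA.
pose LM := GRing.isLinear.Build _ _ _ _ _ Llin.
pose LL : {linear 'rV[R]_n -> R^o} := HB.pack L LM.
have Lc : continuous LL.
  move=> y; apply: differentiable_continuous.
  have -> : (LL : _ -> _) = \sum_i (fun h : 'rV[R]_n => (h 0 i : R^o) * partial i u x).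
    by apply/funext => h; rewrite /LL /= /L fct_sumE.
  by apply: differentiable_sum => i; apply: differentiableM => //; exact: differentiable_coord.
suff E : u \o shift x = cst (u x) + LL +o_ (0 : 'rV[R]_n) id.
  by apply/diff_locallyP; rewrite (diff_unique Lc E).
apply/eqaddoP => e e0.
(* The remainder is a sum of [n] terms, each at most this times [|h|]; [n.+1] avoids a division by
   zero in dimension 0. *)
have e'0 : 0 < e / n.+1%:R by rewrite divr_gt0.
have H1 := near_ball_origin du.
have H2 : \forall h \near (0 : 'rV[R]_n), forall i y, `|y - x| <= `|h| ->
    `|partial i u x - partial i u y| <= e / n.+1%:R.
  suff H i : \forall h \near (0 : 'rV[R]_n), forall y, `|y - x| <= `|h| ->
      `|partial i u x - partial i u y| <= e / n.+1%:R by apply: filter_forall H.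
  have /cvgrPdist_le /(_ _ e'0) := cu i; exact: near_ball_origin.
near=> h => /=.
have H2h : forall i y, `|y - x| <= `|h| ->
    `|partial i u x - partial i u y| <= e / n.+1%:R by near: h.
have H1h : forall y, `|y - x| <= `|h| -> forall i, derivable u y (delta_mx 0 i).
  by near: h.
have [|c [ch E]] := @increment_partials u x h; first by move=> y i /H1h; exact.
rewrite /= -![(_ + _ : _ -> _) _]/(_ + _) -![(- _ : _ -> _) _]/(- _) /cst /=.
rewrite [h + x]addrC opprD addrA E /L -sumrB.
apply: le_trans (ler_norm_sum _ _ _) _.
apply: (@le_trans _ _ (\sum_(i < n) `|h| * (e / n.+1%:R))).
  apply: ler_sum => i _; rewrite -mulrBr normrM; apply: ler_pM => //.
    exact: row_coord_le.
  by rewrite distrC; exact: H2h.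
rewrite sumr_const card_ord -mulrnAr mulrC; apply: ler_wpM2r => //.
by rewrite -mulr_natr -mulrA ger_pMr// mulrC ler_pdivrMr// mul1r ler_nat.
Unshelve. all: by end_near. Qed.

Lemma derive_partials u x v : differentiable u x ->
  'D_v u x = \sum_i v 0 i * partial i u x.
Proof.
move=> du; rewrite deriveE// {1}(row_sum_delta v) linear_sum /=.
by apply: eq_bigr => i _; rewrite linearZ /= /partial deriveE.
Qed.

End Partials.

Section Symmetry.
Variables (R : realType) (n : nat).
Implicit Types (x : 'rV[R]_n) (u : 'rV[R]_n -> R^o).

(** The mean value theorem twice: along [i] for the increment of [u] in direction [j], then along
    [j] for [partial i u]. Both intermediate points are within [2 * s] of [x]. *)
Lemma second_difference u x (i j : 'I_n) (s : R) : 0 < s ->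
  (forall y, `|y - x| <= 2 * s -> derivable u y (delta_mx 0 i)) ->
  (forall y, `|y - x| <= 2 * s -> derivable (partial i u) y (delta_mx 0 j)) ->
  exists2 y, `|y - x| <= 2 * s &
    u (x + s *: delta_mx 0 i + s *: delta_mx 0 j) - u (x + s *: delta_mx 0 i)
    - u (x + s *: delta_mx 0 j) + u x = s ^+ 2 * partial j (partial i u) y.
Proof.
move=> s0 du ddu.
have e1 k (c : R) : `|c| <= s -> `|c *: (delta_mx 0 k : 'rV[R]_n)| <= s.
  move=> cs; apply: row_norm_le => [|l]; first exact: ltW.
  by rewrite !mxE eqxx /= normrM; case: eqP => _; rewrite ?normr1 ?mulr1// normr0 mulr0 ltW.
have near2 (c d : R) : `|c| <= s -> `|d| <= s ->
    `|x + c *: delta_mx 0 i + d *: delta_mx 0 j - x| <= 2 * s.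
  move=> cs ds; rewrite addrC !addrA addNr add0r mulr2n mulrDl mul1r.
  by apply: le_trans (ler_normD _ _) _; apply: lerD; exact: e1.
have ss : `|s| <= s by rewrite gtr0_norm.
have s00 : `|0 : R| <= s by rewrite normr0 ltW.
pose phi y : R^o := u (y + s *: delta_mx 0 j) - u y.
have dphi (c : R) : `|c| <= `|s| ->
   is_derive (x + c *: delta_mx 0 i) (delta_mx 0 i) phi
     (partial i u (x + c *: delta_mx 0 i + s *: delta_mx 0 j) -
      partial i u (x + c *: delta_mx 0 i)).
  rewrite (gtr0_norm s0) => cs; apply: is_deriveB.
    by apply: is_derive_translate; apply/derivableP/du; exact: near2.
  apply/derivableP/du; have := near2 c 0 cs s00; by rewrite scale0r addr0.
have [|c cs E1] := @directional_MVT R _ phi x (delta_mx 0 i) s.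
  by move=> t /dphi[].
have [_ Dphi] := dphi _ cs.
rewrite Dphi in E1.
rewrite (gtr0_norm s0) in cs.
have [|d ds E2] := @directional_MVT R _ (partial i u) (x + c *: delta_mx 0 i) (delta_mx 0 j) s.
  by move=> t; rewrite (gtr0_norm s0) => ts; apply: ddu; exact: near2.
rewrite (gtr0_norm s0) in ds.
exists (x + c *: delta_mx 0 i + d *: delta_mx 0 j); first exact: near2.
rewrite E2 in E1; rewrite expr2 -mulrA -E1 /phi; ring.
Qed.

(** The second difference is symmetric in [i] and [j], so arbitrarily close to [x] the two mixed
    derivatives take a common value, though at different points; continuity brings both points to
    [x]. *)
Lemma partialC u x (i j : 'I_n) :
  (\forall y \near x, forall k, derivable u y (delta_mx 0 k)) ->
  (\forall y \near x, forall k l, derivable (partial k u) y (delta_mx 0 l)) ->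
  {for x, continuous (partial j (partial i u))} ->
  {for x, continuous (partial i (partial j u))} ->
  partial i (partial j u) x = partial j (partial i u) x.
Proof.
move=> du ddu cji cij.
apply/eqP; rewrite -subr_eq0 -normr_eq0 eq_le normr_ge0 andbT.
apply/ler_addgt0Pr => e e0; rewrite add0r.
have e20 : 0 < e / 2 by rewrite divr_gt0.
have /cvgrPdist_le /(_ _ e20) C1 := cij.
have /cvgrPdist_le /(_ _ e20) C2 := cji.
have /nbhs_normP[r /= r0 Hr] : \forall y \near x,
   ((forall k, derivable u y (delta_mx 0 k)) /\
    (forall k l, derivable (partial k u) y (delta_mx 0 l))) /\
   (`|partial i (partial j u) x - partial i (partial j u) y| <= e / 2 /\
   `|partial j (partial i u) x - partial j (partial i u) y| <= e / 2).
  exact: (filterI (filterI du ddu) (filterI C1 C2)).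
(* Then [2 * s] is strictly less than [r], so the closed ball of [second_difference] lies in the
   open ball of radius [r]. *)
pose s := r / 4.
have s0 : 0 < s by rewrite divr_gt0.
have sr (y : 'rV[R]_n) : `|y - x| <= 2 * s -> ball_ Num.norm x r y.
  by move=> H; rewrite /ball_ /= distrC; apply: le_lt_trans H _; rewrite /s; lra.
have [||y yx E1] := @second_difference u x i j s s0.
- by move=> y /sr/Hr[[D _] _]; exact: D.
- by move=> y /sr/Hr[[_ D] _]; exact: D.
have [||z zx E2] := @second_difference u x j i s s0.
- by move=> t /sr/Hr[[D _] _]; exact: D.
- by move=> t /sr/Hr[[_ D] _]; exact: D.
have /Hr[_ [_ H1]] := sr _ yx.
have /Hr[_ [H2 _]] := sr _ zx.
have E : partial j (partial i u) y = partial i (partial j u) z.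
  apply: (mulfI (lt0r_neq0 (exprn_gt0 2 s0))).
  apply: etrans (esym E1) (etrans _ E2).
  have -> : x + s *: delta_mx 0 i + s *: delta_mx 0 j =
            x + s *: delta_mx 0 j + s *: delta_mx 0 i by exact: addrAC.
  by congr (_ + _); exact: addrAC.
have aux (a b c d : R) : `|a - c| <= e / 2 -> `|b - d| <= e / 2 -> d = c -> `|a - b| <= e.
  move=> ac bd dc; apply: le_trans (ler_distD c _ _) _.
  by rewrite [leRHS]splitr lerD// -dc distrC.
exact: aux H2 H1 E.
Qed.

End Symmetry.

(** * Smooth scalar functions *)

Section SmoothGeneral.
Variables (R : realType) (n : nat) (W : normedModType R).
Implicit Types (U : set 'rV[R]_n) (f g : 'rV[R]_n -> W).

Lemma iter_partial_rcons (s : seq 'I_n) i f :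
  iter_partial (rcons s i) f = iter_partial s (partial i f).
Proof. by rewrite /iter_partial foldr_rcons. Qed.

Lemma smooth_on_partial U f i : smooth_on U f -> smooth_on U (partial i f).
Proof. by move=> sf s x Ux; rewrite -iter_partial_rcons; exact: sf. Qed.

Lemma partial_eq_on U f g i x : open U -> (forall y, U y -> f y = g y) -> U x ->
  partial i f x = partial i g x.
Proof.
move=> oU fg Ux; apply: near_eq_derive.
by have := open_nbhs_nbhs (conj oU Ux); apply: filterS => y /fg.
Qed.

End SmoothGeneral.

(* Locked, since conversion checks on iterated partial derivatives diverge. *)
HB.lock Definition pderiv (R : realType) (n : nat) (i : 'I_n) (u : 'rV[R]_n -> R) :
  'rV[R]_n -> R := partial i (u : _ -> R^o).
Arguments pderiv {R n} i u _.

Lemma pderivE (R : realType) (n : nat) (i : 'I_n) (u : 'rV[R]_n -> R) :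
  pderiv i u = partial i (u : _ -> R^o).
Proof. by rewrite unlock. Qed.

(* A wrapper rather than a definition: [done] would unfold [smooth_on]. *)
Variant smooth (R : realType) (n : nat) (U : set 'rV[R]_n) (u : 'rV[R]_n -> R) : Prop :=
  Smooth of smooth_on U (u : _ -> R^o).

Section SmoothScalar.
Variables (R : realType) (n : nat) (U : set 'rV[R]_n).
Hypothesis oU : open U.
Implicit Types (u v : 'rV[R]_n -> R) (x : 'rV[R]_n).

(** Peels off the innermost derivative, whereas [iter_partial] adds the outermost one. Sums,
    products and inverses are then handled by induction on [k], since their first derivatives are
    again built from sums, products and inverses. *)
Fixpoint Cn (k : nat) u : Prop :=
  (forall x, U x -> {for x, continuous (u : _ -> R^o)} /\
     forall i, derivable (u : _ -> R^o) x (delta_mx 0 i)) /\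
  if k is k'.+1 then forall i, Cn k' (pderiv i u) else True.

Lemma CnW k u : Cn k u -> forall x, U x -> {for x, continuous (u : _ -> R^o)} /\
     forall i, derivable (u : _ -> R^o) x (delta_mx 0 i).
Proof. by case: k => [|k] []. Qed.

Lemma Cn_smooth u : (forall k, Cn k u) -> smooth U u.
Proof.
move=> Cu; split=> s; suff K k : forall (s : seq 'I_n) u, (size s <= k)%N -> Cn k u ->
    forall x, U x -> {for x, continuous (iter_partial s (u : _ -> R^o))} /\
      forall i, derivable (iter_partial s (u : _ -> R^o)) x (delta_mx 0 i).
  exact: (K (size s)).
elim: k => [|k IH] {}s {Cu}u.
  by rewrite leqn0 size_eq0 => /eqP-> /CnW Hu x /Hu.
case: (lastP s) => [_ /CnW Hu x /Hu //|s' i]; rewrite size_rcons ltnS => sk [_ Hu] x Ux.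
by rewrite iter_partial_rcons -pderivE; apply: (IH s' (pderiv i u)) => //; exact: Hu.
Qed.

Lemma smooth_Cn u : smooth U u -> forall k, Cn k u.
Proof.
move=> [su] k; elim: k u su => [|k IH] u su /=; (split; last first).
- exact: I.
- by move=> x Ux; exact: (su [::]).
- by move=> i; apply: IH; rewrite pderivE; exact: smooth_on_partial.
- by move=> x Ux; exact: (su [::]).
Qed.

Lemma CnS k u : Cn k.+1 u -> Cn k u.
Proof.
by elim: k u => [|k IH] u [Hu Hd]; split => // i; apply: IH; exact: Hd.
Qed.

Lemma Cn_ext k u v : (forall x, U x -> u x = v x) -> Cn k u -> Cn k v.
Proof.
have near_uv w z x : (forall x, U x -> w x = z x) -> U x -> \near x, (w : _ -> R^o) x = z x.
  by move=> wz Ux; have := open_nbhs_nbhs (conj oU Ux); apply: filterS => y /wz.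
elim: k u v => [|k IH] u v uv [Hu Hd]; (split; last first).
- exact: I.
- move=> x Ux; have [cu du] := Hu _ Ux; have N := near_uv _ _ _ uv Ux; split.
    rewrite /prop_for /continuous_at -(uv _ Ux); apply: cvg_trans cu; exact: (near_eq_cvg N).
  by move=> i; exact: (near_eq_derivable N).
- move=> i; apply: IH (Hd i) => x Ux; rewrite !pderivE; exact: partial_eq_on uv _.
- move=> x Ux; have [cu du] := Hu _ Ux; have N := near_uv _ _ _ uv Ux; split.
    rewrite /prop_for /continuous_at -(uv _ Ux); apply: cvg_trans cu; exact: (near_eq_cvg N).
  by move=> i; exact: (near_eq_derivable N).
Qed.

Lemma Cn_cst k (c : R) : Cn k (fun=> c).
Proof.
elim: k c => [|k IH] c; (split; last first).
- exact: I.
- by move=> x Ux; split; [exact: cst_continuous|move=> i; exact: derivable_cst].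
- move=> i; have -> // : pderiv i (fun=> c) = fun=> 0.
  by apply/funext => x; rewrite pderivE; exact: derive_cst.
- by move=> x Ux; split; [exact: cst_continuous|move=> i; exact: derivable_cst].
Qed.

Lemma pderivD u v i x : Cn 0 u -> Cn 0 v -> U x ->
  pderiv i (fun y => u y + v y) x = pderiv i u x + pderiv i v x.
Proof.
move=> /CnW cu /CnW cv Ux; rewrite !pderivE.
exact: (@deriveD _ _ _ (u : _ -> R^o) v x _ ((cu x Ux).2 i) ((cv x Ux).2 i)).
Qed.

Lemma pderivM u v i x : Cn 0 u -> Cn 0 v -> U x ->
  pderiv i (fun y => u y * v y) x = pderiv i u x * v x + u x * pderiv i v x.
Proof.
move=> /CnW cu /CnW cv Ux.
have := (@deriveM _ _ (u : _ -> R^o) v x _ ((cu x Ux).2 i) ((cv x Ux).2 i)).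
by rewrite !pderivE /partial => ->; rewrite addrC; congr (_ + _); exact: mulrC.
Qed.

Lemma pderivV u i x : Cn 0 u -> U x -> u x != 0 ->
  pderiv i (fun y => (u y)^-1) x = - ((u x)^-1 * (u x)^-1 * pderiv i u x).
Proof.
move=> /CnW cu Ux u0.
have := (@deriveV _ _ u x _ u0 ((cu x Ux).2 i)).
by rewrite !pderivE /partial => ->; rewrite -mulNr -invfM -expr2.
Qed.

Lemma Cn0D u v : Cn 0 u -> Cn 0 v -> Cn 0 (fun x => u x + v x).
Proof.
move=> /CnW cu /CnW cv; split; [move=> x Ux; split|exact: I].
  by apply: (@continuousD _ _ _ (u : _ -> R^o) v); [exact: (cu x Ux).1|exact: (cv x Ux).1].
by move=> i; exact: (derivableD ((cu x Ux).2 i) ((cv x Ux).2 i)).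
Qed.

Lemma Cn0M u v : Cn 0 u -> Cn 0 v -> Cn 0 (fun x => u x * v x).
Proof.
move=> /CnW cu /CnW cv; split; [move=> x Ux; split|exact: I].
  by apply: (@continuousM _ _ u v); [exact: (cu x Ux).1|exact: (cv x Ux).1].
by move=> i; exact: (derivableM ((cu x Ux).2 i) ((cv x Ux).2 i)).
Qed.

Lemma Cn0V u : Cn 0 u -> (forall x, U x -> u x != 0) -> Cn 0 (fun x => (u x)^-1).
Proof.
move=> /CnW cu u0; split; [move=> x Ux; split|exact: I].
  by apply: continuousV; [exact: u0|exact: (cu x Ux).1].
by move=> i; apply: derivableV; [exact: u0|exact: (cu x Ux).2].
Qed.

Lemma CnW0 k u : Cn k u -> Cn 0 u. Proof. by move=> /CnW. Qed.

Lemma CnD k u v : Cn k u -> Cn k v -> Cn k (fun x => u x + v x).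
Proof.
elim: k u v => [|k IH] u v; first exact: Cn0D.
move=> cu cv; split; first by apply: CnW (Cn0D (CnW0 cu) (CnW0 cv)).
move=> i; apply: (@Cn_ext _ (fun x => pderiv i u x + pderiv i v x)).
  by move=> x Ux; rewrite pderivD //; [exact: CnW0 cu|exact: CnW0 cv].
by apply: IH; [apply: cu.2|apply: cv.2].
Qed.

Lemma CnM k u v : Cn k u -> Cn k v -> Cn k (fun x => u x * v x).
Proof.
elim: k u v => [|k IH] u v; first exact: Cn0M.
move=> cu cv; split; first by apply: CnW (Cn0M (CnW0 cu) (CnW0 cv)).
move=> i; apply: (@Cn_ext _ (fun x => pderiv i u x * v x + u x * pderiv i v x)).
  by move=> x Ux; rewrite pderivM //; [exact: CnW0 cu|exact: CnW0 cv].
by apply: CnD; apply: IH; do ?[exact: CnS]; [apply: cu.2|apply: cv.2].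
Qed.

(** The derivative of 1/u is a polynomial in 1/u and a derivative of u, so regularity of 1/u itself
    to order [k] yields order [k.+1]. *)
Lemma CnV k u : Cn k u -> (forall x, U x -> u x != 0) -> Cn k (fun x => (u x)^-1).
Proof.
move=> + u0; elim: k => [|k IH] cu; first exact: Cn0V.
split; first by apply: CnW (Cn0V (CnW0 cu) u0).
move=> i; apply: (@Cn_ext _ (fun x => (-1) * ((u x)^-1 * (u x)^-1 * pderiv i u x))).
  by move=> x Ux; rewrite pderivV ?mulN1r//; [exact: CnW0 cu|exact: u0].
have cV := IH (CnS cu).
by apply: CnM; [exact: Cn_cst|apply: CnM; [exact: CnM|apply: cu.2]].
Qed.

Lemma smooth_ext u v : (forall x, U x -> u x = v x) -> smooth U u -> smooth U v.
Proof. by move=> uv /smooth_Cn cu; apply: Cn_smooth => k; exact: Cn_ext uv _. Qed.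

Lemma smooth_cst c : smooth U (fun=> c).
Proof. by apply: Cn_smooth => k; exact: Cn_cst. Qed.

Lemma smoothD u v : smooth U u -> smooth U v -> smooth U (fun x => u x + v x).
Proof. by move=> /smooth_Cn cu /smooth_Cn cv; apply: Cn_smooth => k; exact: CnD. Qed.

Lemma smoothM u v : smooth U u -> smooth U v -> smooth U (fun x => u x * v x).
Proof. by move=> /smooth_Cn cu /smooth_Cn cv; apply: Cn_smooth => k; exact: CnM. Qed.

Lemma smoothV u : smooth U u -> (forall x, U x -> u x != 0) -> smooth U (fun x => (u x)^-1).
Proof. by move=> /smooth_Cn cu u0; apply: Cn_smooth => k; exact: CnV. Qed.

Lemma smoothN u : smooth U u -> smooth U (fun x => - u x).
Proof.
move=> su; apply: (@smooth_ext (fun x => (-1) * u x)) => [x _|]; first by rewrite mulN1r.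
exact: (smoothM (smooth_cst (-1)) su).
Qed.

Lemma smoothB u v : smooth U u -> smooth U v -> smooth U (fun x => u x - v x).
Proof. by move=> su sv; exact: (smoothD su (smoothN sv)). Qed.

Lemma smooth_sum (I : Type) (r : seq I) (P : pred I) (F : I -> 'rV[R]_n -> R) :
  (forall i, P i -> smooth U (F i)) -> smooth U (fun x => \sum_(i <- r | P i) F i x).
Proof.
move=> sF; elim: r => [|a r IH].
  by under eq_fun do rewrite big_nil; exact: smooth_cst.
under eq_fun do rewrite big_cons.
case Pa: (P a); last exact: IH.
exact: (@smoothD (F a) (fun x => \sum_(i <- r | P i) F i x) (sF a Pa) IH).
Qed.

Lemma smooth_prod (I : Type) (r : seq I) (P : pred I) (F : I -> 'rV[R]_n -> R) :
  (forall i, P i -> smooth U (F i)) -> smooth U (fun x => \prod_(i <- r | P i) F i x).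
Proof.
move=> sF; elim: r => [|a r IH].
  by under eq_fun do rewrite big_nil; exact: smooth_cst.
under eq_fun do rewrite big_cons.
case Pa: (P a); last exact: IH.
exact: (@smoothM (F a) (fun x => \prod_(i <- r | P i) F i x) (sF a Pa) IH).
Qed.

Lemma smooth_pderiv u i : smooth U u -> smooth U (pderiv i u).
Proof. by move=> [su]; split; rewrite pderivE; exact: smooth_on_partial. Qed.

Lemma pderiv_eq_on u v i x : (forall y, U y -> u y = v y) -> U x ->
  pderiv i u x = pderiv i v x.
Proof. by move=> uv Ux; rewrite !pderivE; exact: partial_eq_on uv _. Qed.

Lemma pderiv_cst (c : R) i x : pderiv i (fun=> c) x = 0.
Proof. by rewrite pderivE; exact: derive_cst. Qed.

Lemma pderiv_mul u v i x : smooth U u -> smooth U v -> U x ->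
  pderiv i (fun y => u y * v y) x = pderiv i u x * v x + u x * pderiv i v x.
Proof. by move=> /smooth_Cn cu /smooth_Cn cv Ux; exact: pderivM. Qed.

Lemma pderiv_add u v i x : smooth U u -> smooth U v -> U x ->
  pderiv i (fun y => u y + v y) x = pderiv i u x + pderiv i v x.
Proof. by move=> /smooth_Cn cu /smooth_Cn cv Ux; exact: pderivD. Qed.

Lemma pderiv_sum (I : Type) (r : seq I) (P : pred I) (F : I -> 'rV[R]_n -> R) i x :
  (forall j, P j -> smooth U (F j)) -> U x ->
  pderiv i (fun x => \sum_(j <- r | P j) F j x) x = \sum_(j <- r | P j) pderiv i (F j) x.
Proof.
move=> sF Ux; elim: r => [|a r IH].
  by rewrite big_nil; under eq_fun do rewrite big_nil; exact: pderiv_cst.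
under eq_fun do rewrite big_cons.
rewrite big_cons -IH; case Pa: (P a); last by [].
by apply: pderivD Ux; apply: smooth_Cn; [exact: sF|exact: smooth_sum].
Qed.

Lemma smooth_differentiable u x : smooth U u -> U x -> differentiable (u : _ -> R^o) x.
Proof.
move=> [su] Ux; apply: continuous_partials_differentiable.
  by have := open_nbhs_nbhs (conj oU Ux); apply: filterS => y Uy; exact: (su [::] y Uy).2.
by move=> i; exact: (su [:: i] x Ux).1.
Qed.

Lemma pderivC u i j x : smooth U u -> U x ->
  pderiv i (pderiv j u) x = pderiv j (pderiv i u) x.
Proof.
move=> [su] Ux; rewrite !pderivE; apply: partialC.
- by have := open_nbhs_nbhs (conj oU Ux); apply: filterS => y Uy; exact: (su [::] y Uy).2.
- by have := open_nbhs_nbhs (conj oU Ux); apply: filterS => y Uy k; exact: (su [:: k] y Uy).2.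
- exact: (su [:: j; i] x Ux).1.
- exact: (su [:: i; j] x Ux).1.
Qed.

End SmoothScalar.

Section SmoothMatrix.
Variables (R : realType) (n : nat) (U : set 'rV[R]_n).
Hypothesis oU : open U.

Lemma partial_coord (p q : nat) (f : 'rV[R]_n -> 'M[R]_(p, q)) a b i x :
  derivable f x (delta_mx 0 i) ->
  pderiv i (fun y => f y a b) x = partial i f x a b.
Proof. by move=> df; rewrite pderivE /partial derive_mx// mxE. Qed.

Lemma smooth_coord (p q : nat) (f : 'rV[R]_n -> 'M[R]_(p, q)) a b :
  smooth_on U f -> smooth U (fun y => f y a b).
Proof.
move=> sf; apply: Cn_smooth => k; elim: k f sf => [|k IH] f sf; (split; last first).
- exact: I.
- move=> x Ux; have [cf df] := sf [::] x Ux; split.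
    exact: (@continuous_comp _ _ _ f (fun M : 'M[R]_(p, q) => M a b : R^o) x cf
      (@coord_continuous R p q a b (f x))).
  by move=> i; have /derivable_mxP := df i; exact.
- move=> i; apply: (Cn_ext oU) (IH _ (@smooth_on_partial _ _ _ _ _ i sf)) => x Ux /=.
  by rewrite partial_coord//; exact: (sf [::] x Ux).2.
- move=> x Ux; have [cf df] := sf [::] x Ux; split.
    exact: (@continuous_comp _ _ _ f (fun M : 'M[R]_(p, q) => M a b : R^o) x cf
      (@coord_continuous R p q a b (f x))).
  by move=> i; have /derivable_mxP := df i; exact.
Qed.

Lemma smooth_on_differentiable (p : nat) (f : 'rV[R]_n -> 'rV[R]_p) x :
  smooth_on U f -> U x -> differentiable f x.
Proof.
move=> sf Ux.
have -> : f = \sum_(j < p) (fun y => (f y 0 j) *: (delta_mx 0 j : 'rV[R]_p)).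
  apply/funext => y; rewrite fct_sumE; exact: row_sum_delta.
apply: differentiable_sum => j; apply: differentiableZl.
exact: smooth_differentiable (smooth_coord 0 j sf) Ux.
Qed.

Lemma jacobianE (p : nat) (f : 'rV[R]_n -> 'rV[R]_p) x i j :
  smooth_on U f -> U x -> 'J f x i j = pderiv i (fun y => f y 0 j) x.
Proof.
move=> sf Ux; rewrite partial_coord; last exact: (sf [::] x Ux).2.
rewrite /partial deriveEjacobian; last exact: smooth_on_differentiable Ux.
by rewrite -rowE [RHS]mxE.
Qed.

End SmoothMatrix.

Section LocallyConstant.
Variables (R : realType) (n : nat) (U : set 'rV[R]_n).
Hypothesis oU : open U.

Lemma pderiv0_near_cst (u : 'rV[R]_n -> R) x : smooth U u -> U x ->
  (forall i y, U y -> pderiv i u y = 0) -> \forall y \near x, u y = u x.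
Proof.
move=> [su] Ux du0.
have /near_ball_origin := open_nbhs_nbhs (conj oU Ux).
move=> /nbhs_normP[r /= r0 Hr]; apply/nbhs_normP; exists r => //= y.
rewrite /ball_ /= => xy.
have Hyx : ball_ Num.norm 0 r (y - x) by rewrite /ball_ /= sub0r normrN distrC.
have [|c [ch E]] := @increment_partials R n u x (y - x).
  by move=> z i zx; exact: (su [::] z (Hr _ Hyx _ zx)).2.
have xyx : x + (y - x) = y by rewrite addrC subrK.
rewrite xyx in E; apply/eqP; rewrite -subr_eq0 E.
apply/eqP/big1 => i _; have := du0 i (c i) (Hr _ Hyx _ (ch i)); rewrite pderivE => ->.
exact: mulr0.
Qed.

Lemma is_derive_curve (u : 'rV[R]_n -> R) (x : R -> 'rV[R]_n) (t : R) :
  smooth U u -> U (x t) -> derivable x t 1 ->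
  is_derive t 1 (fun s => u (x s)) (\sum_i ('D_1 x t) 0 i * pderiv i u (x t)).
Proof.
move=> su Ut dx.
have dx' : differentiable x t by apply/derivable1_diffP.
have du := smooth_differentiable oU su Ut.
have dux : differentiable (fun s => u (x s) : R^o) t.
  exact: (differentiable_comp dx' du).
have E : 'D_1 (fun s => u (x s) : R^o) t = \sum_i ('D_1 x t) 0 i * pderiv i u (x t).
  rewrite deriveE// (diff_comp dx' du) /= -(deriveE _ du) (deriveE (1 : R) dx').
  by under [RHS]eq_bigr do rewrite pderivE; exact: derive_partials.
by rewrite -E; apply/derivableP/diff_derivable.
Qed.

End LocallyConstant.

(** * Tangential gradients and the Simons formula *)

Section TangentialGradient.
Variables (R : realType) (n N : nat) (U : set 'rV[R]_n).
Hypothesis oU : open U.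
Variables (f nu : 'I_N -> 'rV[R]_n -> R) (X : 'I_N -> 'I_n -> 'rV[R]_n -> R).
Hypothesis f_smooth : forall a, smooth U (f a).
Hypothesis nu_smooth : forall a, smooth U (nu a).
Hypothesis X_smooth : forall a j, smooth U (X a j).
Hypothesis frameK : forall x j k, U x ->
  \sum_a pderiv j (f a) x * X a k x = (j == k)%:R.
Hypothesis coframeK : forall x a b, U x ->
  \sum_j X a j x * pderiv j (f b) x = (a == b)%:R - nu a x * nu b x.
Hypothesis nuX : forall x j, U x -> \sum_a nu a x * X a j x = 0.
Hypothesis nu_unit : forall x, U x -> \sum_a nu a x * nu a x = 1.
Hypothesis nu_normal : forall x j, U x -> \sum_a nu a x * pderiv j (f a) x = 0.
Implicit Types (u v : 'rV[R]_n -> R) (x : 'rV[R]_n) (a b c d e : 'I_N).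

(** [X a j] stands for the sum over k of g^(jk) d_k f_a. The metric itself does not appear in this
    section: it enters through the duality relations [frameK], [coframeK] and [nuX]. *)
Definition tgrad a u x : R := \sum_j X a j x * pderiv j u x.

Lemma tgrad_smooth a u : smooth U u -> smooth U (tgrad a u).
Proof.
move=> su; apply: (smooth_sum oU) => j _; apply: (smoothM oU); first exact: X_smooth.
exact: smooth_pderiv.
Qed.

Lemma tgrad_eq_on a u v x : (forall y, U y -> u y = v y) -> U x -> tgrad a u x = tgrad a v x.
Proof. by move=> uv Ux; apply: eq_bigr => j _; rewrite (pderiv_eq_on oU j uv Ux). Qed.

Lemma tgrad_cst_on a u k x : (forall y, U y -> u y = k) -> U x -> tgrad a u x = 0.
Proof.
move=> uv Ux; rewrite (@tgrad_eq_on a u (fun=> k))//; apply: big1 => j _.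
by rewrite pderiv_cst mulr0.
Qed.

Lemma tgradM a u v x : smooth U u -> smooth U v -> U x ->
  tgrad a (fun y => u y * v y) x = tgrad a u x * v x + u x * tgrad a v x.
Proof.
move=> su sv Ux; rewrite /tgrad mulr_suml mulr_sumr -big_split /=.
by apply: eq_bigr => j _; rewrite (@pderiv_mul _ _ U)//; ring.
Qed.

Lemma tgrad_sum (I : Type) (r : seq I) (P : pred I) (F : I -> 'rV[R]_n -> R) a x :
  (forall i, P i -> smooth U (F i)) -> U x ->
  tgrad a (fun y => \sum_(i <- r | P i) F i y) x = \sum_(i <- r | P i) tgrad a (F i) x.
Proof.
move=> sF Ux; rewrite /tgrad exchange_big /=; apply: eq_bigr => j _.
by rewrite (pderiv_sum oU)// mulr_sumr.
Qed.

Lemma tgradD a u v x : smooth U u -> smooth U v -> U x ->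
  tgrad a (fun y => u y + v y) x = tgrad a u x + tgrad a v x.
Proof.
move=> su sv Ux; rewrite /tgrad -big_split /=.
by apply: eq_bigr => j _; rewrite (@pderiv_add _ _ U)// mulrDr.
Qed.

Lemma tgradN a u x : smooth U u -> U x -> tgrad a (fun y => - u y) x = - tgrad a u x.
Proof.
move=> su Ux; rewrite (@tgrad_eq_on a _ (fun y => -1 * u y))//; last first.
  by move=> y _; rewrite mulN1r.
rewrite tgradM//; last exact: smooth_cst.
by rewrite (@tgrad_cst_on a (fun=> -1) (-1))// mul0r add0r mulN1r.
Qed.

Lemma sum_delta (I : finType) (F : I -> R) (i : I) : \sum_j (i == j)%:R * F j = F i.
Proof.
rewrite (bigD1 i)//= eqxx mul1r big1 ?addr0// => j ji.
by rewrite eq_sym (negbTE ji) mul0r.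
Qed.

(** Inverts the definition of [tgrad], so that vanishing of all [tgrad a u] gives vanishing of the
    coordinate derivatives. *)
Lemma pderiv_tgrad j u x : U x -> pderiv j u x = \sum_a pderiv j (f a) x * tgrad a u x.
Proof.
move=> Ux; under eq_bigr do rewrite mulr_sumr.
rewrite exchange_big /= -[LHS](sum_delta (fun k => pderiv k u x)).
apply: eq_bigr => k _; rewrite -(frameK j k Ux) mulr_suml.
by apply: eq_bigr => a _; rewrite mulrA.
Qed.

Lemma nu_tgrad u x : U x -> \sum_a nu a x * tgrad a u x = 0.
Proof.
move=> Ux; under eq_bigr do rewrite mulr_sumr.
rewrite exchange_big /= big1// => j _.
under eq_bigr do rewrite mulrA.
by rewrite -mulr_suml nuX// mul0r.
Qed.

Definition shape a b x : R := tgrad a (nu b) x.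

Lemma shape_smooth a b : smooth U (shape a b).
Proof. exact: tgrad_smooth. Qed.

Lemma nu_pderiv_nu j x : U x -> \sum_a nu a x * pderiv j (nu a) x = 0.
Proof.
move=> Ux; have : pderiv j (fun y => \sum_a nu a y * nu a y) x = 0.
  by rewrite (@pderiv_eq_on _ _ _ oU _ (fun=> 1))// pderiv_cst.
rewrite (pderiv_sum oU)//; last by move=> a _; apply: (smoothM oU).
under eq_bigr do rewrite (@pderiv_mul _ _ U)// [X in X + _]mulrC.
by rewrite big_split /= -mulr2n => /eqP; rewrite mulrn_eq0 => /eqP.
Qed.

Lemma nu_pderiv2 j k x : U x ->
  \sum_a pderiv j (nu a) x * pderiv k (f a) x = - \sum_a nu a x * pderiv j (pderiv k (f a)) x.
Proof.
move=> Ux; have : pderiv j (fun y => \sum_a nu a y * pderiv k (f a) y) x = 0.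
  by rewrite (@pderiv_eq_on _ _ _ oU _ (fun=> 0)) ?pderiv_cst// => y Uy; exact: nu_normal.
rewrite (pderiv_sum oU)//; last by move=> a _; apply: (smoothM oU) => //; exact: smooth_pderiv.
rewrite (eq_bigr _ (fun a _ =>
  @pderiv_mul _ _ U _ _ j x (nu_smooth a) (smooth_pderiv k (f_smooth a)) Ux)).
by rewrite big_split /= => /eqP; rewrite addr_eq0 => /eqP.
Qed.

(** Differentiating |nu|^2 = 1 shows that d_j nu is tangent, and differentiating nu . d_k f = 0
    moves the derivative from nu onto f. In this form symmetry in [a] and [b] is that of second
    derivatives. *)
Lemma shapeE a b x : U x ->
  shape a b x = - \sum_j \sum_k X a j x * X b k x * \sum_c nu c x * pderiv j (pderiv k (f c)) x.
Proof.
move=> Ux; rewrite -sumrN; apply: eq_bigr => j _.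
have -> : pderiv j (nu b) x = \sum_c ((b == c)%:R - nu b x * nu c x) * pderiv j (nu c) x.
  under eq_bigr do rewrite mulrBl; rewrite sumrB sum_delta.
  under [X in _ - X]eq_bigr do rewrite -mulrA.
  by rewrite -mulr_sumr nu_pderiv_nu// mulr0 subr0.
under eq_bigr do rewrite -coframeK// mulr_suml.
rewrite exchange_big /= mulr_sumr -sumrN; apply: eq_bigr => k _.
rewrite -mulrA -mulrN; congr (_ * _).
under eq_bigr do rewrite -mulrA [X in _ * X]mulrC.
by rewrite -mulr_sumr nu_pderiv2// mulrN.
Qed.

Lemma shapeC a b x : U x -> shape a b x = shape b a x.
Proof.
move=> Ux; rewrite !shapeE//; congr (- _); rewrite exchange_big /=.
apply: eq_bigr => j _; apply: eq_bigr => k _; congr (_ * _); first exact: mulrC.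
by apply: eq_bigr => c _; rewrite (pderivC oU).
Qed.

Lemma nu_shape b x : U x -> \sum_a nu a x * shape a b x = 0.
Proof. exact: nu_tgrad. Qed.

Lemma shape_nu a x : U x -> \sum_b shape a b x * nu b x = 0.
Proof.
by move=> Ux; under eq_bigr do rewrite shapeC// mulrC; exact: nu_shape.
Qed.

(** Splits the derivative of the vector field (grad_a u) into its tangential part, on the right, and
    its normal part, which equals minus the contraction of the shape tensor with the gradient
    because nu . grad u = 0. The right side can be compared under exchange of [c] and [d]. *)
Lemma tgrad_twist c d u x : smooth U u -> U x ->
  tgrad d (tgrad c u) x + nu c x * \sum_a shape d a x * tgrad a u x =
  \sum_j \sum_i X c j x * X d i x * \sum_a pderiv j (f a) x * pderiv i (tgrad a u) x.
Proof.
move=> su Ux.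
have -> : \sum_j \sum_i X c j x * X d i x * \sum_a pderiv j (f a) x * pderiv i (tgrad a u) x
  = \sum_a ((c == a)%:R - nu c x * nu a x) * tgrad d (tgrad a u) x.
  under [RHS]eq_bigr do rewrite -coframeK// mulr_suml.
  rewrite [RHS]exchange_big /=; apply: eq_bigr => j _.
  under [RHS]eq_bigr do rewrite mulr_sumr.
  rewrite [RHS]exchange_big /=; apply: eq_bigr => i _.
  by rewrite mulr_sumr; apply: eq_bigr => a _; ring.
under [RHS]eq_bigr do rewrite mulrBl; rewrite sumrB sum_delta; congr (_ + _).
under [X in - X]eq_bigr do rewrite -mulrA.
rewrite -mulr_sumr -mulrN; congr (_ * _).
have : tgrad d (fun y => \sum_a nu a y * tgrad a u y) x = 0.
  by rewrite (@tgrad_cst_on d _ 0)// => y; exact: nu_tgrad.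
rewrite tgrad_sum//; last by move=> a _; apply: (smoothM oU) => //; exact: tgrad_smooth.
rewrite (eq_bigr _ (fun a _ => @tgradM d _ _ x (nu_smooth a) (tgrad_smooth a su) Ux)).
by rewrite big_split /= => /eqP; rewrite addr_eq0 => /eqP.
Qed.

Lemma tgrad_commutator c d u x : smooth U u -> U x ->
  tgrad d (tgrad c u) x = tgrad c (tgrad d u) x +
  \sum_a (nu d x * shape c a x - nu c x * shape d a x) * tgrad a u x.
Proof.
move=> su Ux.
have sym : tgrad d (tgrad c u) x + nu c x * \sum_a shape d a x * tgrad a u x =
  tgrad c (tgrad d u) x + nu d x * \sum_a shape c a x * tgrad a u x.
  rewrite !tgrad_twist// [RHS]exchange_big /=; apply: eq_bigr => j _; apply: eq_bigr => i _.
  congr (_ * _); first exact: mulrC.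
  have T k l : pderiv k (fun y => \sum_a pderiv l (f a) y * tgrad a u y) x =
     \sum_a pderiv k (pderiv l (f a)) x * tgrad a u x +
     \sum_a pderiv l (f a) x * pderiv k (tgrad a u) x.
    rewrite (pderiv_sum oU)//; last first.
      by move=> a _; apply: (smoothM oU); [exact: smooth_pderiv|exact: tgrad_smooth].
    rewrite (eq_bigr _ (fun a _ =>
      @pderiv_mul _ _ U _ _ k x (smooth_pderiv l (f_smooth a)) (tgrad_smooth a su) Ux)).
    by rewrite big_split.
  (* Both sides are second derivatives of [u], by [pderiv_tgrad]. Cancelling the terms with second
     derivatives of [f], symmetric as well, leaves the symmetry of the right side of
     [tgrad_twist]. *)
  have C : pderiv i (fun y => \sum_a pderiv j (f a) y * tgrad a u y) x =
           pderiv j (fun y => \sum_a pderiv i (f a) y * tgrad a u y) x.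
    rewrite -(@pderiv_eq_on _ _ _ oU (pderiv j u)) ?(@pderiv_eq_on _ _ _ oU _ (pderiv i u) j)//.
    - by rewrite (pderivC oU).
    - by move=> y Uy; rewrite -pderiv_tgrad.
    - by move=> y Uy; rewrite -pderiv_tgrad.
  move: C; rewrite !T.
  under [X in X + _ = _ -> _]eq_bigr do rewrite (pderivC oU)//.
  by move/addrI.
have -> : \sum_a (nu d x * shape c a x - nu c x * shape d a x) * tgrad a u x =
    nu d x * (\sum_a shape c a x * tgrad a u x) - nu c x * \sum_a shape d a x * tgrad a u x.
  by rewrite !mulr_sumr -sumrB; apply: eq_bigr => a _; ring.
by rewrite addrA -sym addrK.
Qed.


(** * Codazzi equation and divergence of the shape tensor *)

Definition shape2 a b x : R := \sum_e shape a e x * shape e b x.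

Lemma shape2_smooth a b : smooth U (shape2 a b).
Proof.
by apply: (smooth_sum oU) => e _; apply: (smoothM oU); exact: shape_smooth.
Qed.

Lemma shape2C a b x : U x -> shape2 a b x = shape2 b a x.
Proof.
by move=> Ux; apply: eq_bigr => e _; rewrite shapeC// [shape e b x]shapeC// mulrC.
Qed.

Lemma nu_shape2 b x : U x -> \sum_a nu a x * shape2 a b x = 0.
Proof.
move=> Ux; under eq_bigr do rewrite mulr_sumr.
rewrite exchange_big /= big1// => e _; under eq_bigr do rewrite mulrA.
by rewrite -mulr_suml nu_shape// mul0r.
Qed.

Lemma tgrad_shapeC c a b x : U x -> tgrad c (shape a b) x = tgrad c (shape b a) x.
Proof. by move=> Ux; apply: tgrad_eq_on => // y; exact: shapeC. Qed.

(** The commutator formula applied to [nu b]. The two correction terms carry a factor nu, so on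
    tangent vectors this is the usual symmetry of nabla h. *)
Lemma codazzi c a b x : U x -> tgrad c (shape a b) x =
  tgrad a (shape c b) x + nu c x * shape2 a b x - nu a x * shape2 c b x.
Proof.
move=> Ux; rewrite [LHS]tgrad_commutator// -addrA; congr (_ + _).
by rewrite !mulr_sumr -sumrB; apply: eq_bigr => e _; rewrite -/(shape e b x); ring.
Qed.

Lemma nu_tgrad_shape c b x : U x -> \sum_a nu a x * tgrad c (shape a b) x = - shape2 c b x.
Proof.
move=> Ux; have : tgrad c (fun y => \sum_a nu a y * shape a b y) x = 0.
  by rewrite (@tgrad_cst_on c _ 0)// => y; exact: nu_shape.
rewrite tgrad_sum//; last by move=> a _; apply: (smoothM oU) => //; exact: shape_smooth.
rewrite (eq_bigr _ (fun a _ => @tgradM c _ _ x (nu_smooth a) (shape_smooth a b) Ux)).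
by rewrite big_split /= addrC => /eqP; rewrite addr_eq0 => /eqP.
Qed.

Variables (p1 p2 : R).
Hypothesis tr_shape : forall x, U x -> \sum_a shape a a x = p1.
Hypothesis sqnorm_shape : forall x, U x -> \sum_a \sum_b shape a b x ^+ 2 = p2.

Lemma tr_shape2 x : U x -> \sum_a shape2 a a x = p2.
Proof.
move=> Ux; rewrite -(sqnorm_shape Ux); apply: eq_bigr => a _; apply: eq_bigr => b _.
by rewrite [shape b a x]shapeC// expr2.
Qed.

Lemma tgrad_tr_shape c x : U x -> \sum_a tgrad c (shape a a) x = 0.
Proof.
move=> Ux; rewrite -tgrad_sum//; last by move=> a _; exact: shape_smooth.
exact: (@tgrad_cst_on c _ p1).
Qed.

(** The trace of the Codazzi equation: the derivative of the constant trace drops out, and of the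
    two corrections only the one with the trace of h^2 survives. What remains is normal, so the
    covariant divergence vanishes. *)
Lemma div_shape b x : U x -> \sum_a tgrad a (shape a b) x = - (p2 * nu b x).
Proof.
move=> Ux; under eq_bigr do rewrite tgrad_shapeC// codazzi//.
rewrite sumrB big_split /= tgrad_tr_shape// add0r -mulr_sumr tr_shape2//.
under eq_bigr do rewrite shape2C//.
by rewrite nu_shape2// sub0r mulrC.
Qed.

Lemma shape_tgrad_shape c x : U x ->
  \sum_a \sum_b shape a b x * tgrad c (shape a b) x = 0.
Proof.
move=> Ux; have : tgrad c (fun y => \sum_a \sum_b shape a b y * shape a b y) x = 0.
  exact: (@tgrad_cst_on c _ p2).
have s2 a b : smooth U (fun y => shape a b y * shape a b y).
  by apply: (smoothM oU); exact: shape_smooth.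
rewrite tgrad_sum//; last by move=> a _; apply: (smooth_sum oU) => b _.
under eq_bigr => a _.
  rewrite tgrad_sum//.
  rewrite (eq_bigr _ (fun b _ => @tgradM c _ _ x (shape_smooth a b) (shape_smooth a b) Ux)).
  under eq_bigr do rewrite [X in X + _]mulrC -mulr2n.
  rewrite sumrMnl.
over.
by rewrite sumrMnl => /eqP; rewrite mulrn_eq0 => /eqP.
Qed.

(** * Simons' formula *)

Definition shape_laplacian a b x : R := \sum_c tgrad c (tgrad c (shape a b)) x.

(** Commuting the two derivatives produces the divergence of the shape tensor, known from
    [div_shape]; the commutator contributes what the Ricci identity does intrinsically. *)
Lemma tgrad2_shape a b x : U x ->
  \sum_c tgrad c (tgrad a (shape c b)) x =
  - (p2 * shape a b x) - \sum_e shape a e x * shape2 e b x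
  - nu a x * \sum_c \sum_e shape c e x * tgrad e (shape c b) x.
Proof.
move=> Ux.
rewrite (eq_bigr _ (fun c _ => @tgrad_commutator a c _ x (shape_smooth c b) Ux)).
rewrite big_split /= -addrA; congr (_ + _).
  rewrite -tgrad_sum//; last by move=> c _; apply: tgrad_smooth; exact: shape_smooth.
  rewrite (@tgrad_eq_on a _ (fun y => (- p2) * nu b y))//; last first.
    by move=> y Uy; rewrite div_shape// mulNr.
  rewrite tgradM//; last exact: smooth_cst.
  by rewrite (@tgrad_cst_on a _ (- p2))// mul0r add0r mulNr.
under eq_bigr => c _ do under eq_bigr do rewrite mulrBl.
under eq_bigr do rewrite sumrB.
rewrite sumrB; congr (_ - _); last first.
  rewrite mulr_sumr; apply: eq_bigr => c _; rewrite mulr_sumr.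
  by apply: eq_bigr => e _; rewrite mulrA.
rewrite exchange_big /= -sumrN; apply: eq_bigr => e _.
rewrite -mulrN -nu_tgrad_shape// mulr_sumr; apply: eq_bigr => c _; ring.
Qed.

(** By Codazzi the Laplacian is the divergence of [tgrad a (shape c b)] up to the derivatives of the
    two corrections. The cubic term is the tangential discrepancy between this componentwise
    Laplacian and the covariant one. The coefficient [z] of the normal term stays unspecified
    because it only meets tensors annihilated by nu, through [contract_nu]. *)
Lemma shape_laplacianE x : U x -> exists z : 'I_N -> R,
  forall a b, shape_laplacian a b x = p1 * shape2 a b x - p2 * shape a b x
     - 2 * (\sum_e shape a e x * shape2 e b x) - nu a x * z b.
Proof.
move=> Ux.
exists (fun b => \sum_c tgrad c (shape2 c b) x +
   \sum_c \sum_e shape c e x * tgrad e (shape c b) x) => a b.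
pose g c y := tgrad a (shape c b) y + nu c y * shape2 a b y - nu a y * shape2 c b y.
have s1 c : smooth U (tgrad a (shape c b)) by apply: tgrad_smooth; exact: shape_smooth.
have s2 c : smooth U (fun y => nu c y * shape2 a b y).
  by apply: (smoothM oU) => //; exact: shape2_smooth.
have s3 c : smooth U (fun y => nu a y * shape2 c b y).
  by apply: (smoothM oU) => //; exact: shape2_smooth.
have E c : tgrad c (tgrad c (shape a b)) x =
    tgrad c (tgrad a (shape c b)) x + (shape c c x * shape2 a b x + nu c x * tgrad c (shape2 a b) x)
    - (shape c a x * shape2 c b x + nu a x * tgrad c (shape2 c b) x).
  rewrite (@tgrad_eq_on c _ (g c))//; last by move=> y; exact: codazzi.
  have s12 : smooth U (fun y => tgrad a (shape c b) y + nu c y * shape2 a b y).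
    exact: (smoothD oU (s1 c) (s2 c)).
  rewrite (tgradD c s12 (smoothN oU (s3 c)) Ux) (tgradN c (s3 c) Ux).
  rewrite (tgradD c (s1 c) (s2 c) Ux).
  rewrite (tgradM c (nu_smooth c) (shape2_smooth a b) Ux).
  by rewrite (tgradM c (nu_smooth a) (shape2_smooth c b) Ux).
rewrite /shape_laplacian (eq_bigr _ (fun c _ => E c)) sumrB !big_split /= tgrad2_shape//.
rewrite -mulr_suml tr_shape// nu_tgrad// -mulr_sumr.
under [X in _ - (X + _)]eq_bigr do rewrite shapeC//.
ring.
Qed.

Definition cubic_trace x : R := \sum_a \sum_b shape a b x * shape2 a b x.
Definition quartic_trace x : R := \sum_a \sum_b shape2 a b x ^+ 2.

Lemma shape_shape_shape2 x : U x ->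
  \sum_a \sum_b shape a b x * (\sum_e shape a e x * shape2 e b x) = quartic_trace x.
Proof.
move=> Ux.
transitivity (\sum_a \sum_b \sum_e shape a b x * shape a e x * shape2 e b x).
  apply: eq_bigr => a _; apply: eq_bigr => b _; rewrite mulr_sumr.
  by apply: eq_bigr => e _; rewrite mulrA.
rewrite exchange_big [RHS]exchange_big /=; apply: eq_bigr => b _.
rewrite exchange_big /=; apply: eq_bigr => e _.
rewrite -mulr_suml expr2; congr (_ * _); rewrite shape2C//.
by apply: eq_bigr => a _; rewrite [shape a b x]shapeC// [shape a e x]shapeC.
Qed.

Lemma contract_nu (B : 'I_N -> 'I_N -> R) (z : 'I_N -> R) x :
  (forall b, \sum_a nu a x * B a b = 0) ->
  \sum_a \sum_b B a b * (nu a x * z b) = 0.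
Proof.
move=> nB; rewrite exchange_big /= big1// => b _.
rewrite (eq_bigr (fun a => nu a x * B a b * z b)); last by move=> a _; ring.
by rewrite -mulr_suml nB mul0r.
Qed.

Lemma shape_laplacian_contract x : U x ->
  \sum_a \sum_b shape a b x * shape_laplacian a b x =
  p1 * cubic_trace x - p2 ^+ 2 - 2 * quartic_trace x.
Proof.
move=> Ux; have [z E] := shape_laplacianE Ux.
have -> : \sum_a \sum_b shape a b x * shape_laplacian a b x =
  \sum_a (p1 * (\sum_b shape a b x * shape2 a b x) - p2 * (\sum_b shape a b x ^+ 2)
   - 2 * (\sum_b shape a b x * (\sum_e shape a e x * shape2 e b x))
   - \sum_b shape a b x * (nu a x * z b)).
  apply: eq_bigr => a _; rewrite !mulr_sumr -!sumrB.
  by apply: eq_bigr => b _; rewrite E; ring.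
rewrite !sumrB -!mulr_sumr sqnorm_shape// shape_shape_shape2// contract_nu; last first.
  by move=> b; exact: nu_shape.
by rewrite /cubic_trace expr2 subr0.
Qed.

(** The sum of this square norm and of the contraction of h with its Laplacian is the divergence of
    h_ab grad_c h_ab, which is zero since |h|^2 is constant. *)
Lemma sqnorm_tgrad_shape x : U x ->
  \sum_c \sum_a \sum_b tgrad c (shape a b) x ^+ 2 =
  p2 ^+ 2 - p1 * cubic_trace x + 2 * quartic_trace x.
Proof.
move=> Ux.
suff : \sum_c \sum_a \sum_b tgrad c (shape a b) x ^+ 2 +
    \sum_a \sum_b shape a b x * shape_laplacian a b x = 0.
  rewrite shape_laplacian_contract//; lra.
have -> : \sum_a \sum_b shape a b x * shape_laplacian a b x =
    \sum_c \sum_a \sum_b shape a b x * tgrad c (tgrad c (shape a b)) x.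
  rewrite exchange_big /=; under eq_bigr => a _ do under eq_bigr do rewrite mulr_sumr.
  under eq_bigr do rewrite exchange_big.
  rewrite exchange_big /=; apply: eq_bigr => c _; rewrite exchange_big /=.
  by apply: eq_bigr => a _.
rewrite -big_split /= big1// => c _.
have s1 a b : smooth U (tgrad c (shape a b)) by apply: tgrad_smooth; exact: shape_smooth.
have s2 a b : smooth U (fun y => shape a b y * tgrad c (shape a b) y).
  by apply: (smoothM oU); [exact: shape_smooth|exact: s1].
have s3 a : smooth U (fun y => \sum_b shape a b y * tgrad c (shape a b) y).
  by apply: (smooth_sum oU) => b _; exact: s2.
have : tgrad c (fun y => \sum_a \sum_b shape a b y * tgrad c (shape a b) y) x = 0.
  by apply: (@tgrad_cst_on c _ 0) => // y; exact: shape_tgrad_shape.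
rewrite tgrad_sum// => S0; apply: etrans S0; rewrite -big_split /=; apply: eq_bigr => a _.
rewrite tgrad_sum// -big_split /=; apply: eq_bigr => b _.
by rewrite (tgradM c (shape_smooth a b) (s1 a b) Ux) expr2.
Qed.

(* The tangential part of [tgrad c (shape a b)], that is, the covariant
   derivative of the second fundamental form. *)
Definition cov_shape c a b x : R :=
  tgrad c (shape a b) x + nu a x * shape2 c b x + nu b x * shape2 c a x.

(** [nu_tgrad_shape] gives the normal component of the derivative in either slot as minus h^2.
    Removing both lowers the square norm by twice the trace of h^4, which cancels the quartic term
    of [sqnorm_tgrad_shape]. *)
Lemma sqnorm_cov_shape x : U x ->
  \sum_c \sum_a \sum_b cov_shape c a b x ^+ 2 = p2 ^+ 2 - p1 * cubic_trace x.
Proof.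
move=> Ux; have -> : p2 ^+ 2 - p1 * cubic_trace x =
   \sum_c \sum_a \sum_b tgrad c (shape a b) x ^+ 2 - 2 * quartic_trace x.
  by rewrite sqnorm_tgrad_shape//; ring.
rewrite /quartic_trace mulr_sumr -sumrB; apply: eq_bigr => c _.
have A1 : \sum_a \sum_b tgrad c (shape a b) x * (nu a x * shape2 c b x)
    = - \sum_b shape2 c b x ^+ 2.
  rewrite exchange_big /= -sumrN; apply: eq_bigr => b _.
  rewrite (eq_bigr (fun a => nu a x * tgrad c (shape a b) x * shape2 c b x)).
    by rewrite -mulr_suml nu_tgrad_shape// mulNr expr2.
  by move=> a _; ring.
have A2 : \sum_a \sum_b tgrad c (shape a b) x * (nu b x * shape2 c a x)
    = - \sum_b shape2 c b x ^+ 2.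
  rewrite exchange_big /= -A1; apply: eq_bigr => a _; apply: eq_bigr => b _.
  by rewrite tgrad_shapeC.
have B1 : \sum_a \sum_b (nu a x * shape2 c b x) ^+ 2 = \sum_b shape2 c b x ^+ 2.
  rewrite -[RHS]mul1r -(nu_unit Ux) mulr_suml; apply: eq_bigr => a _.
  by rewrite mulr_sumr; apply: eq_bigr => b _; ring.
have B2 : \sum_a \sum_b (nu b x * shape2 c a x) ^+ 2 = \sum_b shape2 c b x ^+ 2.
  by rewrite exchange_big.
have nk : \sum_a nu a x * shape2 c a x = 0.
  by under eq_bigr do rewrite shape2C//; exact: nu_shape2.
have C : \sum_a \sum_b (nu a x * shape2 c b x) * (nu b x * shape2 c a x) = 0.
  rewrite big1// => a _.
  rewrite (eq_bigr (fun b => nu a x * shape2 c a x * (nu b x * shape2 c b x))).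
    by rewrite -mulr_sumr nk mulr0.
  by move=> b _; ring.
have -> : \sum_a \sum_b cov_shape c a b x ^+ 2 =
  \sum_a (\sum_b tgrad c (shape a b) x ^+ 2
   + 2 * (\sum_b tgrad c (shape a b) x * (nu a x * shape2 c b x))
   + 2 * (\sum_b tgrad c (shape a b) x * (nu b x * shape2 c a x))
   + \sum_b (nu a x * shape2 c b x) ^+ 2 + \sum_b (nu b x * shape2 c a x) ^+ 2
   + 2 * \sum_b (nu a x * shape2 c b x) * (nu b x * shape2 c a x)).
  apply: eq_bigr => a _; rewrite !mulr_sumr -!big_split /=.
  by apply: eq_bigr => b _; rewrite /cov_shape; ring.
rewrite !big_split /= -!mulr_sumr A1 A2 B1 B2 C; ring.
Qed.

(** * Parallel second fundamental form and its consequences *)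

Hypothesis simons_le0 : forall x, U x -> p2 ^+ 2 <= p1 * cubic_trace x.

Lemma sumr_eq0P (I : finType) (F : I -> R) : (forall i, 0 <= F i) ->
  \sum_i F i = 0 -> forall i, F i = 0.
Proof.
move=> F0 /eqP; rewrite psumr_eq0// => /allP F1 i.
by apply/eqP/F1; rewrite mem_index_enum.
Qed.

Lemma cov_shape_eq0 c a b x : U x -> cov_shape c a b x = 0.
Proof.
move=> Ux; have sq0 : \sum_c \sum_a \sum_b cov_shape c a b x ^+ 2 = 0.
  apply/eqP; rewrite eq_le sqnorm_cov_shape// subr_le0 simons_le0//=.
  rewrite -sqnorm_cov_shape//.
  by do 3![apply: sumr_ge0 => ? _]; exact: sqr_ge0.
have S2 := sumr_eq0P _ sq0 c.
have /S2 {}S2 : forall i, 0 <= \sum_a \sum_b cov_shape i a b x ^+ 2.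
  by move=> i; do 2![apply: sumr_ge0 => ? _]; exact: sqr_ge0.
have S1 := sumr_eq0P _ S2 a.
have /S1 {}S1 : forall i, 0 <= \sum_b cov_shape c i b x ^+ 2.
  by move=> i; apply: sumr_ge0 => ? _; exact: sqr_ge0.
have /eqP := sumr_eq0P (fun i => sqr_ge0 (cov_shape c a i x)) S1 b.
by rewrite sqrf_eq0 => /eqP.
Qed.

Lemma tgrad_shape_parallel c a b x : U x ->
  tgrad c (shape a b) x = - (nu a x * shape2 c b x + nu b x * shape2 c a x).
Proof. by move=> Ux; apply/eqP; rewrite -subr_eq0 opprK addrA; exact/eqP/cov_shape_eq0. Qed.

(** The Laplacian is computed twice: by Simons' formula, and by differentiating
    [tgrad_shape_parallel]. The cubic terms agree, so the difference [B] of the two sides consists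
    of terms with a factor nu. *)
Lemma shape2_shape a b x : U x -> p1 * shape2 a b x = p2 * shape a b x.
Proof.
move=> Ux.
have s2 i j l : smooth U (fun y => nu i y * shape2 j l y).
  by apply: (smoothM oU) => //; exact: shape2_smooth.
have nD c i d j : tgrad c (fun y => nu i y * shape2 d j y) x =
    shape c i x * shape2 d j x + nu i x * tgrad c (shape2 d j) x.
  by rewrite (tgradM c (nu_smooth i) (shape2_smooth d j) Ux).
pose w i := \sum_c tgrad c (shape2 c i) x.
have L i j : shape_laplacian i j x =
   - 2 * (\sum_e shape i e x * shape2 e j x) - nu i x * w j - nu j x * w i.
  have -> : shape_laplacian i j x = - \sum_c (
    shape c i x * shape2 c j x + nu i x * tgrad c (shape2 c j) x +
    (shape c j x * shape2 c i x + nu j x * tgrad c (shape2 c i) x)).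
    rewrite -sumrN; apply: eq_bigr => c _; rewrite -!nD -tgradD// -tgradN//.
      by apply: tgrad_eq_on => // y; exact: tgrad_shape_parallel.
    exact: (smoothD oU).
  rewrite !big_split /= -!mulr_sumr.
  under eq_bigr do rewrite shapeC//.
  have -> : \sum_c shape c j x * shape2 c i x = \sum_c shape i c x * shape2 c j x.
    under eq_bigr do rewrite mulr_sumr.
    under [RHS]eq_bigr do rewrite mulr_sumr.
    rewrite exchange_big /=; apply: eq_bigr => c _; apply: eq_bigr => d _.
    by rewrite [shape d c x]shapeC// [shape c i x]shapeC//; ring.
  rewrite -/(w i) -/(w j); ring.
have [z E] := shape_laplacianE Ux.
pose B i j := p1 * shape2 i j x - p2 * shape i j x.
have BE i j : B i j = nu i x * (z j - w j) - nu j x * w i.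
  by have := E i j; rewrite L /B; lra.
have nB j : \sum_i nu i x * B i j = 0.
  rewrite (eq_bigr (fun i => p1 * (nu i x * shape2 i j x) - p2 * (nu i x * shape i j x))).
    by rewrite sumrB -!mulr_sumr nu_shape2// nu_shape// !mulr0 subrr.
  by move=> i _; rewrite /B; ring.
have BC i j : B i j = B j i by rewrite /B shape2C// shapeC.
(* [B] is annihilated by nu in both indices, hence orthogonal to the terms in nu to which it is
   equal; so it is orthogonal to itself. *)
have sq0 : \sum_i \sum_j B i j ^+ 2 = 0.
  rewrite (eq_bigr (fun i => \sum_j B i j * (nu i x * (z j - w j)) -
     \sum_j B i j * (nu j x * w i))); last first.
    by move=> i _; rewrite -sumrB; apply: eq_bigr => j _; rewrite expr2 {2}BE; ring.
  rewrite sumrB contract_nu// sub0r exchange_big /=.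
  under eq_bigr => i _ do under eq_bigr do rewrite BC.
  by rewrite contract_nu// oppr0.
have S1 : \sum_j B a j ^+ 2 = 0.
  by apply: sumr_eq0P sq0 a => i; apply: sumr_ge0 => ? _; exact: sqr_ge0.
have /eqP := sumr_eq0P (fun i => sqr_ge0 (B a i)) S1 b.
by rewrite sqrf_eq0 subr_eq0 => /eqP.
Qed.

Hypothesis p1_neq0 : p1 != 0.

Lemma p2_neq0 x : U x -> p2 != 0.
Proof.
move=> Ux; apply/eqP => p20; have := p1_neq0; rewrite -(tr_shape Ux) big1 ?eqxx// => a _.
have sq0 : \sum_a \sum_b shape a b x ^+ 2 = 0 by rewrite sqnorm_shape.
have S1 : \sum_b shape a b x ^+ 2 = 0.
  by apply: sumr_eq0P sq0 a => i; apply: sumr_ge0 => ? _; exact: sqr_ge0.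
have /eqP := sumr_eq0P (fun i => sqr_ge0 (shape a i x)) S1 a.
by rewrite sqrf_eq0 => /eqP.
Qed.

(* The orthogonal projection onto the sum of the normal line and the curved
   principal directions. *)
Definition curved_proj a b x : R := p1 / p2 * shape a b x + nu a x * nu b x.

Lemma curved_proj_smooth a b : smooth U (curved_proj a b).
Proof.
apply: (smoothD oU); apply: (smoothM oU) => //; [exact: smooth_cst|exact: shape_smooth].
Qed.

(** As h^2 = (p2 / p1) h, the derivative of (p1 / p2) h_ab is - (nu_a h_cb + nu_b h_ca), exactly
    opposite to the derivative of nu_a nu_b. *)
Lemma pderiv_curved_proj j a b x : U x -> pderiv j (curved_proj a b) x = 0.
Proof.
move=> Ux; rewrite pderiv_tgrad// big1// => c _.
have p20 := p2_neq0 Ux.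
have s1 : smooth U (fun y => p1 / p2 * shape a b y).
  by apply: (smoothM oU); [exact: smooth_cst|exact: shape_smooth].
have s2 : smooth U (fun y => nu a y * nu b y) by exact: (smoothM oU).
rewrite (tgradD c s1 s2 Ux) (tgradM c (nu_smooth a) (nu_smooth b) Ux).
rewrite (tgradM c (smooth_cst _ (p1 / p2)) (shape_smooth a b) Ux).
rewrite (@tgrad_cst_on c (fun=> p1 / p2) (p1 / p2))// mul0r add0r tgrad_shape_parallel//.
have K k l : shape2 k l x = p2 / p1 * shape k l x.
  by apply: (mulfI p1_neq0); rewrite shape2_shape//; field.
rewrite !K -/(shape c a x) -/(shape c b x).
apply/eqP; rewrite mulf_eq0; apply/orP; right; apply/eqP; field.
by rewrite p1_neq0 p20.
Qed.

(** With P the projection [curved_proj], the tangential gradient of f - (p1 / p2) nu is 1 - P, and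
    (1 - P) P = 0; P itself is constant. *)
Lemma pderiv_center j b x : U x ->
  pderiv j (fun y => \sum_a (f a y - p1 / p2 * nu a y) * curved_proj a b y) x = 0.
Proof.
move=> Ux; rewrite pderiv_tgrad// big1// => c _.
apply/eqP; rewrite mulf_eq0; apply/orP; right; apply/eqP.
have p20 := p2_neq0 Ux.
have s0 a : smooth U (fun y => p1 / p2 * nu a y).
  by apply: (smoothM oU) => //; exact: smooth_cst.
have s1 a : smooth U (fun y => f a y - p1 / p2 * nu a y) by exact: (smoothB oU).
rewrite tgrad_sum//; last first.
  by move=> a _; apply: (smoothM oU) => //; exact: curved_proj_smooth.
have E a : tgrad c (fun y => (f a y - p1 / p2 * nu a y) * curved_proj a b y) x =
   ((c == a)%:R - curved_proj c a x) * curved_proj a b x.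
  rewrite (tgradM c (s1 a) (curved_proj_smooth a b) Ux).
  have -> : tgrad c (curved_proj a b) x = 0.
    by rewrite /tgrad big1// => i _; rewrite pderiv_curved_proj// mulr0.
  rewrite mulr0 addr0; congr (_ * _).
  rewrite (tgradD c (f_smooth a) (smoothN oU (s0 a)) Ux) (tgradN c (s0 a) Ux).
  rewrite (tgradM c (smooth_cst _ (p1 / p2)) (nu_smooth a) Ux).
  rewrite (@tgrad_cst_on c (fun=> p1 / p2) (p1 / p2))// mul0r add0r [X in X - _]coframeK//.
  by rewrite /curved_proj /shape opprD addrA addrAC.
rewrite (eq_bigr _ (fun a _ => E a)).
under eq_bigr do rewrite mulrBl; rewrite sumrB sum_delta.
apply/eqP; rewrite subr_eq0; apply/eqP.
rewrite (eq_bigr (fun a => (p1 / p2) ^+ 2 * (shape c a x * shape a b x) +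
   p1 / p2 * nu b x * (shape c a x * nu a x) +
   p1 / p2 * nu c x * (nu a x * shape a b x) +
   nu c x * nu b x * (nu a x * nu a x))); last first.
  by move=> a _; rewrite /curved_proj; ring.
rewrite !big_split /= -!mulr_sumr nu_unit// nu_shape// shape_nu// !mulr0 !addr0 mulr1.
rewrite /curved_proj; congr (_ + _).
have -> : \sum_a shape c a x * shape a b x = shape2 c b x.
  by apply: eq_bigr => a _; rewrite [shape a b x]shapeC.
have -> : shape2 c b x = p2 / p1 * shape c b x.
  by apply: (mulfI p1_neq0); rewrite shape2_shape//; field.
by field; rewrite p1_neq0 p20.
Qed.

End TangentialGradient.

(** * Traces of powers and symmetric functions of the eigenvalues *)

Section TracePowers.
Variables (F : fieldType).

Lemma char_poly_conj n (S A : 'M[F]_n) : S \in unitmx ->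
  char_poly (S *m A *m invmx S) = char_poly A.
Proof.
move=> uS; rewrite /char_poly.
have -> : char_poly_mx (S *m A *m invmx S) =
   map_mx polyC S *m char_poly_mx A *m map_mx polyC (invmx S).
  rewrite /char_poly_mx mulmxBr mulmxBl scalar_mxC -!map_mxM /=.
  by rewrite -[X in _ = X - _]mulmxA -map_mxM mulmxV// map_mx1 mulmx1.
by rewrite !det_mulmx mulrC mulrA -det_mulmx -map_mxM mulVmx// map_mx1 det1 mul1r.
Qed.

Lemma expmx_lblock m (a : F) (C : 'M[F]_(m, 1)) (D : 'M[F]_m) (k : nat) :
  exists C', (block_mx a%:M 0 C D : 'M[F]_(1 + m)) ^+ k = block_mx (a ^+ k)%:M 0 C' (D ^+ k).
Proof.
elim: k => [|k [C' IH]].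
  by exists 0; rewrite !expr0; exact: scalar_mx_block.
exists (C' *m a%:M + D ^+ k *m C).
rewrite exprSr IH -[LHS]/(_ *m _) mulmx_block !mul0mx !mulmx0 !addr0 !add0r.
by rewrite -scalar_mxM !exprSr.
Qed.

Lemma expmx_conj n (S A : 'M[F]_n) k : S \in unitmx ->
  (S *m A *m invmx S) ^+ k = S *m A ^+ k *m invmx S.
Proof.
move=> uS; elim: k => [|k IH].
  by rewrite !expr0 -[LHS]/(1%:M) -[X in S *m X]/(1%:M) mulmx1 mulmxV.
rewrite !exprSr IH.
change (S *m A ^+ k *m invmx S *m (S *m A *m invmx S) = S *m (A ^+ k *m A) *m invmx S).
by rewrite !mulmxA mulmxKV.
Qed.

(** Deflation: in a basis starting with an eigenvector the matrix is block triangular, and the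
    induction applies to the lower block. Only the splitting of the characteristic polynomial is
    used, which suits a shape operator written in chart coordinates, where its matrix need not be
    symmetric. *)
Lemma mxtrace_exp_split n (A : 'M[F]_n) (s : seq F) (k : nat) :
  char_poly A = \prod_(a <- s) ('X - a%:P) -> \tr (A ^+ k) = \sum_(a <- s) a ^+ k.
Proof.
elim: n => [|m IH] in A s *.
  move=> E; have : size (\prod_(a <- s) ('X - a%:P)) = 1%N by rewrite -E size_char_poly.
  by rewrite size_prod_XsubC => -[/size0nil->]; rewrite /mxtrace big_ord0 big_nil.
case: s => [|a s] E.
  by have := size_char_poly A; rewrite E big_nil size_poly1.
move: (A : 'M[F]_(1 + m)) E => {}A E.
have : eigenvalue A a by rewrite eigenvalue_root_char E big_cons rootM root_XsubC eqxx.
move=> /eigenvalueP[v vA v0].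
(* The first row of [row_ebase v] is [v] up to the invertible scalar [col_ebase v], so [S] is a
   basis that starts with an eigenvector. *)
pose S : 'M[F]_(1 + m) := row_ebase v.
have uS : S \in unitmx by exact: row_ebase_unit.
have vS : v = col_ebase v *m usubmx S.
  rewrite -{1}(mulmx_ebase v) rank_rV v0 -mulmxA; congr (_ *m _).
  rewrite -/S -[X in _ *m X = _]vsubmxK.
  have -> : pid_mx true = (row_mx 1%:M 0 : 'M[F]_(1, 1 + m)).
    exact: (@pid_mx_row F m 1).
  by apply: etrans (mul_row_col 1%:M 0 (usubmx S) (dsubmx S)) _; rewrite mul1mx mul0mx addr0.
have uA : usubmx S *m A = a *: usubmx S.
  have uc : col_ebase v \in unitmx by exact: col_ebase_unit.
  by rewrite -[usubmx S](mulKmx uc) -vS -mulmxA vA -scalemxAr.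
pose B : 'M[F]_(1 + m) := S *m A *m invmx S.
have BE : B = block_mx a%:M 0 (dlsubmx B) (drsubmx B).
  rewrite -[LHS]submxK; have : usubmx B = row_mx a%:M 0.
    rewrite /B -mulmxA -[X in usubmx (X *m _)]vsubmxK mul_col_mx col_mxKu mulmxA uA -scalemxAl.
    have : usubmx (S *m invmx S) = row_mx 1%:M 0.
      by rewrite mulmxV// scalar_mx_block /block_mx col_mxKu.
    rewrite -[X in usubmx (X *m _)]vsubmxK mul_col_mx col_mxKu => ->.
    by rewrite scale_row_mx scaler0 scalemx1.
  rewrite /ulsubmx /ursubmx => ->; by rewrite row_mxKl row_mxKr.
have EB : char_poly B = char_poly A by exact: char_poly_conj.
have ED : char_poly (drsubmx B) = \prod_(a <- s) ('X - a%:P).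
  have : char_poly B = ('X - a%:P) * char_poly (drsubmx B).
    rewrite {1}BE /char_poly /char_poly_mx map_block_mx scalar_mx_block opp_block_mx.
    rewrite add_block_mx map_mx0 oppr0 !addr0 det_lblock; congr (_ * _).
    by rewrite map_scalar_mx -rmorphB /= det_scalar1.
  rewrite EB E big_cons => /mulfI H; apply/esym/H.
  by rewrite polyXsubC_eq0.
have -> : \tr (A ^+ k) = \tr (B ^+ k).
  by rewrite expmx_conj// mxtrace_mulC mulmxA mulVmx// mul1mx.
have [C' ->] : exists C', B ^+ k = block_mx (a ^+ k)%:M 0 C' (drsubmx B ^+ k).
  have [C' HC] := expmx_lblock a (dlsubmx B) (drsubmx B) k.
  by rewrite -BE in HC; exists C'.
by rewrite mxtrace_block (IH _ _ ED) big_cons mxtrace_scalar mulr1n.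
Qed.

End TracePowers.

Section Newton.
Variables (F : comNzRingType).

Definition elem_sym (n : nat) (r : nat) (lam : 'rV[F]_n) : F :=
  \sum_(I : {set 'I_n} | #|I| == r) \prod_(i in I) lam 0 i.

Lemma elem_sym_coef n (r : nat) (lam : 'rV[F]_n) :
  elem_sym r lam = (\prod_(i < n) (1 + lam 0 i *: 'X))`_r.
Proof.
under eq_bigr do rewrite addrC.
rewrite bigA_distr coef_sum /elem_sym [LHS]big_mkcond /=; apply: eq_bigr => I _.
have -> : \prod_i (if i \in I then lam 0 i *: 'X else 1) =
    (\prod_(i in I) lam 0 i) *: 'X^#|I| :> {poly F}.
  rewrite -big_mkcond /= scaler_prod; congr (_ *: _).
  by rewrite prodr_const.
rewrite coefZ coefXn eq_sym; case: eqP; by rewrite ?mulr1 ?mulr0.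
Qed.

(** On the generating polynomial, adding a root [a] changes the coefficient p_k to p_k + a p_(k-1),
    which makes the identities an induction on [s]; p_0 = 1 is carried along to feed p_1. *)
Lemma newton_seq (s : seq F) (p := \prod_(a <- s) (1 + a *: 'X) : {poly F}) :
  [/\ p`_0 = 1, \sum_(a <- s) a = p`_1,
      \sum_(a <- s) a ^+ 2 = p`_1 ^+ 2 - 2 * p`_2 &
      \sum_(a <- s) a ^+ 3 = p`_1 ^+ 3 - 3 * p`_1 * p`_2 + 3 * p`_3].
Proof.
rewrite {}/p; elim: s => [|a s].
  by rewrite !big_nil !coefC /=; split=> //; ring.
rewrite !big_cons; set p := \prod_(_ <- _) _ => -[p0 -> -> ->].
have c0 : ((1 + a *: 'X) * p)`_0 = p`_0.
  by rewrite mulrDl mul1r -scalerAl coefD coefZ coefXM /= mulr0 addr0.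
have cS k : ((1 + a *: 'X) * p)`_k.+1 = p`_k.+1 + a * p`_k.
  by rewrite mulrDl mul1r -scalerAl coefD coefZ coefXM.
by rewrite c0 !cS p0; split => //; ring.
Qed.

Lemma newton n (lam : 'rV[F]_n) :
  [/\ \sum_i lam 0 i = elem_sym 1 lam,
      \sum_i lam 0 i ^+ 2 = elem_sym 1 lam ^+ 2 - 2 * elem_sym 2 lam &
      \sum_i lam 0 i ^+ 3 =
        elem_sym 1 lam ^+ 3 - 3 * elem_sym 1 lam * elem_sym 2 lam + 3 * elem_sym 3 lam].
Proof.
rewrite !elem_sym_coef; have [_] := newton_seq [seq lam 0 i | i <- index_enum 'I_n].
by rewrite !big_map.
Qed.

End Newton.

Lemma char_poly_traces (F : fieldType) n (A : 'M[F]_n) (lam : 'rV[F]_n) :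
  char_poly A = \prod_(i < n) ('X - (lam 0 i)%:P) ->
  [/\ \tr A = elem_sym 1 lam, \tr (A *m A) = elem_sym 1 lam ^+ 2 - 2 * elem_sym 2 lam &
      \tr (A *m A *m A) =
        elem_sym 1 lam ^+ 3 - 3 * elem_sym 1 lam * elem_sym 2 lam + 3 * elem_sym 3 lam].
Proof.
move=> E; have T k : \tr (A ^+ k) = \sum_i lam 0 i ^+ k.
  have /(_ k) := @mxtrace_exp_split F n A [seq lam 0 i | i <- index_enum 'I_n].
  by rewrite !big_map => /(_ E).
have [<- <- <-] := newton lam; split.
- by rewrite -[A in LHS]expr1 T; under eq_bigr do rewrite expr1.
- by rewrite -T.
- by rewrite -T; congr (\tr _); rewrite [in RHS]exprSr.
Qed.

(** * Orthonormal bases *)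

Section Orthonormalization.
Variable R : rcfType.

Definition posdef n (G : 'M[R]_n) :=
  G^T = G /\ forall v : 'rV[R]_n, v != 0 -> 0 < (v *m G *m v^T) 0 0.

(** Cholesky factorization by induction: eliminate with the pivot [a] and recurse on the Schur
    complement [S]. *)
Lemma posdef_orthonormal n (G : 'M[R]_n) : posdef G ->
  exists L : 'M[R]_n, L *m G *m L^T = 1%:M.
Proof.
elim: n G => [|m IH] G.
  by exists 1%:M; apply/matrixP => -[].
move=> posG; have {posG} [sG pG] : @posdef (1 + m) G := posG.
move: (G : 'M[R]_(1 + m)) sG pG => {}G sG pG.
pose a := G 0 0; pose b : 'M[R]_(m, 1) := dlsubmx G; pose D : 'M[R]_m := drsubmx G.
have ulE : ulsubmx G = a%:M.
  by rewrite [ulsubmx G]mx11_scalar; congr (_%:M); rewrite !mxE; congr (G _ _); apply/val_inj.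
have GE : G = block_mx a%:M b^T b D.
  rewrite -[LHS]submxK ulE; congr block_mx.
  by rewrite -{1}sG; apply/matrixP => i j; rewrite !mxE.
have sD : D^T = D by rewrite /D -{2}sG; apply/matrixP => i j; rewrite !mxE.
have a0 : 0 < a.
  have := pG (row_mx 1%:M 0).
  rewrite {1}GE tr_row_mx mul_row_block mul_row_col !trmx0 !mulmx0 !mul0mx !addr0.
  rewrite mul1mx trmx1 mulmx1 mxE eqxx mulr1n; apply.
  apply/eqP => /(congr1 (@lsubmx _ _ 1 m)); rewrite row_mxKl linear0.
  by move=> /matrixP /(_ 0 0) /eqP; rewrite !mxE eqxx oner_eq0.
pose S : 'M[R]_m := D - b *m (a^-1)%:M *m b^T.
have pS : posdef S.
  split.
    by rewrite linearB /= sD !trmx_mul trmxK tr_scalar_mx mulmxA.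
  (* The first coordinate is chosen to minimize the form of [G] for the given [w]; the minimum is
     the form of the Schur complement. *)
  move=> w w0; have := pG (row_mx (- (w *m b *m (a^-1)%:M)) w).
  have -> : (row_mx (- (w *m b *m (a^-1)%:M)) w *m G *m
     (row_mx (- (w *m b *m (a^-1)%:M)) w)^T) = w *m S *m w^T.
    rewrite {1}GE tr_row_mx mul_row_block mul_row_col.
    have -> : - (w *m b *m (a^-1)%:M) *m a%:M + w *m b = 0.
      by rewrite mulNmx -(mulmxA (w *m b)) -scalar_mxM mulVf ?gt_eqF// mulmx1 addNr.
    by rewrite mul0mx add0r /S mulmxBr !mulmxA mulNmx [in RHS]addrC.
  apply; apply: contraNneq w0 => /(congr1 (@rsubmx _ _ 1 m)).
  by rewrite row_mxKr linear0 => ->.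
have [L LS] := IH S pS.
pose s := Num.sqrt a.
have s0 : s != 0 by rewrite gt_eqF// sqrtr_gt0.
have ss : s ^+ 2 = a by rewrite sqr_sqrtr// ltW.
suff : exists L : 'M[R]_(1 + m), L *m G *m L^T = 1%:M by [].
exists (block_mx (s^-1)%:M 0 (- (L *m b *m (a^-1)%:M)) L).
rewrite {1}GE tr_block_mx mulmx_block !mul0mx !addr0.
have -> : - (L *m b *m (a^-1)%:M) *m a%:M + L *m b = 0.
  by rewrite mulNmx -(mulmxA (L *m b)) -scalar_mxM mulVf ?gt_eqF// mulmx1 addNr.
rewrite mulmx_block !mul0mx !add0r trmx0 !mulmx0 !addr0 tr_scalar_mx -!scalar_mxM.
have -> : s^-1 * a * s^-1 = 1 by rewrite -ss; field.
have -> : (s^-1 * a)%:M *m (- (L *m b *m (a^-1)%:M))^T + (s^-1)%:M *m b^T *m L^T = 0.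
  rewrite linearN /= !trmx_mul tr_scalar_mx mulmxN !mulmxA -!scalar_mxM.
  by rewrite mulfK ?gt_eqF// addNr.
have -> : (- (L *m b *m (a^-1)%:M) *m b^T + L *m D) *m L^T = 1%:M.
  by rewrite -LS /S mulmxBr !mulmxA mulNmx addrC.
by rewrite -scalar_mx_block.
Qed.

Lemma gram_posdef m N (B : 'M[R]_(m, N)) : row_free B -> posdef (B *m B^T).
Proof.
move=> fB; split; first by rewrite trmx_mul trmxK.
move=> v v0; rewrite mulmxA -mulmxA -trmx_mul.
have vB0 : v *m B != 0 by rewrite mulmx_free_eq0.
rewrite mxE lt_neqAle; under eq_bigr do rewrite [X in _ * X]mxE -expr2.
apply/andP; split; last by apply: sumr_ge0 => i _; exact: sqr_ge0.
apply: contraNneq vB0 => /esym /eqP; rewrite psumr_eq0; last by move=> i _; exact: sqr_ge0.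
move=> /allP H; apply/eqP/rowP => i; apply/eqP; rewrite [X in _ == X]mxE -sqrf_eq0.
by apply: H; rewrite mem_index_enum.
Qed.

Lemma orthonormal_row_base m N (A : 'M[R]_(m, N)) :
  exists E : 'M[R]_(\rank A, N), E *m E^T = 1%:M /\ (E :=: A)%MS.
Proof.
have [L LG] := posdef_orthonormal (gram_posdef (row_base_free A)).
exists (L *m row_base A); split; first by rewrite trmx_mul -LG !mulmxA.
have uL : row_free L.
  rewrite row_free_unit; have : L *m (row_base A *m (row_base A)^T *m L^T) = 1%:M.
    by rewrite mulmxA.
  by case/mulmx1_unit.
by apply: eqmx_trans (eqmxMfull _ _) (eq_row_base A); rewrite row_full_unit -row_free_unit.
Qed.

Lemma proj_orthonormal_base N (P : 'M[R]_N) : P^T = P -> P *m P = P ->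
  exists E : 'M[R]_(\rank P, N), [/\ E *m E^T = 1%:M, E *m P = E & P = E^T *m E].
Proof.
move=> sP iP; have [E [EE EP]] := orthonormal_row_base P.
have EPE : E *m P = E.
  have /submxP[C ->] : (E <= P)%MS by rewrite EP.
  by rewrite -mulmxA iP.
exists E; split => //; have /submxP[C PE] : (P <= E)%MS by rewrite -EP.
move: (\rank P) E EE EPE C PE {EP} => r E EE EPE C PE.
have PEE : P *m E^T *m E = P by rewrite {1}PE -(mulmxA C) EE mulmx1 -PE.
have := congr1 trmx PEE; rewrite !trmx_mul trmxK sP mulmxA => <-.
by rewrite -mulmxA EPE.
Qed.

(** [Q] stacks orthonormal bases of the kernel and of the image of [P]. The kernel comes first
    because [cylinder] puts the flat coordinates first. *)
Lemma proj_diag N (P : 'M[R]_N) (k : nat) : P^T = P -> P *m P = P -> \tr P = k%:R ->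
  exists Q : 'M[R]_N, Q *m Q^T = 1%:M /\
    forall x : 'rV[R]_N, x *m Q *m P = (\row_j (if (N - k <= j)%N then x 0 j else 0)) *m Q.
Proof.
move=> sP iP tP.
have [E1 [E1E1 E1P PE1]] := proj_orthonormal_base sP iP.
have [||E2 [E2E2 E2P PE2]] := @proj_orthonormal_base N (1%:M - P).
- by rewrite linearB /= trmx1 sP.
- by rewrite mulmxBr mulmx1 mulmxBl mul1mx iP subrr subr0.
(* The ranks are generalized so that the dimension equalities [r1k] and [r2k], read off from traces,
   can be substituted in the matrix types. *)
move: (\rank P) E1 E1E1 E1P PE1 (\rank (1%:M - P)) E2 E2E2 E2P PE2.
move=> r1 E1 E1E1 E1P PE1 r2 E2 E2E2 E2P PE2.
have r1k : r1 = k.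
  apply/eqP; rewrite -(eqr_nat R) -tP PE1 mxtrace_mulC E1E1 mxtrace1//.
have r2k : (r2 + r1)%N = N.
  apply/eqP; rewrite -(eqr_nat R) natrD r1k -tP -(mxtrace1 R r2) -E2E2 mxtrace_mulC -PE2.
  by rewrite linearB /= mxtrace1 subrK.
move: sP iP tP; subst k; move: P E1 E1E1 E1P PE1 E2 E2E2 E2P PE2; subst N.
move=> P E1 E1E1 E1P PE1 E2 E2E2 E2P PE2 sP iP tP.
have E2P0 : E2 *m P = 0.
  by move/eqP: E2P; rewrite mulmxBr mulmx1 subr_eq addrC -subr_eq subrr eq_sym => /eqP.
have E12 : E1 *m E2^T = 0.
  by rewrite -E1P -mulmxA -{1}sP -trmx_mul E2P0 trmx0 mulmx0.
have E21 : E2 *m E1^T = 0 by rewrite -[LHS]trmxK trmx_mul trmxK E12 trmx0.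
exists (col_mx E2 E1); split.
  by rewrite tr_col_mx mul_col_row E2E2 E1E1 E12 E21 -scalar_mx_block.
move=> x; rewrite -mulmxA mul_col_mx E2P0 E1P.
have -> : (\row_j (if (r2 + r1 - r1 <= j)%N then x 0 j else 0)) = row_mx 0 (rsubmx x).
  apply/rowP => j; rewrite !mxE addnK; case: splitP => i ji; rewrite ji.
    by rewrite leqNgt ltn_ord /= mxE.
  by rewrite leq_addr !mxE; congr (x 0 _); exact/val_inj.
by rewrite -{1}[x]hsubmxK !mul_row_col mul0mx mulmx0.
Qed.

End Orthonormalization.

(** * Hypersurfaces in a chart *)

Section SumsAndInnerProducts.
Variables (R : realType) (n : nat).

Lemma innerE (G : 'M[R]_n) (u v : 'rV[R]_n) :
  inner G u v = \sum_i \sum_j u 0 i * G i j * v 0 j.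
Proof.
rewrite /inner mxE exchange_big /=; apply: eq_bigr => j _; rewrite mxE mulr_suml.
by apply: eq_bigr => i _; rewrite mxE.
Qed.

Lemma inner_row (G E : 'M[R]_n) i j : inner G (row i E) (row j E) = (E *m G *m E^T) i j.
Proof.
rewrite /inner -row_mul mxE [RHS]mxE; apply: eq_bigr => k _.
by congr (_ * _); [rewrite [LHS]mxE|rewrite !mxE].
Qed.

Lemma sum_lt_sym (T : 'I_n -> 'I_n -> R) : (forall i j, T i j = T j i) ->
  (forall i, T i i = 0) ->
  2 * \sum_(i < n) \sum_(j < n | (i < j)%N) T i j = \sum_i \sum_j T i j.
Proof.
move=> TC T0.
have E i : \sum_j T i j = \sum_(j < n | (i < j)%N) T i j + \sum_(j < n | (j < i)%N) T i j.
  rewrite (bigID (fun j : 'I_n => (i < j)%N)) /=; congr (_ + _).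
  rewrite (bigD1 i) ?ltnn//= T0 add0r; apply: eq_bigl => j.
  by rewrite -leqNgt [in RHS]ltn_neqAle andbC.
rewrite (eq_bigr _ (fun i _ => E i)) big_split /= mulr2n mulrDl mul1r; congr (_ + _).
rewrite (exchange_big_dep predT)//=; apply: eq_bigr => i _; apply: eq_bigr => j _.
exact: TC.
Qed.

End SumsAndInnerProducts.

Section SmoothInverse.
Variables (R : realType) (n : nat) (U : set 'rV[R]_n).
Hypothesis oU : open U.

Lemma smooth_det m (A : 'rV[R]_n -> 'M[R]_m) :
  (forall i j, smooth U (fun x => A x i j)) -> smooth U (fun x => \det (A x)).
Proof.
move=> sA; apply: (smooth_sum oU) => s _; apply: (smoothM oU); first exact: smooth_cst.
by apply: (smooth_prod oU).
Qed.

Lemma smooth_invmx m (A : 'rV[R]_n -> 'M[R]_m) i j :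
  (forall i j, smooth U (fun x => A x i j)) -> (forall x, U x -> A x \in unitmx) ->
  smooth U (fun x => invmx (A x) i j).
Proof.
move=> sA uA.
apply: (@smooth_ext _ _ _ oU (fun x => (\det (A x))^-1 * cofactor (A x) j i)).
  by move=> x Ux; rewrite /invmx uA// !mxE.
apply: (smoothM oU).
  apply: (smoothV oU) => [|x Ux]; first exact: smooth_det.
  by have := uA x Ux; rewrite unitmxE unitfE.
apply: (smoothM oU); first exact: smooth_cst.
apply: smooth_det => k l.
by apply: (@smooth_ext _ _ _ oU (fun x => A x (lift j k) (lift i l))) => // x _; rewrite !mxE.
Qed.

End SmoothInverse.

Section Hypersurface.
Variables (R : realType) (n : nat) (U : set 'rV[R]_n).
Hypothesis oU : open U.
Variables (F N : 'rV[R]_n -> 'rV[R]_n.+1) (g : 'rV[R]_n -> 'M[R]_n).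
Hypothesis F_smooth : smooth_on U F.
Hypothesis N_smooth : smooth_on U N.
Hypothesis F_immersion : forall x, U x -> row_free ('J F x) /\ 'J F x *m ('J F x)^T = g x.
Hypothesis N_unit : forall x, U x -> N x *m (N x)^T = 1%:M.
Hypothesis N_normal : forall x, U x -> 'J F x *m (N x)^T = 0.
Implicit Types (x : 'rV[R]_n) (i j k l m : 'I_n) (a b c d : 'I_n.+1).

Definition pos a x : R := F x 0 a.
Definition nor a x : R := N x 0 a.
(** The pseudo-inverse of the Jacobian; it instantiates [X] of the section on tangential
    gradients. *)
Definition coframe a j x : R := (('J F x)^T *m invmx (g x)) a j.

Lemma pos_smooth a : smooth U (pos a).
Proof. exact: smooth_coord. Qed.

Lemma nor_smooth a : smooth U (nor a).
Proof. exact: smooth_coord. Qed.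

Lemma jac_pos x j a : U x -> 'J F x j a = pderiv j (pos a) x.
Proof. by move=> Ux; rewrite (jacobianE oU j a F_smooth Ux). Qed.

Lemma jac_nor x j a : U x -> 'J N x j a = pderiv j (nor a) x.
Proof. by move=> Ux; rewrite (jacobianE oU j a N_smooth Ux). Qed.

Lemma g_unit x : U x -> g x \in unitmx.
Proof.
move=> Ux; have [fJ gE] := F_immersion Ux.
have [L] := posdef_orthonormal (gram_posdef fJ); rewrite gE.
by move=> /mulmx1_unit[]; rewrite unitmx_mul => /andP[].
Qed.

Lemma g_sym x : U x -> (g x)^T = g x.
Proof. by move=> Ux; have [_ <-] := F_immersion Ux; rewrite trmx_mul trmxK. Qed.

Lemma gE x i j : U x -> g x i j = \sum_a pderiv i (pos a) x * pderiv j (pos a) x.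
Proof.
move=> Ux; have [_ <-] := F_immersion Ux; rewrite mxE; apply: eq_bigr => a _.
by rewrite [X in _ * X]mxE !jac_pos.
Qed.

Lemma g_smooth i j : smooth U (fun x => g x i j).
Proof.
apply: (@smooth_ext _ _ _ oU (fun x => \sum_a pderiv i (pos a) x * pderiv j (pos a) x)).
  by move=> x Ux; rewrite gE.
by apply: (smooth_sum oU) => a _; apply: (smoothM oU); apply: smooth_pderiv; exact: pos_smooth.
Qed.

Lemma coframe_smooth a j : smooth U (coframe a j).
Proof.
apply: (@smooth_ext _ _ _ oU (fun x => \sum_k pderiv k (pos a) x * invmx (g x) k j)).
  by move=> x Ux; rewrite /coframe mxE; apply: eq_bigr => k _; rewrite mxE jac_pos.
apply: (smooth_sum oU) => k _; apply: (smoothM oU).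
  by apply: smooth_pderiv; exact: pos_smooth.
by apply: (smooth_invmx oU); [exact: g_smooth|exact: g_unit].
Qed.

Lemma jac_coframe x : U x -> 'J F x *m (('J F x)^T *m invmx (g x)) = 1%:M.
Proof. by move=> Ux; rewrite mulmxA (F_immersion Ux).2 mulmxV// g_unit. Qed.

(** Both sides are the orthogonal projection onto the tangent space. The normal and the rows of the
    Jacobian form an invertible matrix [W], and equality is checked on these rows. *)
Lemma coframe_jac x : U x ->
  ('J F x)^T *m invmx (g x) *m 'J F x = 1%:M - (N x)^T *m N x.
Proof.
move=> Ux; set J := 'J F x; have JN := N_normal Ux; have NN := N_unit Ux.
have NJ : N x *m J^T = 0 by rewrite -[LHS]trmxK trmx_mul trmxK JN trmx0.
pose W : 'M[R]_(1 + n) := col_mx (N x) J.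
have uW : W \in unitmx.
  have : W *m W^T \in unitmx.
    rewrite tr_col_mx mul_col_row NN JN NJ (F_immersion Ux).2.
    by rewrite unitmxE det_ublock det1 mul1r -unitmxE g_unit.
  by rewrite unitmx_mul => /andP[].
have E : W *m (J^T *m invmx (g x) *m J) = W *m (1%:M - (N x)^T *m N x).
  rewrite /W !mul_col_mx; congr col_mx.
    by rewrite mulmxBr mulmx1 !mulmxA NJ NN mul1mx !mul0mx subrr.
  by rewrite mulmxBr mulmx1 !mulmxA JN mul0mx subr0 -(mulmxA J) jac_coframe// mul1mx.
by rewrite -[LHS](mulKmx uW) E mulKmx.
Qed.

Lemma frameK x j k : U x -> \sum_a pderiv j (pos a) x * coframe a k x = (j == k)%:R.
Proof.
move=> Ux; have := congr1 (fun B : 'M[R]_n => B j k) (jac_coframe Ux).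
by rewrite [X in _ = X -> _]mxE [X in X = _ -> _]mxE => <-; apply: eq_bigr => a _; rewrite jac_pos.
Qed.

Lemma coframeK x a b : U x ->
  \sum_j coframe a j x * pderiv j (pos b) x = (a == b)%:R - nor a x * nor b x.
Proof.
move=> Ux; have := congr1 (fun B : 'M[R]_n.+1 => B a b) (coframe_jac Ux).
rewrite mxE [RHS]mxE [X in _ = X + _]mxE [X in _ = _ + X]mxE [X in _ = _ - X]mxE.
rewrite big_ord1 mxE => <-.
by apply: eq_bigr => j _; rewrite jac_pos.
Qed.

Lemma nor_coframe x j : U x -> \sum_a nor a x * coframe a j x = 0.
Proof.
move=> Ux; have NJ : N x *m ('J F x)^T = 0.
  by rewrite -[LHS]trmxK trmx_mul trmxK N_normal// trmx0.
have : (N x *m (('J F x)^T *m invmx (g x))) 0 j = 0 by rewrite mulmxA NJ mul0mx mxE.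
by rewrite mxE.
Qed.

Lemma nor_unit x : U x -> \sum_a nor a x * nor a x = 1.
Proof.
move=> Ux; have := congr1 (fun B : 'M[R]_1 => B 0 0) (N_unit Ux).
rewrite [X in X = _ -> _]mxE [X in _ = X -> _]mxE eqxx mulr1n => <-.
by apply: eq_bigr => a _; rewrite mxE.
Qed.

Lemma nor_normal x j : U x -> \sum_a nor a x * pderiv j (pos a) x = 0.
Proof.
move=> Ux; have := congr1 (fun B : 'M[R]_(n, 1) => B j 0) (N_normal Ux).
rewrite [X in _ = X -> _]mxE [X in X = _ -> _]mxE => S0; apply: etrans S0.
by apply: eq_bigr => a _; rewrite [X in _ = _ * X]mxE jac_pos// mulrC.
Qed.

Local Notation h := (shape nor coframe).

Definition shape_mx x : 'M[R]_n.+1 := \matrix_(a, b) h a b x.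

Lemma shape_mx_jac x : U x -> shape_mx x = ('J F x)^T *m invmx (g x) *m 'J N x.
Proof.
move=> Ux; apply/matrixP => a b; rewrite mxE [RHS]mxE.
by apply: eq_bigr => j _; rewrite jac_nor.
Qed.

Lemma shape_mxE x (A : 'M[R]_n) : U x -> 'J N x = - (A *m 'J F x) ->
  shape_mx x = - (('J F x)^T *m invmx (g x) *m A *m 'J F x).
Proof. by move=> Ux JN; rewrite shape_mx_jac// JN mulmxN mulmxA. Qed.

Lemma shape_mx_sym x : U x -> (shape_mx x)^T = shape_mx x.
Proof.
move=> Ux; apply/matrixP => a b; rewrite !mxE.
exact: (shapeC oU pos_smooth nor_smooth coframeK nor_unit nor_normal).
Qed.

Lemma shape2_mx x a b : U x -> shape2 nor coframe a b x = (shape_mx x *m shape_mx x) a b.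
Proof. by move=> Ux; rewrite mxE; apply: eq_bigr => c _; rewrite !mxE. Qed.

(** With J X = 1, the powers of - X A J telescope to X A^k J up to sign, and cyclicity reduces their
    traces to those of A^k. Odd powers keep the minus sign of the Weingarten formula. *)
Lemma shape_traces x (A : 'M[R]_n) : U x -> 'J N x = - (A *m 'J F x) ->
  [/\ \sum_a h a a x = - \tr A,
      \sum_a \sum_b h a b x ^+ 2 = \tr (A *m A) &
      cubic_trace nor coframe x = - \tr (A *m A *m A)].
Proof.
move=> Ux JN; have E := shape_mxE Ux JN; set X := ('J F x)^T *m invmx (g x) in E.
have JX : 'J F x *m X = 1%:M by exact: jac_coframe.
clearbody X.
have E2 : shape_mx x *m shape_mx x = X *m (A *m A) *m 'J F x.
  have P : X *m A *m 'J F x *m (X *m A *m 'J F x) = X *m A *m ('J F x *m X) *m (A *m 'J F x).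
    by rewrite !mulmxA.
  by rewrite E mulmxN mulNmx opprK P JX mulmx1 !mulmxA.
split.
- transitivity (\tr (shape_mx x)); first by apply: eq_bigr => a _; rewrite mxE.
  by rewrite E linearN /= mxtrace_mulC mulmxA JX mul1mx.
- transitivity (\tr (shape_mx x *m (shape_mx x)^T)).
    apply: eq_bigr => a _; rewrite mxE; apply: eq_bigr => b _.
    by rewrite !mxE expr2.
  by rewrite shape_mx_sym// E2 mxtrace_mulC mulmxA JX mul1mx.
- transitivity (\tr (shape_mx x *m (shape_mx x *m shape_mx x)^T)).
    apply: eq_bigr => a _; rewrite mxE; apply: eq_bigr => b _.
    by rewrite [X in _ = _ * X]mxE -shape2_mx// [X in _ = X * _]mxE.
  rewrite trmx_mul shape_mx_sym// E2 E mulNmx linearN /=; congr (- _).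
  have P : X *m A *m 'J F x *m (X *m (A *m A) *m 'J F x) =
      X *m A *m ('J F x *m X) *m (A *m A *m 'J F x) by rewrite !mulmxA.
  by rewrite P JX mulmx1 !mulmxA mxtrace_mulC !mulmxA JX mul1mx.
Qed.

(** The second fundamental form in chart components, with the sign of the shape operator (see
    [sff_shape]) and thus opposite to [shape]. *)
Definition sff i j x : R := \sum_c nor c x * pderiv i (pderiv j (pos c)) x.

(** Differentiating g_ij = d_i f . d_j f, the three derivatives of the metric give six products, of
    which four cancel and two coincide. *)
Lemma christoffelE x i j k : U x ->
  christoffel g i j k x = \sum_a coframe a k x * pderiv i (pderiv j (pos a)) x.
Proof.
move=> Ux; have sp l a : smooth U (pderiv l (pos a)).
  by apply: smooth_pderiv; exact: pos_smooth.
have dm l p q : dmetric g l p q x =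
   \sum_a (pderiv l (pderiv p (pos a)) x * pderiv q (pos a) x
         + pderiv p (pos a) x * pderiv l (pderiv q (pos a)) x).
  rewrite /dmetric -pderivE.
  rewrite (@pderiv_eq_on _ _ _ oU _ (fun y => \sum_a pderiv p (pos a) y * pderiv q (pos a) y))//.
    rewrite (pderiv_sum oU)//; last by move=> a _; exact: (smoothM oU).
    by apply: eq_bigr => a _; rewrite (@pderiv_mul _ _ U).
  by move=> y; exact: gE.
rewrite /christoffel mulr_sumr.
have -> : \sum_a coframe a k x * pderiv i (pderiv j (pos a)) x =
  \sum_l invmx (g x) k l * \sum_a pderiv l (pos a) x * pderiv i (pderiv j (pos a)) x.
  under [RHS]eq_bigr do rewrite mulr_sumr.
  rewrite exchange_big /=; apply: eq_bigr => a _; rewrite /coframe mxE mulr_suml.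
  apply: eq_bigr => l _; rewrite mxE jac_pos//.
  have -> : invmx (g x) k l = invmx (g x) l k by rewrite -{1}(g_sym Ux) -trmx_inv mxE.
  ring.
apply: eq_bigr => l _; rewrite mulrCA; congr (_ * _).
rewrite !dm -big_split /= -sumrB mulr_sumr; apply: eq_bigr => a _.
rewrite (pderivC oU j i (pos_smooth a) Ux).
rewrite (pderivC oU l i (pos_smooth a) Ux).
rewrite (pderivC oU l j (pos_smooth a) Ux).
by field.
Qed.

Lemma gauss_formula x i j a : U x -> pderiv i (pderiv j (pos a)) x =
  \sum_k christoffel g i j k x * pderiv k (pos a) x + sff i j x * nor a x.
Proof.
move=> Ux; have -> : \sum_k christoffel g i j k x * pderiv k (pos a) x =
  \sum_b ((b == a)%:R - nor b x * nor a x) * pderiv i (pderiv j (pos b)) x.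
  under eq_bigr do rewrite christoffelE// mulr_suml.
  rewrite exchange_big /=; apply: eq_bigr => b _.
  by rewrite -coframeK// mulr_suml; apply: eq_bigr => k _; ring.
under eq_bigr do rewrite mulrBl; rewrite sumrB.
under eq_bigr do rewrite eq_sym; rewrite sum_delta -addrA -[LHS]addr0; congr (_ + _).
rewrite /sff mulr_suml addrC -sumrB big1// => b _; ring.
Qed.

Lemma sff_shape x (A : 'M[R]_n) i j : U x -> 'J N x = - (A *m 'J F x) ->
  sff i j x = (A *m g x) i j.
Proof.
move=> Ux JN; rewrite -[LHS]opprK.
rewrite -(nu_pderiv2 oU pos_smooth nor_smooth nor_normal)//.
have [_ <-] := F_immersion Ux; rewrite mulmxA.
have -> : A *m 'J F x = - 'J N x by rewrite JN opprK.
rewrite mulNmx [RHS]mxE mxE; congr (- _); apply: eq_bigr => a _.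
by rewrite jac_nor// mxE jac_pos.
Qed.

(** Differentiate [christoffelE]. Third derivatives of the position cancel by symmetry; the
    derivative of the coframe has tangential part - Gamma ([dXf]) and normal part [A] ([dXn]).
    Paired with the Gauss formula, the first cancels the quadratic terms of [riemann] and the second
    leaves the right side. *)
Lemma gauss_equation x (A : 'M[R]_n) i j k l : U x -> 'J N x = - (A *m 'J F x) ->
  riemann g i j k l x = sff j k x * A i l - sff i k x * A j l.
Proof.
move=> Ux JN.
have sp p a : smooth U (pderiv p (pos a)) by apply: smooth_pderiv; exact: pos_smooth.
have spp p q a : smooth U (pderiv p (pderiv q (pos a))) by exact: smooth_pderiv.
have dG p q r s : pderiv p (christoffel g q r s) x =
   \sum_a pderiv p (coframe a s) x * pderiv q (pderiv r (pos a)) x +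
   \sum_a coframe a s x * pderiv p (pderiv q (pderiv r (pos a))) x.
  rewrite (@pderiv_eq_on _ _ _ oU _ (fun y =>
    \sum_a coframe a s y * pderiv q (pderiv r (pos a)) y))//; last first.
    by move=> y; exact: christoffelE.
  rewrite (pderiv_sum oU)//; last first.
    by move=> a _; apply: (smoothM oU) => //; exact: coframe_smooth.
  rewrite -big_split /=; apply: eq_bigr => a _.
  by rewrite (@pderiv_mul _ _ U)//; exact: coframe_smooth.
have dXf p q s : \sum_a pderiv p (coframe a s) x * pderiv q (pos a) x = - christoffel g p q s x.
  have : pderiv p (fun y => \sum_a coframe a s y * pderiv q (pos a) y) x = 0.
    rewrite (@pderiv_eq_on _ _ _ oU _ (fun=> (q == s)%:R)) ?pderiv_cst// => y Uy.
    by rewrite -(frameK q s Uy); apply: eq_bigr => a _; rewrite mulrC.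
  rewrite (pderiv_sum oU)//; last first.
    by move=> a _; apply: (smoothM oU) => //; exact: coframe_smooth.
  rewrite (eq_bigr _ (fun a _ => @pderiv_mul _ _ U _ _ p x (coframe_smooth a s) (sp q a) Ux)).
  by rewrite big_split /= -christoffelE// => /eqP; rewrite addr_eq0 => /eqP.
have dXn p s : \sum_a pderiv p (coframe a s) x * nor a x = A p s.
  have : pderiv p (fun y => \sum_a coframe a s y * nor a y) x = 0.
    rewrite (@pderiv_eq_on _ _ _ oU _ (fun=> 0)) ?pderiv_cst// => y Uy.
    by apply: etrans (nor_coframe s Uy); apply: eq_bigr => a _; rewrite mulrC.
  rewrite (pderiv_sum oU)//; last first.
    by move=> a _; apply: (smoothM oU); [exact: coframe_smooth|exact: nor_smooth].
  rewrite (eq_bigr _ (fun a _ => @pderiv_mul _ _ U _ _ p x (coframe_smooth a s) (nor_smooth a) Ux)).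
  rewrite big_split /= => /eqP; rewrite addr_eq0 => /eqP ->.
  have -> : A = - ('J N x *m (('J F x)^T *m invmx (g x))).
    by rewrite JN mulNmx opprK -mulmxA jac_coframe// mulmx1.
  rewrite mxE mxE; congr (- _); apply: eq_bigr => a _.
  by rewrite jac_nor// mulrC.
have K p q r s : \sum_a pderiv p (coframe a s) x * pderiv q (pderiv r (pos a)) x =
   - (\sum_m christoffel g q r m x * christoffel g p m s x) + sff q r x * A p s.
  under eq_bigr do rewrite gauss_formula// mulrDr.
  rewrite big_split /=; congr (_ + _); last first.
    by rewrite -dXn mulr_sumr; apply: eq_bigr => a _; ring.
  under eq_bigr do rewrite mulr_sumr.
  rewrite exchange_big /= -sumrN; apply: eq_bigr => m _.
  by rewrite -mulrN -dXf mulr_sumr; apply: eq_bigr => a _; ring.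
rewrite /riemann -!pderivE !dG !K sumrB.
have -> : \sum_a coframe a l x * pderiv i (pderiv j (pderiv k (pos a))) x =
          \sum_a coframe a l x * pderiv j (pderiv i (pderiv k (pos a))) x.
  by apply: eq_bigr => a _; rewrite (pderivC oU i j (sp k a) Ux).
ring.
Qed.

Lemma sectional_curvature_row x (A E : 'M[R]_n) i j : U x -> 'J N x = - (A *m 'J F x) ->
  E *m g x *m E^T = 1%:M -> i != j ->
  let b := E *m (A *m g x) *m E^T in
  sectional_curvature g x (row i E) (row j E) = b j j * b i i - b i j * b j i.
Proof.
move=> Ux JN EgE ij b.
rewrite /sectional_curvature !inner_row EgE [X in _ / (X * _ - _)]mxE.
rewrite [X in _ / (_ * X - _)]mxE [X in _ / (_ - X ^+ _)]mxE !eqxx (negbTE ij).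
rewrite !mulr1n mulr0n expr0n subr0 mulr1 divr1.
pose Bf u v := inner (A *m g x) u v.
have opE u v : curvature_op g x u v v = Bf v v *: (u *m A) - Bf u v *: (v *m A).
  apply/rowP => l; rewrite mxE [RHS]mxE [X in _ = X + _]mxE [X in _ = _ + X]mxE.
  rewrite [X in _ = _ - X]mxE [X in _ = _ * X - _]mxE [X in _ = _ - _ * X]mxE.
  transitivity (\sum_i0 \sum_j0 \sum_k0
    (v 0 j0 * (A *m g x) j0 k0 * v 0 k0 * (u 0 i0 * A i0 l)
     - u 0 i0 * (A *m g x) i0 k0 * v 0 k0 * (v 0 j0 * A j0 l))).
    apply: eq_bigr => p _; apply: eq_bigr => q _; apply: eq_bigr => r _.
    by rewrite (gauss_equation _ _ _ _ Ux JN) !(sff_shape _ _ Ux JN); ring.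
  rewrite /Bf !innerE.
  have -> : (\sum_i0 \sum_k0 v 0 i0 * (A *m g x) i0 k0 * v 0 k0) * (\sum_i0 u 0 i0 * A i0 l)
     = \sum_i0 \sum_j0 \sum_k0 v 0 j0 * (A *m g x) j0 k0 * v 0 k0 * (u 0 i0 * A i0 l).
    rewrite mulr_sumr; apply: eq_bigr => p _; rewrite mulr_suml.
    by apply: eq_bigr => q _; rewrite mulr_suml.
  have -> : (\sum_i0 \sum_k0 u 0 i0 * (A *m g x) i0 k0 * v 0 k0) * (\sum_j0 v 0 j0 * A j0 l)
     = \sum_i0 \sum_j0 \sum_k0 u 0 i0 * (A *m g x) i0 k0 * v 0 k0 * (v 0 j0 * A j0 l).
    rewrite mulr_suml; apply: eq_bigr => p _; rewrite mulr_sumr.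
    by apply: eq_bigr => q _; rewrite mulr_suml.
  rewrite -sumrB; apply: eq_bigr => p _; rewrite -sumrB; apply: eq_bigr => q _.
  by rewrite -sumrB.
rewrite opE {1}/inner mulmxBl mulmxBl -!scalemxAl mxE.
rewrite [X in X + _]mxE [X in _ + X]mxE [X in _ - X]mxE.
have fold u w : (u *m A *m g x *m w^T) 0 0 = inner (A *m g x) u w.
  by rewrite /inner mulmxA.
by rewrite !fold /Bf !inner_row.
Qed.

(** The matrix [b] of the second fundamental form in the basis [E] is similar to [A], since g E^T
    inverts [E]. Summing its 2 by 2 principal minors over all pairs gives the difference of traces;
    the diagonal pairs contribute zero. *)
Lemma sectional_sum x (A E : 'M[R]_n) : U x -> 'J N x = - (A *m 'J F x) ->
  E *m g x *m E^T = 1%:M ->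
  2 * \sum_(i < n) \sum_(j < n | (i < j)%N) sectional_curvature g x (row i E) (row j E) =
  \tr A ^+ 2 - \tr (A *m A).
Proof.
move=> Ux JN EgE; pose b := E *m (A *m g x) *m E^T.
have gEE : g x *m E^T *m E = 1%:M.
  by have := mulmx1C (etrans (mulmxA _ _ _) EgE).
have trb : \tr b = \tr A.
  by rewrite /b -mulmxA mxtrace_mulC -!mulmxA (mulmxA (g x)) gEE mulmx1.
have trb2 : \tr (b *m b) = \tr (A *m A).
  have -> : b *m b = E *m (A *m (g x *m E^T *m E) *m (A *m g x *m E^T)).
    by rewrite /b !mulmxA.
  by rewrite gEE mulmx1 mxtrace_mulC -!mulmxA (mulmxA (g x)) gEE mulmx1.
under eq_bigr => i _.
  under eq_bigr => j ij do rewrite (sectional_curvature_row Ux JN EgE (_ : i != j)) ?neq_ltn ?ij//.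
over.
rewrite /= -/b (sum_lt_sym (T := fun i j => b j j * b i i - b i j * b j i)).
- rewrite -trb -trb2 expr2 [X in X * _]/mxtrace mulr_suml -sumrB; apply: eq_bigr => i _.
  rewrite [X in _ - X]mxE sumrB [X in _ = X - _]mulr_sumr; congr (_ - _).
  by apply: eq_bigr => j _; rewrite mulrC.
- by move=> i j; ring.
- by move=> i; rewrite subrr.
Qed.

End Hypersurface.

(** * Changes of chart *)

Lemma locally_constant (T : topologicalType) (X : Type) (phi : T -> X) :
  connected [set: T] -> (forall p, \forall q \near p, phi q = phi p) ->
  forall p q, phi p = phi q.
Proof.
move=> cT loc p q.
have op (B : set X) : open [set r | B (phi r)].
  rewrite openE => r /= Br; rewrite /interior.
  by apply: filterS (loc r) => s /= ->.
pose B := [set r | phi r = phi p].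
have BT : B = [set: T].
  apply: cT.
  - by exists p.
  - by exists B; rewrite ?setTI//; exact: (op [set phi p]).
  - exists B; rewrite ?setTI//; rewrite -openC.
    exact: (op (~` [set phi p])).
by have : B q by rewrite BT.
Qed.

Section ChartChange.
Variables (R : realType) (n : nat) (M : manifold R n).
Variables (c d : chart R n M).
Hypothesis (Ac : atlas M c) (Ad : atlas M d).

(** Built from derivatives along the axes, which smoothness on [transition_dom] supplies directly;
    total differentiability would first call for openness of that set. *)
Definition chart_change_mx (x : 'rV[R]_n) : 'M[R]_n :=
  \matrix_(j, i) ('D_(delta_mx 0 j) (transition c d) x) 0 i.

(** The chain rule along each coordinate line of [c], carried by the transition to a curve [gam] in
    the image of [d]. *)
Lemma jacobian_chart_change (m : nat) (phi : M -> 'rV[R]_m) (p : M) :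
  (forall c, atlas M c -> smooth_on (chart_img c) (fun x => phi (chart_inv c x))) ->
  chart_dom c p -> chart_dom d p ->
  'J (fun x => phi (chart_inv c x)) (chart_fun c p) =
  chart_change_mx (chart_fun c p) *m 'J (fun x => phi (chart_inv d x)) (chart_fun d p).
Proof.
move=> sphi cp dp; set x := chart_fun c p; set y := chart_fun d p.
have Ux : chart_img c x by exact: chart_fun_img.
have Uy : chart_img d y by exact: chart_fun_img.
have oc := @chart_img_open _ _ _ c; have od := @chart_img_open _ _ _ d.
have tx : transition_dom c d x by split => //; rewrite chart_funK.
have xy : transition c d x = y by rewrite /transition chart_funK.
have dtau j : derivable (transition c d) x (delta_mx 0 j).
  have [_ H] := atlas_smooth M; exact: (H c d Ac Ad [::] x tx).2.
apply/matrixP => j a; rewrite (jacobianE oc j a (sphi c Ac) Ux) mxE.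
pose gam (s : R) := transition c d (x + s *: delta_mx 0 j).
have g0 : gam 0 = y by rewrite /gam scale0r addr0.
have dgam : is_derive (0 : R) 1 gam ('D_(delta_mx 0 j) (transition c d) x).
  have := @is_derive_line R _ _ (transition c d) x (delta_mx 0 j) 0.
  by rewrite scale0r addr0; apply; exact: dtau.
have su := smooth_coord od 0 a (sphi d Ad).
have := @is_derive_curve _ _ _ od _ gam 0 su.
have [dg Dg] := dgam; rewrite g0 Dg => /(_ Uy dg) [_ D1].
have sc := smooth_coord oc 0 a (sphi c Ac).
have dc : derivable ((fun x => phi (chart_inv c x) 0 a) : _ -> R^o) x (delta_mx 0 j).
  by case: sc => sc; exact: (sc [::] x Ux).2.
have := @is_derive_line R _ _ ((fun x => phi (chart_inv c x) 0 a) : _ -> R^o) x (delta_mx 0 j) 0.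
rewrite scale0r addr0 => /(_ dc) [_ D2].
rewrite pderivE /partial -D2.
have -> : \sum_i chart_change_mx x j i * 'J (fun x => phi (chart_inv d x)) y i a =
   \sum_i ('D_(delta_mx 0 j) (transition c d) x) 0 i *
           pderiv i (fun x => phi (chart_inv d x) 0 a) y.
  apply: eq_bigr => i _; rewrite mxE; congr (_ * _).
  exact: (jacobianE od i a (sphi d Ad) Uy).
rewrite -D1; apply: near_eq_derive.
have cl : {for 0, continuous (fun s : R => x + s *: (delta_mx 0 j : 'rV[R]_n))}.
  apply: (@continuousD _ _ _ (fun=> x)); first exact: cst_continuous.
  exact: scalel_continuous.
have cinv : {for 0, continuous (fun s : R => chart_inv c (x + s *: delta_mx 0 j))}.
  apply: (@continuous_comp _ _ _ (fun s : R => x + s *: (delta_mx 0 j : 'rV[R]_n))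
    (chart_inv c) 0 cl).
  by rewrite scale0r addr0; exact: chart_inv_continuous.
(* The expressions of [phi] in the two charts agree only while the line stays in the domain of [d],
   that is, for small [s]. *)
have near_dom : \forall s \near (0 : R), chart_dom d (chart_inv c (x + s *: delta_mx 0 j)).
  suff nb : nbhs (chart_inv c (x + 0 *: delta_mx 0 j)) (chart_dom d) by exact: (cinv _ nb).
  apply: open_nbhs_nbhs; split; first exact: chart_dom_open.
  by rewrite scale0r addr0 chart_funK.
apply: filterS near_dom => s dom_s.
by rewrite /gam /transition chart_funK.
Qed.

End ChartChange.

(** * The curved directions *)

(** Pseudo-inverses in two charts are compared through the tangent projection X J, which is the same
    for both. *)
Lemma coframe_change (R : comPzRingType) (m k : nat) (Jc Jd : 'M[R]_(m, k)) (K : 'M[R]_m)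
    (Xc Xd : 'M[R]_(k, m)) :
  Jc = K *m Jd -> Xc *m Jc = Xd *m Jd -> Jd *m Xd = 1%:M -> Xc *m K = Xd.
Proof.
move=> JE XJ JX.
by rewrite -[LHS]mulmx1 -JX mulmxA -(mulmxA Xc) -JE XJ -mulmxA JX mulmx1.
Qed.

Section Global.
Variables (R : realType) (n : nat) (hn : (3 <= n)%N).
Variables (M : riemannian_manifold R n).
Hypothesis M_connected : connected [set: M].
Variables (S : R) (hS : forall p : M, is_scalar_curvature p S).
Variables (f : M -> 'rV[R]_n.+1) (hf : isometric_immersion f).
Variables (xi : M -> 'rV[R]_n.+1) (hxi : unit_normal_field f xi).
Variables (lam : M -> 'rV[R]_n).
Hypothesis hlam : forall p : M, principal_curvatures f xi p (lam p).
Variables (H : R) (hH : forall p : M, mean_curvature 1 (lam p) = H) (H_neq0 : H != 0).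
Hypothesis hH3 : forall p : M, 0 <= H * mean_curvature 3 (lam p).
Hypothesis S_ge0 : 0 <= S.
Hypothesis S_le : S <= n%:R * H ^+ 2 / (2 * (n%:R - 1)).
Implicit Types (c d : chart R n M) (p q : M) (x : 'rV[R]_n).

Let N c := local_expr xi c.
Let F c := local_expr f c.
Let h c := shape (nor (N c)) (coframe (F c) (metric c)).

Lemma F_smooth c : atlas M c -> smooth_on (chart_img c) (F c).
Proof. by move=> Ac; exact: hf.1. Qed.

Lemma N_smooth c : atlas M c -> smooth_on (chart_img c) (N c).
Proof. by move=> Ac; have [sxi _ _] := hxi; exact: sxi. Qed.

Lemma F_immersion c x : atlas M c -> chart_img c x ->
  row_free ('J (F c) x) /\ 'J (F c) x *m ('J (F c) x)^T = metric c x.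
Proof. by move=> Ac; exact: hf.2. Qed.

Lemma N_unit c x : N c x *m (N c x)^T = 1%:M.
Proof. by have [_ u _] := hxi; exact: u. Qed.

Lemma N_normal c x : atlas M c -> chart_img c x -> 'J (F c) x *m (N c x)^T = 0.
Proof. by move=> Ac Ux; have [_ _ u] := hxi; exact: u. Qed.

Let e1 : R := n%:R * H.
Let e2 : R := 'C(n, 2)%:R * S.
(** Negative because the tensor [h] is minus the shape operator; [p2], being quadratic, is
    insensitive to the sign. *)
Let p1 : R := - e1.
Let p2 : R := e1 ^+ 2 - 2 * e2.

Lemma natr_bin2 : 2 * ('C(n, 2)%:R : R) = n%:R * (n%:R - 1).
Proof.
have := congr1 (fun k : nat => k%:R : R) (bin_ffact n 2).
rewrite natrM mulrC => ->; rewrite ffactnSr ffactn1 natrM natrB//.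
exact: leq_trans hn.
Qed.

(** Translates the hypotheses on H, S and H_3 into traces of [h], by Newton's identities and, for S,
    the Gauss equation. The third symmetric function may vary from point to point, so only its sign
    relative to H is recorded. *)
Lemma curvature_traces c x : atlas M c -> chart_img c x ->
  [/\ \sum_a h c a a x = p1, \sum_a \sum_b h c a b x ^+ 2 = p2 &
  exists2 e3, 0 <= H * e3 &
   cubic_trace (nor (N c)) (coframe (F c) (metric c)) x = - (e1 ^+ 3 - 3 * e1 * e2 + 3 * e3)].
Proof.
move=> Ac Ux; have dom := chart_inv_dom Ux.
have [A] := hlam Ac dom; rewrite /is_shape_operator (chart_invK Ux) => JN cA.
have [T1 T2 T3] := char_poly_traces cA.
have [S1 S2 S3] := shape_traces (@chart_img_open _ _ _ c) (F_smooth Ac) (N_smooth Ac)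
  (fun y => @F_immersion c y Ac) (fun y _ => N_unit c y) (fun y => @N_normal c y Ac) Ux JN.
set l := lam (chart_inv c x) in T1 T2 T3 cA.
have n0 : (n%:R : R) != 0 by rewrite pnatr_eq0 -lt0n; exact: leq_trans hn.
have C0 k : (k <= n)%N -> ('C(n, k)%:R : R) != 0 by rewrite pnatr_eq0 -lt0n bin_gt0.
have E1 : elem_sym 1 l = e1.
  by rewrite /e1 -(hH (chart_inv c x)) /mean_curvature bin1 mulrA mulfV// mul1r.
have [L EgE] : exists L : 'M[R]_n, L *m metric c x *m L^T = 1%:M.
  have [fJ gE'] := F_immersion Ac Ux.
  by have := posdef_orthonormal (gram_posdef fJ); rewrite gE'.
have SS := sectional_sum (@chart_img_open _ _ _ c) (F_smooth Ac) (N_smooth Ac)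
  (fun y => @F_immersion c y Ac) (fun y _ => N_unit c y) (fun y => @N_normal c y Ac) Ux JN EgE.
have HS := hS Ac dom; rewrite /= (chart_invK Ux) in HS.
have E2 : elem_sym 2 l = e2.
  rewrite /e2 (HS L EgE) mulrA mulfV ?C0 ?mul1r//; last by exact: leq_trans hn.
  by move: SS; rewrite T1 T2; lra.
have E3 : 0 <= H * elem_sym 3 l.
  have := hH3 (chart_inv c x); rewrite /mean_curvature mulrCA pmulr_rge0//.
  by rewrite invr_gt0 ltr0n bin_gt0.
split; first by rewrite S1 T1 E1.
  by rewrite S2 T2 E1 E2.
by exists (elem_sym 3 l) => //; rewrite S3 T3 E1 E2.
Qed.

Lemma S_bound : 4 * e2 <= e1 ^+ 2.
Proof.
have n1 : 0 < (n%:R : R) - 1 by rewrite subr_gt0 ltr1n; exact: leq_trans hn.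
move: S_le; rewrite ler_pdivlMr; last by rewrite mulr_gt0.
have -> : 4 * e2 = n%:R * (2 * (n%:R - 1) * S).
  have -> : 4 * e2 = 2 * (2 * 'C(n, 2)%:R) * S by rewrite /e2; ring.
  by rewrite natr_bin2; ring.
have -> : e1 ^+ 2 = n%:R * (n%:R * H ^+ 2) by rewrite /e1; ring.
by move=> SL; apply: ler_wpM2l => //; rewrite mulrC.
Qed.

Lemma e2_ge0 : 0 <= e2. Proof. by rewrite /e2 mulr_ge0. Qed.

Lemma e1_neq0 : e1 != 0.
Proof. by rewrite mulf_neq0// pnatr_eq0 -lt0n; exact: leq_trans hn. Qed.

Lemma simons_le c x : atlas M c -> chart_img c x ->
  p2 ^+ 2 <= p1 * cubic_trace (nor (N c)) (coframe (F c) (metric c)) x.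
Proof.
move=> Ac Ux; have [_ _ [e3 e30 ->]] := curvature_traces Ac Ux.
have e13 : 0 <= e1 * e3 by rewrite /e1 -mulrA mulr_ge0.
have := mulr_ge0 e2_ge0 (_ : 0 <= e1 ^+ 2 - 4 * e2).
rewrite subr_ge0 => /(_ S_bound); rewrite /p1 /p2 => e0.
rewrite -subr_ge0.
have -> : - e1 * - (e1 ^+ 3 - 3 * e1 * e2 + 3 * e3) - (e1 ^+ 2 - 2 * e2) ^+ 2 =
  e2 * (e1 ^+ 2 - 4 * e2) + 3 * (e1 * e3) by ring.
by rewrite addr_ge0// mulr_ge0.
Qed.

Lemma p1_neq0 : p1 != 0. Proof. by rewrite oppr_eq0 e1_neq0. Qed.

Lemma p2_gt0 : 0 < p2.
Proof.
have e1p : 0 < e1 ^+ 2 by rewrite exprn_even_gt0//= e1_neq0.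
by have := S_bound; rewrite /p2; lra.
Qed.

(** The inverse of the nonzero eigenvalue of [h]: the signed radius of the spherical factor. *)
Let rho := p1 / p2.
Let X c := coframe (F c) (metric c).

Definition curved_mx c x : 'M[R]_n.+1 :=
  \matrix_(a, b) curved_proj (nor (N c)) (X c) p1 p2 a b x.

Section InChart.
Variables (c : chart R n M) (Ac : atlas M c).
Let oU := @chart_img_open _ _ _ c.
Let U := chart_img c.
Let Fs := F_smooth Ac.
Let Ns := N_smooth Ac.
Let FI := fun y => @F_immersion c y Ac.
Let Nu := fun y (_ : U y) => N_unit c y.
Let Nn := fun y => @N_normal c y Ac.
Let posS := pos_smooth oU Fs.
Let norS := nor_smooth oU Ns.
Let XS := coframe_smooth oU Fs FI.
Let fK := frameK oU Fs FI.
Let cK := coframeK oU Fs FI Nu Nn.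
Let nX := nor_coframe (metric c) Nn.
Let n1 := nor_unit Nu.
Let nn := nor_normal oU Fs Nn.
Let tr1 x (Ux : U x) : \sum_a h c a a x = p1.
Proof. by have [] := curvature_traces Ac Ux. Qed.
Let tr2 x (Ux : U x) : \sum_a \sum_b h c a b x ^+ 2 = p2.
Proof. by have [] := curvature_traces Ac Ux. Qed.
Let sle x (Ux : U x) := simons_le Ac Ux.

(** With nabla h = 0, [sqnorm_cov_shape] makes e2 (e1^2 - 4 e2) + 3 e1 e3 vanish; both terms are
    nonnegative, so the first is zero. This is the dichotomy for S. *)
Lemma simons_eq x : U x -> e2 * (e1 ^+ 2 - 4 * e2) = 0.
Proof.
move=> Ux.
have := sqnorm_cov_shape oU posS norS XS fK cK nX n1 nn tr1 tr2 Ux.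
rewrite big1 => [|i _]; last first.
  rewrite big1// => a _; rewrite big1// => b _.
  by rewrite (cov_shape_eq0 oU posS norS XS fK cK nX n1 nn tr1 tr2 sle)// expr0n.
have [_ _ [e3 e30 ->]] := curvature_traces Ac Ux.
have e13 : 0 <= e1 * e3 by rewrite /e1 -mulrA mulr_ge0.
have := mulr_ge0 e2_ge0 (_ : 0 <= e1 ^+ 2 - 4 * e2).
rewrite subr_ge0 => /(_ S_bound) e0 E.
have : e2 * (e1 ^+ 2 - 4 * e2) + 3 * (e1 * e3) = 0.
  by rewrite -[RHS]oppr0 [in RHS]E /p1 /p2; ring.
by lra.
Qed.

Lemma curved_mx_near x : U x -> \forall y \near x, curved_mx c y = curved_mx c x.
Proof.
move=> Ux.
have near_ab ab : \forall y \near x, curved_proj (nor (N c)) (X c) p1 p2 ab.1 ab.2 y =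
    curved_proj (nor (N c)) (X c) p1 p2 ab.1 ab.2 x.
  apply: (pderiv0_near_cst oU _ Ux).
    exact: (curved_proj_smooth oU norS XS).
  move=> i y Uy.
  exact: (pderiv_curved_proj oU posS norS XS fK cK nX n1 nn tr1 tr2 sle p1_neq0 i _ _ Uy).
have near_all : \forall y \near x, forall ab, curved_proj (nor (N c)) (X c) p1 p2 ab.1 ab.2 y =
    curved_proj (nor (N c)) (X c) p1 p2 ab.1 ab.2 x by apply: filter_forall near_ab.
apply: filterS near_all => y Hy.
by apply/matrixP => a b; rewrite !mxE; exact: (Hy (a, b)).
Qed.

Lemma center_near x : U x -> \forall y \near x,
  (F c y - rho *: N c y) *m curved_mx c y = (F c x - rho *: N c x) *m curved_mx c x.
Proof.
move=> Ux; pose u b y := \sum_a (pos (F c) a y - rho * nor (N c) a y) *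
   curved_proj (nor (N c)) (X c) p1 p2 a b y.
have uE y b : ((F c y - rho *: N c y) *m curved_mx c y) 0 b = u b y.
  by rewrite mxE; apply: eq_bigr => a _; rewrite !mxE.
have near_b b : \forall y \near x, u b y = u b x.
  apply: (pderiv0_near_cst oU _ Ux).
    apply: (smooth_sum oU) => a _; apply: (smoothM oU); last first.
      exact: (curved_proj_smooth oU norS XS).
    by apply: (smoothB oU) => //; apply: (smoothM oU) => //; exact: smooth_cst.
  move=> i y Uy.
  exact: (pderiv_center oU posS norS XS fK cK nX n1 nn tr1 tr2 sle p1_neq0 i _ Uy).
have near_all : \forall y \near x, forall b, u b y = u b x by apply: filter_forall near_b.
apply: filterS near_all => y Hy.
by apply/rowP => b; rewrite !uE; exact: Hy.
Qed.

Lemma curved_mxE x : U x ->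
  curved_mx c x = rho *: shape_mx (F c) (N c) (metric c) x + (N c x)^T *m N c x.
Proof.
by move=> Ux; apply/matrixP => a b; rewrite !mxE big_ord1 mxE.
Qed.

Lemma curved_mx_facts x (P := curved_mx c x) : U x ->
  [/\ P^T = P, P *m P = P, \tr P = rho * p1 + 1 & N c x *m P = N c x].
Proof.
move=> Ux; have PE := curved_mxE Ux; rewrite -/P in PE.
set Hm := shape_mx _ _ _ x in PE; set v := N c x in PE *.
have vv : v *m v^T = 1%:M by exact: N_unit.
have HT : Hm^T = Hm by exact: (shape_mx_sym oU Fs Ns FI Nu Nn).
have vH : v *m Hm = 0.
  apply/rowP => b; rewrite mxE [RHS]mxE.
  apply: etrans (nu_shape nX b Ux); apply: eq_bigr => a _.
  by congr (_ * _); rewrite mxE.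
have Hv : Hm *m v^T = 0 by rewrite -[LHS]trmxK trmx_mul trmxK HT vH trmx0.
have HH : rho *: (Hm *m Hm) = Hm.
  apply/matrixP => a b; rewrite mxE -(shape2_mx _ _ _ _ _ Ux).
  have := shape2_shape oU posS norS XS fK cK nX n1 nn tr1 tr2 sle a b Ux.
  rewrite /rho mulrAC => ->; rewrite mulrAC divff ?mul1r ?gt_eqF ?p2_gt0//.
  by rewrite [RHS]mxE.
split.
- by rewrite PE linearD linearZ /= HT trmx_mul trmxK.
- have A1 : v^T *m v *m Hm = 0 by rewrite -mulmxA vH mulmx0.
  have A2 : Hm *m (v^T *m v) = 0 by rewrite mulmxA Hv mul0mx.
  have A3 : v^T *m v *m (v^T *m v) = v^T *m v by rewrite mulmxA -(mulmxA v^T) vv mulmx1.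
  rewrite PE mulmxDr !mulmxDl -!scalemxAl -!scalemxAr A1 A2 A3 HH.
  by rewrite !scaler0 addr0 add0r.
- rewrite PE linearD linearZ /= mxtrace_mulC vv mxtrace1; congr (_ * _ + _).
  by rewrite -(tr1 Ux); apply: eq_bigr => a _; rewrite mxE.
- by rewrite PE mulmxDr -scalemxAr vH scaler0 add0r mulmxA vv mul1mx.
Qed.

End InChart.

(** Makes the projection a function on M. The ambient shape matrix is X times the Jacobian of the
    normal, and a change of chart acts on the two factors inversely. *)
Lemma curved_mx_chart c d p : atlas M c -> atlas M d -> chart_dom c p -> chart_dom d p ->
  curved_mx c (chart_fun c p) = curved_mx d (chart_fun d p).
Proof.
move=> Ac Ad cp dp.
have Uc := chart_fun_img cp; have Ud := chart_fun_img dp.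
have Nx e (ep : chart_dom e p) : N e (chart_fun e p) = xi p.
  by rewrite /N /local_expr chart_funK.
rewrite (curved_mxE Uc) (curved_mxE Ud) (Nx c cp) (Nx d dp); congr (_ *: _ + _).
rewrite (shape_mx_jac (@chart_img_open _ _ _ c) (F c) (metric c) (N_smooth Ac) Uc).
rewrite (shape_mx_jac (@chart_img_open _ _ _ d) (F d) (metric d) (N_smooth Ad) Ud).
have JF : 'J (F c) (chart_fun c p) =
    chart_change_mx c d (chart_fun c p) *m 'J (F d) (chart_fun d p).
  exact: (jacobian_chart_change (phi := f) Ac Ad F_smooth cp dp).
have JN : 'J (N c) (chart_fun c p) =
    chart_change_mx c d (chart_fun c p) *m 'J (N d) (chart_fun d p).
  exact: (jacobian_chart_change (phi := xi) Ac Ad N_smooth cp dp).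
have XJc := coframe_jac (fun y => @F_immersion c y Ac) (fun y _ => N_unit c y)
  (fun y => @N_normal c y Ac) Uc.
have XJd := coframe_jac (fun y => @F_immersion d y Ad) (fun y _ => N_unit d y)
  (fun y => @N_normal d y Ad) Ud.
have JXd := jac_coframe (fun y => @F_immersion d y Ad) Ud.
rewrite (Nx c cp) in XJc; rewrite (Nx d dp) in XJd.
rewrite JN mulmxA; congr (_ *m _).
exact: (coframe_change JF (etrans XJc (esym XJd)) JXd).
Qed.

(** The projection and the centre are defined at each point by a chosen chart. Independence of the
    chart lets a neighbourhood of a point be treated in a single chart, where both are constant;
    connectedness does the rest. *)
Lemma curved_structure (p0 : M) : exists (P : 'M[R]_n.+1) (b : 'rV[R]_n.+1),
  [/\ P^T = P, P *m P = P, \tr P = rho * p1 + 1, b *m P = b &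
      forall p, xi p *m P = xi p /\ f p *m P = b + rho *: xi p].
Proof.
pose ch p := s2val (cid2 ((atlas_smooth M).1 p)).
have Ach p : atlas M (ch p) by exact: (s2valP (cid2 ((atlas_smooth M).1 p))).
have dch p : chart_dom (ch p) p by exact: (s2valP' (cid2 ((atlas_smooth M).1 p))).
pose P p := curved_mx (ch p) (chart_fun (ch p) p).
pose b p := (f p - rho *: xi p) *m P p.
have PE c p : atlas M c -> chart_dom c p -> P p = curved_mx c (chart_fun c p).
  by move=> Ac cp; exact: curved_mx_chart.
have bE c p : atlas M c -> chart_dom c p -> b p =
   (F c (chart_fun c p) - rho *: N c (chart_fun c p)) *m curved_mx c (chart_fun c p).
  move=> Ac cp; rewrite /b (PE c p Ac cp) /F /N /local_expr.
  by rewrite (chart_funK cp).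
have near_chart c p (G : 'rV[R]_n -> Prop) : chart_dom c p ->
    (\forall y \near chart_fun c p, G y) ->
    \forall q \near p, chart_dom c q /\ G (chart_fun c q).
  move=> cp nG; have dn : nbhs p (chart_dom c).
    by apply: open_nbhs_nbhs; split => //; exact: chart_dom_open.
  have nG' : nbhs p [set q | G (chart_fun c q)] by exact: (chart_fun_continuous cp nG).
  exact: filterI dn nG'.
have Pcst : forall p q, P p = P q.
  apply: locally_constant => // p.
  have := near_chart _ p _ (dch p) (curved_mx_near (Ach p) (chart_fun_img (dch p))).
  by apply: filterS => q [dq Eq]; rewrite (PE _ q (Ach p) dq) Eq.
have bcst : forall p q, b p = b q.
  apply: locally_constant => // p.
  have := near_chart _ p _ (dch p) (center_near (Ach p) (chart_fun_img (dch p))).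
  by apply: filterS => q [dq Eq]; rewrite (bE _ q (Ach p) dq) Eq -(bE _ p (Ach p) (dch p)).
have facts p := curved_mx_facts (Ach p) (chart_fun_img (dch p)).
have [sP iP tP _] := facts p0.
exists (P p0), (b p0); split=> //; first by rewrite /b -mulmxA iP.
move=> p; have [_ _ _ xP] := facts p.
have {}xP : xi p *m P p0 = xi p.
  by move: xP; rewrite -/(P p) (Pcst p p0) /N /local_expr (chart_funK (dch p)).
split => //; rewrite (bcst p0 p) /b (Pcst p p0) mulmxBl -scalemxAl xP.
by rewrite subrK.
Qed.

End Global.

(** * Curves with radial acceleration *)

Section RealFunctions.
Variable R : realType.
Implicit Types (u v : R -> R) (t : R).

Lemma is_derive_mul u v t (a b : R) : is_derive t 1 u a -> is_derive t 1 v b ->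
  is_derive t 1 (fun s => u s * v s) (a * v t + u t * b).
Proof.
move=> du dv; have D := is_deriveM du dv.
by apply: is_derive_eq; rewrite addrC [a * _]mulrC.
Qed.

Lemma is_derive_sum_fun (I : finType) (F : I -> R -> R) (a : I -> R) t :
  (forall i, is_derive t 1 (F i) (a i)) ->
  is_derive t 1 (fun s => \sum_i F i s) (\sum_i a i).
Proof.
move=> dF; suff H (r : seq I) : is_derive t 1 (fun s => \sum_(i <- r) F i s) (\sum_(i <- r) a i).
  exact: H.
elim: r => [|i r IH].
  under eq_fun do rewrite big_nil; rewrite big_nil; exact: is_derive_cst.
under eq_fun do rewrite big_cons; rewrite big_cons; exact: is_deriveD.
Qed.

Lemma is_derive_scale u t (k a : R) : is_derive t 1 u a ->
  is_derive t 1 (fun s => u s * k) (a * k).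
Proof.
move=> du; have := is_derive_mul du (is_derive_cst k t 1).
by rewrite mulr0 addr0.
Qed.

Lemma is_derive0_cst u : (forall t, is_derive t 1 u 0) -> forall t, u t = u 0.
Proof. by move=> du t; exact: is_derive_0_is_cst. Qed.

Lemma is_derive_affine u (k : R) : (forall t, is_derive t 1 u k) -> u 1 = u 0 + k.
Proof.
move=> du; have dv t : is_derive t 1 (fun s => u s - s * k) 0.
  have D := is_deriveB (du t) (is_derive_scale k (is_derive_id t 1)).
  by apply: is_derive_eq; rewrite mul1r subrr.
by have := is_derive0_cst dv 1; rewrite mul1r mul0r subr0 => /eqP; rewrite subr_eq => /eqP.
Qed.

Lemma is_derive_sinM (k : R) t : is_derive t 1 (fun s => sin (s * k)) (cos (t * k) * k).
Proof.
apply: (@is_derive1_comp _ sin (fun s => s * k)).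
by have D := is_derive_scale k (is_derive_id t 1); apply: is_derive_eq; rewrite mul1r.
Qed.

Lemma is_derive_cosM (k : R) t : is_derive t 1 (fun s => cos (s * k)) (- (sin (t * k) * k)).
Proof.
rewrite -mulNr; apply: (@is_derive1_comp _ cos (fun s => s * k)).
by have D := is_derive_scale k (is_derive_id t 1); apply: is_derive_eq; rewrite mul1r.
Qed.

(** The energy du^2 + k^2 u^2 is constant, hence zero. Concluding from du = 0, rather than from the
    second term, covers k = 0. *)
Lemma harmonic_zero u du (k : R) : (forall t, is_derive t 1 u (du t)) ->
  (forall t, is_derive t 1 du (- k ^+ 2 * u t)) -> u 0 = 0 -> du 0 = 0 ->
  forall t, u t = 0.
Proof.
move=> d1 d2 u0 du0 t.
have E0 s : du s * du s + (u s * u s) * k ^+ 2 = 0.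
  transitivity (du 0 * du 0 + (u 0 * u 0) * k ^+ 2); last by rewrite u0 du0; ring.
  apply: (@is_derive0_cst (fun s => du s * du s + (u s * u s) * k ^+ 2)) => r.
  have D := is_deriveD (is_derive_mul (d2 r) (d2 r))
    (is_derive_scale (k ^+ 2) (is_derive_mul (d1 r) (d1 r))).
  by apply: is_derive_eq; ring.
have du_eq0 s : du s = 0.
  apply/eqP; rewrite -sqrf_eq0 expr2.
  have a0 : 0 <= du s * du s by rewrite -expr2 sqr_ge0.
  have b0 : 0 <= (u s * u s) * k ^+ 2 by rewrite -expr2 mulr_ge0 ?sqr_ge0.
  by rewrite eq_le a0 andbT; have := E0 s; lra.
rewrite -u0; apply: is_derive0_cst => s.
by have := d1 s; rewrite du_eq0.
Qed.

(** Writing the initial velocity as [b * k] avoids a division by [k] and includes the constant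
    solution for k = 0. *)
Lemma harmonic u du (k a b : R) : (forall t, is_derive t 1 u (du t)) ->
  (forall t, is_derive t 1 du (- k ^+ 2 * u t)) -> u 0 = a -> du 0 = b * k ->
  forall t, u t = a * cos (t * k) + b * sin (t * k).
Proof.
move=> d1 d2 u0 du0 t; apply/eqP; rewrite -subr_eq0; apply/eqP.
apply: (@harmonic_zero (fun t => u t - (a * cos (t * k) + b * sin (t * k)))
  (fun t => du t - (b * k * cos (t * k) - a * k * sin (t * k))) k) => [s|s||].
- have Dc := is_derive_scale a (is_derive_cosM k s).
  have Ds := is_derive_scale b (is_derive_sinM k s).
  have D := is_deriveB (d1 s) (is_deriveD Dc Ds).
  rewrite (_ : (fun t => _) = (u - ((fun s => cos (s * k) * a) + (fun s => sin (s * k) * b)))).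
    by apply: is_derive_eq; ring.
  by apply/funext => r /=; rewrite [a * _]mulrC [b * _]mulrC.
- have Dc := is_derive_scale (b * k) (is_derive_cosM k s).
  have Ds := is_derive_scale (a * k) (is_derive_sinM k s).
  have D := is_deriveB (d2 s) (is_deriveB Dc Ds).
  rewrite (_ : (fun t => _) = (du -
      ((fun s => cos (s * k) * (b * k)) - (fun s => sin (s * k) * (a * k))))).
    by apply: is_derive_eq; ring.
  by apply/funext => r /=; rewrite [b * k * _]mulrC [a * k * _]mulrC.
- by rewrite mul0r cos0 sin0 u0; ring.
- by rewrite mul0r cos0 sin0 du0; ring.
Qed.

(* A curve on a sphere whose acceleration is radial is a great circle: the
   radial factor is minus the squared speed, which is constant. *)
Lemma great_circle (m : nat) (G dG : 'I_m -> R -> R) (beta : R -> R) (r th : R)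
    (a b : 'I_m -> R) :
  (forall j t, is_derive t 1 (G j) (dG j t)) ->
  (forall j t, is_derive t 1 (dG j) (beta t * G j t)) ->
  r != 0 -> (forall t, \sum_j G j t ^+ 2 = r ^+ 2) ->
  (forall j, G j 0 = a j) -> (forall j, dG j 0 = b j * th) -> \sum_j b j ^+ 2 = r ^+ 2 ->
  forall j, G j 1 = a j * cos th + b j * sin th.
Proof.
move=> d1 d2 r0 Gr G0 dG0 br j.
have GdG t : \sum_j G j t * dG j t = 0.
  have D := is_derive_sum_fun (fun j => is_derive_mul (d1 j t) (d1 j t)).
  have : is_derive t 1 (fun s => \sum_j G j s * G j s) 0.
    rewrite (_ : (fun s => _) = cst (r ^+ 2)); first exact: is_derive_cst.
    by apply/funext => s; rewrite -(Gr s); apply: eq_bigr => i _; rewrite expr2.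
  move=> [_ E0]; have [_] := D; rewrite E0.
  under eq_bigr do rewrite [X in X + _]mulrC -mulr2n.
  by rewrite sumrMnl => /esym/eqP; rewrite mulrn_eq0 => /eqP.
have betaE t : \sum_j dG j t ^+ 2 = - (beta t * r ^+ 2).
  have D := is_derive_sum_fun (fun j => is_derive_mul (d1 j t) (d2 j t)).
  have : is_derive t 1 (fun s => \sum_j G j s * dG j s) 0.
    rewrite (_ : (fun s => _) = cst 0); first exact: is_derive_cst.
    by apply/funext => s; exact: GdG.
  move=> [_ E0]; have [_] := D; rewrite E0 big_split /=.
  have -> : \sum_i G i t * (beta t * G i t) = beta t * r ^+ 2.
    by rewrite -(Gr t) mulr_sumr; apply: eq_bigr => i _; ring.
  under [X in _ = X + _ -> _]eq_bigr do rewrite -expr2.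
  by move=> /esym /eqP; rewrite addr_eq0 => /eqP.
have speed t : \sum_j dG j t * dG j t = r ^+ 2 * th ^+ 2.
  transitivity (\sum_j dG j 0 * dG j 0).
    apply: (@is_derive0_cst (fun s => \sum_j dG j s * dG j s)) => s.
    have D := is_derive_sum_fun (fun j => is_derive_mul (d2 j s) (d2 j s)).
    apply: is_derive_eq.
    rewrite (eq_bigr (fun j => 2 * beta s * (G j s * dG j s))); last by move=> i _; ring.
    by rewrite -mulr_sumr GdG mulr0.
  by rewrite -br mulr_suml; apply: eq_bigr => i _; rewrite dG0; ring.
have bth t : beta t = - th ^+ 2.
  have r20 : r ^+ 2 != 0 by rewrite expf_neq0.
  apply: (mulIf r20); rewrite mulNr [RHS](_ : _ = - (r ^+ 2 * th ^+ 2)); last by ring.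
  rewrite -(speed t) -[LHS]opprK; congr (- _); rewrite -betaE.
  by apply: eq_bigr => i _; rewrite expr2.
have d2' t : is_derive t 1 (dG j) (- th ^+ 2 * G j t) by rewrite -(bth t).
by have := harmonic (d1 j) d2' (G0 j) (dG0 j) 1; rewrite mul1r.
Qed.

End RealFunctions.

(** * Images of geodesics *)

Section Geodesics.
Variables (R : realType) (n : nat) (M : riemannian_manifold R n).
Variables (f xi : M -> 'rV[R]_n.+1).
Hypothesis hf : isometric_immersion f.
Hypothesis hxi : unit_normal_field f xi.

(* In a chart the acceleration of the image of a geodesic is, by the Gauss
   formula, the second fundamental form of its velocity times the normal. *)
Lemma geodesic_acceleration (gam : R -> M) : is_geodesic gam ->
  exists (alpha : R -> R), forall (a : 'I_n.+1) (t : R),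
    is_derive t 1 (fun s => f (gam s) 0 a) (derive1 (fun s => f (gam s) 0 a : R^o) t) /\
    is_derive t 1 (derive1 (fun s => f (gam s) 0 a : R^o)) (alpha t * xi (gam t) 0 a).
Proof.
move=> [cgam geo].
(* The factor is computed in a chart around [gam t], so it is found at each [t] separately and
   assembled by choice. *)
suff H (t : R) : exists al, forall a : 'I_n.+1,
    is_derive t 1 (fun s => f (gam s) 0 a) (derive1 (fun s => f (gam s) 0 a : R^o) t) /\
    is_derive t 1 (derive1 (fun s => f (gam s) 0 a : R^o)) (al * xi (gam t) 0 a).
  have [alpha Halpha] := choice H.
  by exists alpha => a t; exact: Halpha.
have [c Ac ct] := (atlas_smooth M).1 (gam t).
pose x := (fun s => chart_fun c (gam s)) : R -> 'rV[R]_n.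
pose F := local_expr f c; pose N := local_expr xi c.
have oU := @chart_img_open _ _ _ c.
have Fs : smooth_on (chart_img c) F by exact: hf.1.
have Ns : smooth_on (chart_img c) N by have [sxi _ _] := hxi; exact: sxi.
have FI := fun y => @hf.2 c y Ac.
have Nu : forall y, chart_img c y -> N y *m (N y)^T = 1%:M.
  by move=> y _; have [_ u _] := hxi; exact: u.
have Nn : forall y, chart_img c y -> 'J F y *m (N y)^T = 0.
  by move=> y Uy; have [_ _ u] := hxi; exact: u.
have near_c (s : R) : chart_dom c (gam s) -> \forall r \near s, chart_dom c (gam r).
  move=> cs; have dn : nbhs (gam s) (chart_dom c).
    by apply: open_nbhs_nbhs; split => //; exact: chart_dom_open.
  exact: (cgam s _ dn).
have fE (s : R) (a : 'I_n.+1) : chart_dom c (gam s) -> f (gam s) 0 a = pos F a (x s).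
  by move=> cs; rewrite /pos /F /local_expr /x chart_funK.
have D1 (s : R) (a : 'I_n.+1) : chart_dom c (gam s) -> is_derive s 1 (fun s => f (gam s) 0 a : R)
    (\sum_i (derive1 x s) 0 i * pderiv i (pos F a) (x s)).
  move=> cs; have Ux : chart_img c (x s) by exact: chart_fun_img.
  have [dx _ _] := geo s c Ac cs.
  have := is_derive_curve oU (pos_smooth oU Fs a) Ux dx.
  rewrite derive1E; apply: near_eq_is_derive.
  by apply: filterS (near_c s cs) => r cr; rewrite fE.
have D1' (s : R) (a : 'I_n.+1) : chart_dom c (gam s) -> derive1 (fun s => f (gam s) 0 a : R^o) s =
    \sum_i (derive1 x s) 0 i * pderiv i (pos F a) (x s).
  by move=> cs; rewrite derive1E; case: (D1 s a cs) => _ E; exact: E.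
have Ut : chart_img c (x t) by exact: chart_fun_img.
have [dx ddx eqg] := geo t c Ac ct.
exists (\sum_i \sum_j sff F N i j (x t) * (derive1 x t) 0 i * (derive1 x t) 0 j) => a.
split; first by rewrite D1'//; exact: D1.
have dx1 i : is_derive t 1 (fun s => (derive1 x s) 0 i : R) ((derive1n 2 x t) 0 i).
  have /derivable_mxP /(_ 0 i) di := ddx.
  split => //; rewrite derive1nS derive1n1 derive1E derive_mx// mxE.
  by [].
have dpf i : is_derive t 1 (fun s => pderiv i (pos F a) (x s))
    (\sum_j (derive1 x t) 0 j * pderiv j (pderiv i (pos F a)) (x t)).
  have sp : smooth (chart_img c) (pderiv i (pos F a)).
    by apply: smooth_pderiv; exact: (pos_smooth oU Fs).
  by have := is_derive_curve oU sp Ut dx; rewrite derive1E.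
have D2 := is_derive_sum_fun (fun i => is_derive_mul (dx1 i) (dpf i)).
(* To differentiate the velocity again, its chart expression must hold near [t], not just at [t]. *)
have near2 : \near t, (fun s => \sum_i (derive1 x s) 0 i * pderiv i (pos F a) (x s)) t =
    derive1 (fun s => f (gam s) 0 a : R^o) t.
  by apply: filterS (near_c t ct) => r cr /=; rewrite D1'.
apply: (near_eq_is_derive near2).
apply: is_derive_eq D2 _.
have xiE : xi (gam t) 0 a = nor N a (x t).
  by rewrite /nor /N /local_expr /x chart_funK.
rewrite xiE.
have E i j : pderiv j (pderiv i (pos F a)) (x t) = 
   \sum_k christoffel (metric c) i j k (x t) * pderiv k (pos F a) (x t)
   + sff F N i j (x t) * nor N a (x t).
  rewrite (pderivC oU j i (pos_smooth oU Fs a) Ut).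
  exact: (gauss_formula oU Fs FI Nu Nn i j a Ut).
have xk k : (derive1n 2 x t) 0 k = - \sum_i \sum_j christoffel (metric c) i j k (x t) *
    (derive1 x t) 0 i * (derive1 x t) 0 j.
  by apply/eqP; rewrite -addr_eq0; apply/eqP; exact: eqg.
rewrite big_split /=.
under eq_bigr do rewrite xk mulNr mulr_suml.
rewrite sumrN exchange_big /= -sumrN -big_split /= mulr_suml.
apply: eq_bigr => i _.
under eq_bigr do rewrite mulr_suml.
rewrite exchange_big /= mulr_sumr mulr_suml -sumrN -big_split /=.
apply: eq_bigr => j _; rewrite E mulrDr mulrDr mulr_sumr mulr_sumr.
have -> : \sum_k christoffel (metric c) i j k (x t) * (derive1 x t) 0 i * (derive1 x t) 0 j *
      pderiv k (pos F a) (x t) =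
   \sum_k (derive1 x t) 0 i * ((derive1 x t) 0 j * (christoffel (metric c) i j k (x t) *
      pderiv k (pos F a) (x t))).
  by apply: eq_bigr => k _; ring.
rewrite -mulr_sumr; ring.
Qed.

End Geodesics.

(** * Rotations in the curved subspace *)

Section Rotation.
Variables (R : realType) (m : nat).
Implicit Types (u v w : 'rV[R]_m) (P : 'M[R]_m).

Lemma sqnormE v : (v *m v^T) 0 0 = \sum_j v 0 j ^+ 2.
Proof. by rewrite mxE; apply: eq_bigr => j _; rewrite mxE expr2. Qed.

Lemma sqnorm_ge0 v : 0 <= (v *m v^T) 0 0.
Proof. by rewrite sqnormE; apply: sumr_ge0 => j _; exact: sqr_ge0. Qed.

Lemma sqnorm_eq0 v : v *m v^T = 0 -> v = 0.
Proof.
move=> /matrixP /(_ 0 0); rewrite sqnormE [RHS]mxE => /eqP.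
rewrite psumr_eq0; last by move=> j _; exact: sqr_ge0.
move=> /allP H; apply/rowP => j; apply/eqP; rewrite [X in _ == X]mxE -sqrf_eq0.
by apply: H; rewrite mem_index_enum.
Qed.

Lemma normalize v : v != 0 -> exists k : R, (k *: v) *m (k *: v)^T = 1%:M.
Proof.
move=> v0; pose q := (v *m v^T) 0 0.
have vq : v *m v^T = q%:M by rewrite [LHS]mx11_scalar.
have q0 : 0 < q.
  rewrite lt_neqAle sqnorm_ge0 andbT eq_sym; apply: contraNneq v0 => q0.
  by apply/eqP/sqnorm_eq0; rewrite vq q0 raddf0.
exists (Num.sqrt q)^-1.
rewrite linearZ /= -scalemxAl -scalemxAr scalerA vq scale_scalar_mx; congr (_%:M).
have s0 : Num.sqrt q != 0 by rewrite gt_eqF// sqrtr_gt0.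
by rewrite -[q in X in _ * X]sqr_sqrtr ?ltW//; field.
Qed.

(** Supplies the direction and the angle of a great circle from [v] to [w] in the image of [P]:
    normalize the part of [w] orthogonal to [v]. If [w] is [v] or [- v] any orthogonal direction
    will do, and [\tr P != 1] guarantees that one exists. *)
Lemma rotation_axis P v w : P^T = P -> P *m P = P -> \tr P != 1 ->
  v *m P = v -> v *m v^T = 1%:M -> w *m P = w -> w *m w^T = 1%:M ->
  exists (th : R) (u : 'rV[R]_m),
  [/\ u *m P = u, u *m v^T = 0, u *m u^T = 1%:M & w = cos th *: v + sin th *: u].
Proof.
move=> sP iP tP vP vv wP ww.
pose c0 := (w *m v^T) 0 0.
have wv : w *m v^T = c0%:M by rewrite [LHS]mx11_scalar.
have vw : v *m w^T = c0%:M by rewrite -[LHS]trmxK trmx_mul trmxK wv tr_scalar_mx.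
pose z := w - c0 *: v.
have zv : z *m v^T = 0.
  by rewrite mulmxBl wv -scalemxAl vv scale_scalar_mx mulr1 subrr.
have zP : z *m P = z by rewrite mulmxBl -scalemxAl wP vP.
have zz : z *m z^T = (1 - c0 ^+ 2)%:M.
  rewrite {2}/z linearB linearZ /= mulmxBr -scalemxAr zv scaler0 subr0.
  rewrite mulmxBl ww -scalemxAl vw scale_scalar_mx.
  by rewrite -raddfB expr2.
have c01 : 0 <= 1 - c0 ^+ 2 by have := sqnorm_ge0 z; rewrite zz mxE eqxx mulr1n.
have cB : -1 <= c0 <= 1.
  by rewrite -ler_norml -(@expr_le1 _ 2)// real_normK ?num_real// -subr_ge0.
have cth : cos (acos c0) = c0 by apply: acosK; rewrite in_itv.
have sth : sin (acos c0) ^+ 2 = 1 - c0 ^+ 2.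
  by have := cos2Dsin2 (acos c0); rewrite cth; lra.
exists (acos c0); rewrite cth.
have [s0|s0] := eqVneq (sin (acos c0)) 0; last first.
  exists ((sin (acos c0))^-1 *: z); split.
  - by rewrite -scalemxAl zP.
  - by rewrite -scalemxAl zv scaler0.
  - rewrite linearZ /= -scalemxAl -scalemxAr scalerA zz -sth scale_scalar_mx; congr (_%:M).
    by field.
  - by rewrite scalerA mulfV// scale1r /z addrC subrK.
have z0 : z = 0.
  by apply: sqnorm_eq0; rewrite zz -sth s0 expr0n /= raddf0.
(* The projection onto the complement of [v] in the image of [P]. Its trace is \tr P - 1, so it has
   a nonzero row, which is normalized to give [u]. *)
pose E := P - v^T *m v.
have E0 : E != 0.
  apply: contraNneq tP => E0; have := congr1 mxtrace E0.
  rewrite linearB /= mxtrace_mulC vv mxtrace1 linear0 => /eqP.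
  by rewrite subr_eq0.
have [i ri] : exists i, row i E != 0.
  apply/existsP; apply: contraNT E0 => /existsPn H; apply/eqP/row_matrixP => i.
  by rewrite row0; apply/eqP; have := H i; rewrite negbK.
have [k kk] := normalize ri.
exists (k *: row i E); split => //.
- rewrite -scalemxAl; congr (_ *: _).
  by rewrite -row_mul mulmxBl iP -mulmxA vP.
- rewrite -scalemxAl -row_mul mulmxBl -mulmxA vv mulmx1.
  have -> : P *m v^T = v^T by rewrite -{1}sP -trmx_mul vP.
  by rewrite subrr row0 scaler0.
- by rewrite s0 scale0r addr0; apply/eqP; rewrite -subr_eq0; apply/eqP.
Qed.

End Rotation.

(** * Completeness and surjectivity onto the cylinder *)

Section Surjectivity.
Variables (R : realType) (n : nat) (M : riemannian_manifold R n).
Variables (f xi : M -> 'rV[R]_n.+1).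
Hypothesis hf : isometric_immersion f.
Hypothesis hxi : unit_normal_field f xi.
Hypothesis M_complete : complete_manifold M.

(** The helix of the cylinder from [f p0] to [Y] in unit time fixes an initial velocity;
    completeness supplies a geodesic of M with that velocity, and its image is shown to follow the
    helix. *)
Lemma geodesic_reach (P : 'M[R]_n.+1) (b Y : 'rV[R]_n.+1) (rho : R) (p0 : M) :
  P^T = P -> P *m P = P -> \tr P != 1 -> rho != 0 -> b *m P = b ->
  (forall p, xi p *m P = xi p /\ f p *m P = b + rho *: xi p) ->
  (Y *m P - b) *m (Y *m P - b)^T = (rho ^+ 2)%:M ->
  exists q, f q = Y.
Proof.
move=> sP iP tP r0 bP fP YY.
have xx p : xi p *m (xi p)^T = 1%:M by have [_ u _] := hxi; exact: u.
pose w := rho^-1 *: (Y *m P - b).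
have wP : w *m P = w by rewrite -scalemxAl mulmxBl -mulmxA iP bP.
have ww : w *m w^T = 1%:M.
  rewrite linearZ /= -scalemxAl -scalemxAr scalerA YY scale_scalar_mx; congr (_%:M).
  by field.
have [th [u [uP uv uu wE]]] := rotation_axis sP iP tP (fP p0).1 (xx p0) wP ww.
pose Q := 1%:M - P.
(* The flat part is the whole flat displacement, covered in unit time; the curved part has the speed
   that sweeps the angle [th] in unit time on a circle of radius |rho|. *)
pose V := (Y - f p0) *m Q + (rho * th) *: u.
have [c Ac cp] := (atlas_smooth M).1 p0.
pose x := chart_fun c p0; have Ux : chart_img c x by exact: chart_fun_img.
pose F := local_expr f c; pose N := local_expr xi c.
have Nx : N x = xi p0 by rewrite /N /local_expr chart_funK.
have oU := @chart_img_open _ _ _ c.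
have Fs : smooth_on (chart_img c) F by exact: hf.1.
have FI := fun y => @hf.2 c y Ac.
have Nu : forall y, chart_img c y -> N y *m (N y)^T = 1%:M by move=> y _; exact: xx.
have Nn : forall y, chart_img c y -> 'J F y *m (N y)^T = 0.
  by move=> y Uy; have [_ _ nn] := hxi; exact: nn.
have Vn : V *m (xi p0)^T = 0.
  rewrite mulmxDl -scalemxAl uv scaler0 addr0 -mulmxA.
  have -> : Q *m (xi p0)^T = 0.
    by rewrite mulmxBl mul1mx -{1}sP -trmx_mul (fP p0).1 subrr.
  by rewrite mulmx0.
(* [V] is orthogonal to [xi p0], hence tangent, so the pseudo-inverse of the Jacobian recovers its
   chart coordinates. *)
pose v := V *m (('J F x)^T *m invmx (metric c x)).
have vJ : v *m 'J F x = V.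
  have := coframe_jac FI Nu Nn Ux; rewrite Nx => CJ.
  by rewrite /v -mulmxA CJ mulmxBr mulmx1 mulmxA Vn mul0mx subr0.
have [gam [geo g0 gv]] := M_complete v Ac cp.
have [alpha Hacc] := geodesic_acceleration hf hxi geo.
pose y (a : 'I_n.+1) (t : R) : R := f (gam t) 0 a.
pose dy (a : 'I_n.+1) (t : R) : R := derive1 (y a : R -> R^o) t.
have d1 (a : 'I_n.+1) (t : R) : is_derive t 1 (y a) (dy a t) := (Hacc a t).1.
have d2 (a : 'I_n.+1) (t : R) : is_derive t 1 (dy a) (alpha t * xi (gam t) 0 a) := (Hacc a t).2.
have y0 a : y a 0 = f p0 0 a by rewrite /y g0.
have dy0 a : dy a 0 = V 0 a.
  have c0 : chart_dom c (gam 0) by rewrite g0.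
  have [_ D] := d1 a 0; rewrite -D.
  have [dx _ _] := geo.2 0 c Ac c0.
  have Ux0 : chart_img c (chart_fun c (gam 0)) by rewrite g0.
  have [_ D'] := is_derive_curve oU (pos_smooth oU Fs a) Ux0 dx.
  rewrite -vJ mxE; under eq_bigr do rewrite (jac_pos oU Fs)//.
  have -> : v = 'D_1 (fun s => chart_fun c (gam s)) 0 by rewrite -derive1E gv.
  rewrite g0 in D'; rewrite -D'; apply: near_eq_derive.
  have dn : nbhs (gam 0) (chart_dom c).
    by apply: open_nbhs_nbhs; split => //; exact: chart_dom_open.
  have dn0 := geo.1 0 _ dn.
  have {}dn0 : \forall s \near (0 : R), chart_dom c (gam s) by exact: dn0.
  apply: filterS dn0 => s cs.
  by rewrite /y /pos /F /local_expr chart_funK.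
have lin (B : 'M[R]_n.+1) (j : 'I_n.+1) (t : R) :
    is_derive t 1 (fun s => (f (gam s) *m B) 0 j) (\sum_a dy a t * B a j) /\
    is_derive t 1 (fun s => \sum_a dy a s * B a j) (alpha t * (xi (gam t) *m B) 0 j).
  split.
    have := is_derive_sum_fun (fun a => is_derive_scale (B a j) (d1 a t)).
    by rewrite (_ : (fun s => \sum_i y i s * B i j) = (fun s => (f (gam s) *m B) 0 j));
       last by apply/funext => s; rewrite mxE.
  have := is_derive_sum_fun (fun a => is_derive_scale (B a j) (d2 a t)).
  by rewrite mxE mulr_sumr; under eq_bigr do rewrite -mulrA.
have V0 (B : 'M[R]_n.+1) j : \sum_a dy a 0 * B a j = (V *m B) 0 j.
  by rewrite mxE; apply: eq_bigr => a _; rewrite dy0.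
have QP : Q *m P = 0 by rewrite mulmxBl mul1mx iP subrr.
have QQ : Q *m Q = Q by rewrite {2}/Q mulmxBr mulmx1 QP subr0.
have VQ : V *m Q = (Y - f p0) *m Q.
  rewrite mulmxDl -mulmxA QQ -scalemxAl.
  have -> : u *m Q = 0 by rewrite mulmxBr mulmx1 uP subrr.
  by rewrite scaler0 addr0.
have VP : V *m P = (rho * th) *: u.
  by rewrite mulmxDl -mulmxA QP mulmx0 add0r -scalemxAl uP.
(* The acceleration is a multiple of xi, which [Q] annihilates; the flat component is affine in
   time. *)
have flat : f (gam 1) *m Q = Y *m Q.
  apply/rowP => j; have dQ (t : R) := (lin Q j t).1.
  have dQ2 (t : R) : \sum_a dy a t * Q a j = (V *m Q) 0 j.
    rewrite -V0; apply: (@is_derive0_cst _ (fun s => \sum_a dy a s * Q a j)) => s.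
    have := (lin Q j s).2.
    have -> : xi (gam s) *m Q = 0 by rewrite mulmxBr mulmx1 (fP (gam s)).1 subrr.
    by rewrite mxE mulr0.
  have dQc (t : R) : is_derive t 1 (fun s => (f (gam s) *m Q) 0 j) ((V *m Q) 0 j).
    by rewrite -(dQ2 t); exact: dQ.
  have E := is_derive_affine dQc; rewrite g0 VQ in E.
  by apply: etrans E _; rewrite mulmxBl [X in _ + X]mxE [X in _ + (_ + X)]mxE addrC subrK.
(* Since f P - b = rho xi, the acceleration is radial about [b] with factor alpha / rho, and
   [great_circle] applies. *)
have round : f (gam 1) *m P = Y *m P.
  have fb p : f p *m P - b = rho *: xi p by rewrite (fP p).2 addrC addKr.
  suff : f (gam 1) *m P - b = Y *m P - b by move=> /addIr.
  have -> : Y *m P - b = rho *: w by rewrite /w scalerA mulfV// scale1r.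
  apply/rowP => j.
  have := @great_circle _ n.+1 (fun j s => (f (gam s) *m P) 0 j - b 0 j)
    (fun j s => \sum_a dy a s * P a j) (fun t => alpha t / rho) rho th
    (fun j => rho * xi p0 0 j) (fun j => rho * u 0 j).
  have GE k s : (f (gam s) *m P) 0 k - b 0 k = rho * xi (gam s) 0 k.
    have := congr1 (fun z : 'rV[R]_n.+1 => z 0 k) (fb (gam s)).
    by rewrite mxE [X in _ = X -> _]mxE [X in _ + X = _ -> _]mxE.
  have GL : (f (gam 1) *m P - b) 0 j = (f (gam 1) *m P) 0 j - b 0 j.
    by rewrite mxE [X in _ + X = _]mxE.
  have WR : (rho *: w) 0 j = rho * xi p0 0 j * cos th + rho * u 0 j * sin th.
    by rewrite wE !mxE; ring.
  rewrite GL WR; apply => //.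
  - move=> k t; have := is_deriveB (lin P k t).1 (is_derive_cst (b 0 k) t 1).
    by rewrite subr0.
  - move=> k t; have := (lin P k t).2; rewrite (fP (gam t)).1.
    by move=> D; apply: is_derive_eq D _; rewrite GE; field.
  - move=> t; rewrite (eq_bigr (fun k => rho ^+ 2 * xi (gam t) 0 k ^+ 2)).
      by rewrite -mulr_sumr -sqnormE xx mxE eqxx mulr1n mulr1.
    by move=> k _; rewrite GE exprMn.
  - by move=> k; rewrite GE g0.
  - by move=> k; rewrite V0 VP mxE; ring.
  - rewrite (eq_bigr (fun k => rho ^+ 2 * u 0 k ^+ 2)).
      by rewrite -mulr_sumr -sqnormE uu mxE eqxx mulr1n mulr1.
    by move=> k _; rewrite exprMn.
exists (gam 1).
have split z : z = z *m P + z *m Q :> 'rV[R]_n.+1.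
  by rewrite -mulmxDr /Q addrC subrK mulmx1.
by rewrite [LHS]split [RHS]split flat round.
Qed.

End Surjectivity.

(** * The cylinder *)

(** The trace is [k.+1] because the k-sphere spans k + 1 dimensions. Only squares of [rho] and [r]
    are compared, as [rho] carries the sign of the normal. Orthonormal coordinates adapted to [P],
    translated by the centre [b], provide the rigid motion. *)
Lemma cylinder_range (R : realType) (n k : nat) (T : Type) (f xi : T -> 'rV[R]_n.+1)
    (P : 'M[R]_n.+1) (b : 'rV[R]_n.+1) (rho r : R) :
  P^T = P -> P *m P = P -> \tr P = k.+1%:R -> b *m P = b -> rho ^+ 2 = r ^+ 2 ->
  (forall p, xi p *m (xi p)^T = 1%:M) ->
  (forall p, f p *m P = b + rho *: xi p) ->
  (forall Y, (Y *m P - b) *m (Y *m P - b)^T = (rho ^+ 2)%:M -> exists q, f q = Y) ->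
  exists2 T : 'rV[R]_n.+1 -> 'rV[R]_n.+1, rigid_motion T & range f = T @` cylinder n k r.
Proof.
move=> sP iP tP bP rr xx fP reach.
have [Q [QQ QP]] := proj_diag sP iP tP.
have QQ' : Q^T *m Q = 1%:M by exact: mulmx1C.
pose mask (x : 'rV[R]_n.+1) : 'rV[R]_n.+1 := \row_j (if (n.+1 - k.+1 <= j)%N then x 0 j else 0).
have maskE x : (mask x *m (mask x)^T) 0 0 = \sum_(j < n.+1 | (n - k <= j)%N) x 0 j ^+ 2.
  rewrite sqnormE [RHS]big_mkcond; apply: eq_bigr => j _; rewrite mxE subSS.
  by case: ifP; rewrite ?expr0n.
have maskQ x : (mask x *m Q) *m (mask x *m Q)^T = mask x *m (mask x)^T.
  by rewrite trmx_mul mulmxA -(mulmxA (mask x)) QQ mulmx1.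
exists (fun x => x *m Q + b); first by exists Q, b.
apply/seteqP; split => [_ [p _ <-]|_ [x cx <-]].
  exists ((f p - b) *m Q^T); last by rewrite -mulmxA QQ' mulmx1 subrK.
  rewrite /cylinder /= -maskE -maskQ -QP -(mulmxA _ Q^T) QQ' mulmx1.
  rewrite mulmxBl bP fP addrC addKr linearZ /= -scalemxAl -scalemxAr scalerA xx.
  by rewrite !mxE eqxx mulr1 -expr2.
have [|q <-] := reach (x *m Q + b); last by exists q.
have -> : (x *m Q + b) *m P - b = x *m Q *m P by rewrite mulmxDl bP addrK.
rewrite QP maskQ [LHS]mx11_scalar maskE.
by rewrite rr; congr (_%:M).
Qed.

Theorem theorem1p3 (R : realType) (n : nat) (hn : (3 <= n)%N)
  (M : riemannian_manifold R n)
  (M_nonempty : [set: M] !=set0)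
  (M_connected : connected [set: M])
  (M_complete : complete_manifold M)
  (M_orientable : orientable M)
  (S : R) (hS : forall p : M, is_scalar_curvature p S)
  (f : M -> 'rV[R]_n.+1) (hf : isometric_immersion f)
  (xi : M -> 'rV[R]_n.+1) (hxi : unit_normal_field f xi)
  (lam : M -> 'rV[R]_n)
  (hlam : forall p : M, principal_curvatures f xi p (lam p))
  (H : R) (hH : forall p : M, mean_curvature 1 (lam p) = H) (H_neq0 : H != 0)
  (hH3 : forall p : M, 0 <= H * mean_curvature 3 (lam p))
  (S_ge0 : 0 <= S) (S_le : S <= n%:R * H ^+ 2 / (2 * (n%:R - 1))) :
  (S = 0 \/ S = n%:R * H ^+ 2 / (2 * (n%:R - 1))) /\
  (S = 0 ->
     exists2 T : 'rV[R]_n.+1 -> 'rV[R]_n.+1, rigid_motion T &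
       range f = T @` cylinder n 1 (1 / (n%:R * `|H|))) /\
  (S = n%:R * H ^+ 2 / (2 * (n%:R - 1)) ->
     exists2 T : 'rV[R]_n.+1 -> 'rV[R]_n.+1, rigid_motion T &
       range f = T @` cylinder n 2 (2 / (n%:R * `|H|))).
Proof.
have [p0 _] := M_nonempty.
have [c Ac cp] := (atlas_smooth M).1 p0.
have SE := simons_eq hn hS hf hxi hlam hH hH3 S_ge0 S_le Ac (chart_fun_img cp).
have [P [b [sP iP tP bP fP]]] :=
  curved_structure hn M_connected hS hf hxi hlam hH H_neq0 hH3 S_ge0 S_le p0.
have n0 : (n%:R : R) != 0 by rewrite pnatr_eq0 -lt0n; exact: leq_trans hn.
have n1 : (n%:R : R) - 1 != 0.
  by rewrite subr_eq0 pnatr_eq1 gtn_eqF//; exact: leq_trans hn.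
have C2 : 'C(n, 2)%:R = n%:R * (n%:R - 1) / 2 :> R.
  by apply: (mulfI (_ : 2 != 0 :> R)); rewrite ?pnatr_eq0// (natr_bin2 R hn); field.
have xx p : xi p *m (xi p)^T = 1%:M by have [_ u _] := hxi; exact: u.
have HH : `|H| ^+ 2 = H ^+ 2 by rewrite real_normK ?num_real.
have aH : `|H| != 0 by rewrite normr_eq0.
have cyl k r rho : (1 < k.+1)%N -> rho != 0 -> rho ^+ 2 = r ^+ 2 -> \tr P = k.+1%:R ->
    (forall p, xi p *m P = xi p /\ f p *m P = b + rho *: xi p) ->
    exists2 T : 'rV[R]_n.+1 -> 'rV[R]_n.+1, rigid_motion T & range f = T @` cylinder n k r.
  move=> k1 rho0 rr trP fP'.
  apply: (cylinder_range sP iP trP bP rr xx (fun p => (fP' p).2)) => Y.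
  have trP1 : \tr P != 1 by rewrite trP pnatr_eq1 gtn_eqF.
  exact: (geodesic_reach hf hxi M_complete p0 sP iP trP1 rho0 bP fP').
split; [|split].
- move: SE => /eqP; rewrite mulf_eq0 => /orP[/eqP E|/eqP E]; [left|right].
    apply/eqP; move/eqP: E; rewrite mulf_eq0 => /orP[|//].
    by rewrite C2 !mulf_eq0 invr_eq0 (negbTE n0) (negbTE n1) pnatr_eq0.
  have n10 : 2 * (n%:R - 1 : R) != 0 by rewrite mulf_neq0.
  apply: (mulIf n10); rewrite divfK//; apply: (mulfI n0).
  move/eqP: E; rewrite subr_eq0 C2 => /eqP E.
  by transitivity ((n%:R * H) ^+ 2); [rewrite E; field|ring].
(* Here p2 = p1^2, so rho = 1 / p1 and the trace of [P] is 2: one curved direction and the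
   normal. *)
- move=> S0; have rhoE :
      - (n%:R * H) / ((n%:R * H) ^+ 2 - 2 * ('C(n, 2)%:R * S)) = - (n%:R * H)^-1.
    by rewrite S0; field; rewrite H_neq0 n0.
  rewrite rhoE in tP fP; apply: (cyl _ _ _ _ _ _ _ fP) => //.
  + by rewrite oppr_eq0 invr_eq0 mulf_neq0.
  + by rewrite sqrrN div1r !exprVn !exprMn HH.
  + by rewrite tP; field; rewrite H_neq0 n0.
(* Here p2 = p1^2 / 2, so rho = 2 / p1 and the trace of [P] is 3: two curved directions and the
   normal. *)
- move=> S1; have rhoE :
      - (n%:R * H) / ((n%:R * H) ^+ 2 - 2 * ('C(n, 2)%:R * S)) = - (2 / (n%:R * H)).
    have -> : (n%:R * H) ^+ 2 - 2 * ('C(n, 2)%:R * S) = (n%:R * H) ^+ 2 / 2.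
      by rewrite C2 S1; field; rewrite n1.
    by field; rewrite H_neq0 n0.
  rewrite rhoE in tP fP; apply: (cyl _ _ _ _ _ _ _ fP) => //.
  + by rewrite oppr_eq0 mulf_neq0 ?pnatr_eq0// invr_eq0 mulf_neq0.
  + by rewrite sqrrN !expr_div_n !exprMn HH.
  + by rewrite tP; field; rewrite H_neq0 n0.
Qed.
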